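(* Let $H$ be a separable Hilbert space and $\mathcal A\subseteq\mathcal B(H)$ a $\mathrm{II}_1$-factor. If $\psi\in H$ is a trace vector for $\mathcal A$, then $\psi$ is approximately convertible to $\varphi$ via $\mathrm{LOCC}(\mathcal A)$ for every unit vector $\varphi\in H$. Conversely, if there exists a trace vector $\psi_0\in H$ for $\mathcal A$, and $\psi\in H$ is a unit vector which is approximately convertible to every unit vector $\varphi\in H$ via $\mathrm{LOCC}(\mathcal A)$, then $\psi$ is a trace vector for $\mathcal A$.
   Context: Normal means weak*-continuous. Inner products are linear in the first argument. For $\psi\in H$, $\omega_\psi(x)=(x\psi,\psi)$, $x\in\mathcal B(H)$. A unit vector $\psi\in H$ is a *trace vector* for a finite factor $\mathcal A\subseteq\mathcal B(H)$ if $\omega_\psi|_{\mathcal A}=\tau$, the unique (normal) tracial state on $\mathcal A$. **LOCC maps.** Let $\mathcal A\subseteq\mathcal B(H)$ be a von Neumann algebra and $\mathcal B=\mathcal A'$ its commutant. For a von Neumann subalgebra $\mathcal C\subseteq \mathcal B(H)$, $\mathrm{CP}^\sigma_{\mathcal C}(\mathcal B(H))$ is the set of normal completely positive maps $\Phi:\mathcal B(H)\to\mathcal B(H)$ with $\Phi(axb)=a\Phi(x)b$ for all $a,b\in\mathcal C$, $x\in\mathcal B(H)$; $\mathrm{UCP}^\sigma_{\mathcal C}(\mathcal B(H))$ is the subset of unital ones. - A *one-way right local map* relative to $\mathcal A$ is a map $\Phi\circ\Psi$ with $\Phi\in\mathrm{UCP}^\sigma_{\mathcal A}(\mathcal B(H))$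 and $\Psi\in\mathrm{CP}^\sigma_{\mathcal B}(\mathcal B(H))$; a *one-way left local map* is a map $\Phi\circ\Psi$ with $\Phi\in\mathrm{CP}^\sigma_{\mathcal A}(\mathcal B(H))$ and $\Psi\in\mathrm{UCP}^\sigma_{\mathcal B}(\mathcal B(H))$. - An *instrument* is a collection $\mathcal I=(\Theta_k)_{k\in\mathbb N}$ of normal completely positive maps on $\mathcal B(H)$ such that $\sum_k\Theta_k(x)$ converges weak* to a limit $\Theta_{\mathcal I}(x)$ for every $x\in\mathcal B(H)$, and $\Theta_{\mathcal I}$ is a normal unital completely positive map. Instruments differing only by a bijective relabelling of the index set are identified. - A *one-way right (left) instrument* relative to $\mathcal A$ is an instrument all of whose maps are one-way right (left) local maps relative to $\mathcal A$; a *one-way (local) instrument* is one which is either a one-way right or a one-way left instrument. - An instrument $(\Gamma_j)_{j\in\mathbb N}$ is a *coarse-graining* of $(\Theta_k)_{k\in\mathbb N}$ if there is a partition $\mathbb N=\bigcup_j S_j$ with $\Gamma_j=\sum_{k\in S_j}\Theta_k$ (point-weak* convergent) for all $j$. - An instrument $\mathcal J$ is *linked* to $\mathcal I=(\Theta_k)_k$ if there are one-way instruments $(\Theta_{ki})_{i\in\mathbb N}$, $k\in\mathbb N$, relative to $\mathcal A$ such that $\mathcal J$ is a coarse-graining of $(\Theta_k\circ\Theta_{ki})_{i,k\in\mathbb N}$. - A normal unital completely positive map $\Theta$ on $\mathcal B(H)$ is in $\mathrm{LOCC}(\mathcal A)$ if there are instruments $\mathcal I_0,\dots,\mathcal I_n$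 such that $\mathcal I_0$ is a one-way local instrument relative to $\mathcal A$, $\mathcal I_{l+1}$ is linked to $\mathcal I_l$ for $l=0,\dots,n-1$, and $\Theta=\Theta_{\mathcal I_n}$. **Convertibility.** For a normal map $\Theta$ on $\mathcal B(H)$, $\Theta_*$ is its predual, $\Theta_*(\omega)=\omega\circ\Theta$ for $\omega\in\mathcal B(H)_*$. A unit vector $\psi$ is *approximately convertible* to a unit vector $\varphi$ via $\mathrm{LOCC}(\mathcal A)$ if for every $\varepsilon>0$ there is $\Theta\in\mathrm{LOCC}(\mathcal A)$ with $\|\Theta_*(\omega_\psi)-\omega_\varphi\|<\varepsilon$. *)

(* Defs.v *)
From HB Require Import structures.
From mathcomp Require Import all_boot all_order all_algebra.
From mathcomp Require Import complex.
From mathcomp Require Import all_classical all_reals all_analysis.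

Set Implicit Arguments.
Unset Strict Implicit.
Unset Printing Implicit Defensive.

Import Order.TTheory GRing.Theory Num.Theory.
Import numFieldNormedType.Exports.

Local Open Scope classical_set_scope.
Local Open Scope ring_scope.
Local Open Scope complex_scope.

(* In [{dot _ for Num.conj}], the form is linear in its first argument and
   conjugate-linear in its second one. Norms on a normed module over [R[i]]
   take their values in [R[i]]. *)
Structure hilbertType (R : realType) := Hilbert {
  hilbert_sort :> completeNormedModType R[i];
  inner : {dot hilbert_sort for Num.conj};
  inner_norm : forall x : hilbert_sort, inner x x = `|x| ^+ 2 }.

Definition separable (R : realType) (H : hilbertType R) :=
  exists2 D : set H, countable D & dense D.

Section BoundedOperators.
Context (R : realType) (H : hilbertType R).

Definition bounded_operator : {pred H -> H} :=
  [pred f : H -> H | `[< linear f /\ continuous f >]].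

Record bop := Bop { bop_fun :> H -> H; bop_funP : bop_fun \in bounded_operator }.

HB.instance Definition _ := [isSub for bop_fun].
HB.instance Definition _ := [Choice of bop by <:].

Lemma bounded_operator_submod_closed : submod_closed bounded_operator.
Proof.
split=> [|c f g].
  apply/asboolP; split=> [k x y|x]; last exact: (@cvg_cst H).
  by change ((0 : H) = k *: (0 : H) + 0); rewrite scaler0 addr0.
move=> /asboolP[fl fc] /asboolP[gl gc]; apply/asboolP; split=> [k x y|x].
  change (c *: f (k *: x + y) + g (k *: x + y)
          = k *: (c *: f x + g x) + (c *: f y + g y)).
  by rewrite fl gl !scalerDr !scalerA (mulrC c) addrACA.
by apply: (@cvgD _ _ _ (nbhs x)); [apply: cvgZl_tmp; exact: fc | exact: gc].
Qed.

HB.instance Definition _ := GRing.isSubmodClosed.Build R[i] (H -> H)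
  bounded_operator bounded_operator_submod_closed.
HB.instance Definition _ := [SubChoice_isSubLmodule of bop by <:].

Lemma bounded_operator_id : (id : H -> H) \in bounded_operator.
Proof. by apply/asboolP; split=> // x; exact: cvg_id. Qed.

Lemma bounded_operator_comp (x y : bop) :
  ((x : H -> H) \o (y : H -> H)) \in bounded_operator.
Proof.
have /asboolP[xl xc] := bop_funP x; have /asboolP[yl yc] := bop_funP y.
apply/asboolP; split=> [k u v /=|u]; first by rewrite yl xl.
by apply: continuous_comp; [exact: yc | exact: xc].
Qed.


Definition bop1 : bop := Bop bounded_operator_id.
Definition bop_mul (x y : bop) : bop := Bop (bounded_operator_comp x y).

Definition is_adjoint (x y : bop) : Prop :=
  forall u v : H, inner H (x u) v = inner H u (y v).

Definition vector_functional (psi : H) : bop -> R[i] :=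
  fun x => inner H (x psi) psi.

(* The predual of [bop]: the functionals [x |-> \sum_n (x (xi n), eta n)]
   with square-summable [xi] and [eta]. *)
Definition normal_functional (w : bop -> R[i]) : Prop :=
  exists xi eta : nat -> H,
    [/\ cvgn (series (fun n => `|xi n| ^+ 2 : R[i]^o)),
        cvgn (series (fun n => `|eta n| ^+ 2 : R[i]^o)) &
        forall x : bop,
          series (fun n => inner H (x (xi n)) (eta n) : R[i]^o) @ \oo --> (w x : R[i]^o)].

Definition predual : Type := {w : bop -> R[i] | normal_functional w}.
HB.instance Definition _ := gen_eqMixin predual.
HB.instance Definition _ := gen_choiceMixin predual.

Definition weakstar : topologicalType :=
  initial_topology
    (fun (x : bop) => (fun w : predual => sval w x) : {ptws predual -> R[i]^o}).

(* Valued in the extended reals so that the supremum is never a default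
   value. *)
Definition functional_norm (w : bop -> R[i]) : \bar R :=
  ereal_sup [set (complex.Re `|w x|)%:E |
             x in [set x : bop | forall u : H, `|x u| <= `|u|]].

Definition commutant (A : set bop) : set bop :=
  [set y | forall x, A x -> bop_mul x y = bop_mul y x].

Definition star_subalgebra (A : set bop) : Prop :=
  [/\ A 0, forall (c : R[i]) x y, A x -> A y -> A (c *: x + y),
      forall x y, A x -> A y -> A (bop_mul x y) &
      forall x, A x -> exists2 y, A y & is_adjoint x y].

Definition von_neumann_algebra (A : set bop) : Prop :=
  star_subalgebra A /\ commutant (commutant A) = A.

Definition factor (A : set bop) : Prop :=
  [/\ von_neumann_algebra A, bop1 <> 0 &
      A `&` commutant A = [set c *: bop1 | c in [set: R[i]]]].

Definition finite_vn (A : set bop) : Prop :=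
  forall v w, A v -> is_adjoint v w -> bop_mul w v = bop1 -> bop_mul v w = bop1.

Definition projection (p : bop) : Prop := bop_mul p p = p /\ is_adjoint p p.

Definition corner (A : set bop) (p : bop) : set bop :=
  [set bop_mul p (bop_mul x p) | x in A].

Definition abelian_projection (A : set bop) (p : bop) : Prop :=
  [/\ A p, projection p &
      forall x y, corner A p x -> corner A p y -> bop_mul x y = bop_mul y x].

Definition II1_factor (A : set bop) : Prop :=
  [/\ factor A, finite_vn A & forall p, abelian_projection A p -> p = 0].

Definition tracial_state (A : set bop) (tau : bop -> R[i]) : Prop :=
  [/\ forall (c : R[i]) x y, A x -> A y -> tau (c *: x + y) = c * tau x + tau y,
      forall x y, A x -> is_adjoint x y -> 0 <= tau (bop_mul y x),
      tau bop1 = 1 &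
      forall x y, A x -> A y -> tau (bop_mul x y) = tau (bop_mul y x)].

Definition normal_on (A : set bop) (tau : bop -> R[i]) : Prop :=
  {within (A : set weakstar), continuous (tau : weakstar -> R[i]^o)}.

(* A finite factor has exactly one tracial state, and it is normal. *)
Definition trace_vector (A : set bop) (psi : H) : Prop :=
  `|psi| = 1 /\
  exists tau, [/\ tracial_state A tau, normal_on A tau &
    forall a, A a -> vector_functional psi a = tau a].

(* [v] ranges over the [n]-fold direct sum of [H], on which [X] acts. *)
Definition positive_opmx n (X : 'M[bop]_n) : Prop :=
  forall v : 'I_n -> H, 0 <= \sum_(i < n) \sum_(j < n) inner H (X i j (v j)) (v i).

Definition completely_positive (T : bop -> bop) : Prop :=
  linear T /\ forall n (X : 'M[bop]_n), positive_opmx X -> positive_opmx (map_mx T X).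

Definition normal_map (T : bop -> bop) : Prop :=
  continuous (T : weakstar -> weakstar).

Definition normal_cp (T : bop -> bop) : Prop :=
  completely_positive T /\ normal_map T.

Definition normal_ucp (T : bop -> bop) : Prop := normal_cp T /\ T bop1 = bop1.

Definition bimodule_map (C : set bop) (T : bop -> bop) : Prop :=
  forall a b x, C a -> C b ->
    T (bop_mul a (bop_mul x b)) = bop_mul a (bop_mul (T x) b).

Definition CPsigma (C : set bop) : set (bop -> bop) :=
  [set T | normal_cp T /\ bimodule_map C T].

Definition UCPsigma (C : set bop) : set (bop -> bop) :=
  [set T | normal_ucp T /\ bimodule_map C T].

Definition right_local (A : set bop) : set (bop -> bop) :=
  [set P \o Q | P in UCPsigma A & Q in CPsigma (commutant A)].

Definition left_local (A : set bop) : set (bop -> bop) :=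
  [set P \o Q | P in CPsigma A & Q in UCPsigma (commutant A)].

(* [G] is the point-weak* limit of [\sum_(k in S) I k]. *)
Definition sum_over (S : set nat) (I : nat -> bop -> bop) (G : bop -> bop) : Prop :=
  forall x, (fun n => (\sum_(0 <= k < n | k \in S) I k x : weakstar)) @ \oo
            --> (G x : weakstar).

Definition total_map (I : nat -> bop -> bop) (T : bop -> bop) : Prop :=
  sum_over [set: nat] I T.

Definition instrument (I : nat -> bop -> bop) : Prop :=
  (forall k, normal_cp (I k)) /\ exists2 T, normal_ucp T & total_map I T.

Definition one_way_right (A : set bop) (I : nat -> bop -> bop) : Prop :=
  instrument I /\ forall k, right_local A (I k).

Definition one_way_left (A : set bop) (I : nat -> bop -> bop) : Prop :=
  instrument I /\ forall k, left_local A (I k).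

Definition one_way (A : set bop) (I : nat -> bop -> bop) : Prop :=
  one_way_right A I \/ one_way_left A I.

(* Empty blocks are allowed: finite instruments are families padded with zero
   maps. *)
Definition coarse_graining (J I : nat -> bop -> bop) : Prop :=
  exists S : nat -> set nat,
    [/\ cover [set: nat] S = [set: nat], trivIset [set: nat] S &
        forall j, sum_over (S j) I (J j)].

(* [e] relabels the double family by natural numbers. *)
Definition linked (A : set bop) (J I : nat -> bop -> bop) : Prop :=
  instrument J /\
  exists2 K : nat -> nat -> bop -> bop, forall k, one_way A (K k) &
  exists2 e : nat -> nat * nat, bijective e &
    coarse_graining J (fun m => I (e m).1 \o K (e m).1 (e m).2).

Definition LOCC (A : set bop) : set (bop -> bop) :=
  [set T | normal_ucp T /\
     exists (n : nat) (I : nat -> nat -> bop -> bop),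
       [/\ one_way A (I 0%N),
           forall l, (l < n)%N -> linked A (I l.+1) (I l) &
           total_map (I n) T]].

Definition predual_map (T : bop -> bop) (w : bop -> R[i]) : bop -> R[i] := w \o T.

Definition approx_convertible (A : set bop) (psi phi : H) : Prop :=
  forall eps : R, 0 < eps -> exists2 T, LOCC A T &
    (functional_norm (predual_map T (vector_functional psi)
                      \- vector_functional phi)%R < eps%:E)%E.

End BoundedOperators.

(* Main.v *)
(* The converse rests on an entanglement monotone. Call [F >= 0] dominated if
   [F <= tau(x^-1) x] for every positive invertible [x] in [A]. The projection onto the trace
   vector is dominated by the Cauchy-Schwarz inequality for the form [x], and LOCC maps preserve
   domination: maps in [CPsigma (commutant A)] are handled through Kraus operators [a] in [A], with
   [x] replaced by the inverse of [a x^-1 a^* + d]. If [psi] converts to the trace vector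
   [psi0], this gives [1 <= tau(x^-1) (x psi, psi)] for all [x], and expanding at [x = 1 + t h]
   to first order in [t] yields [(h psi, psi) = tau(h)].

   For the direct part, the trace vector [psi] is cyclic for the commutant, so [phi] is close to
   a unit vector [t psi] with [t] in the commutant. By averaging over the unitaries of the factor,
   a convex combination [s = \sum_p l_p T_p^* T_p] with [T_p psi = t v_p^* psi] satisfies
   [s psi ~ psi]. With [f = 2 (1 + s)^-1] and [r = (1 - s) (1 + s)^-1] one has [f s f + r^2 = 1],
   so [sqrt(l_p) T_p f] and [r] form a measurement in the commutant; after outcome [p] the
   unitary [v_p] restores [v_p T_p psi = t psi]. *)

(* Two difficulties shape the converse. Instruments may have infinitely many outcomes and each round
   may depend on the previous outcome; so the monotone is an operator inequality, which passes to
   limits, and it is propagated for families with a different dominated operator at each outcome.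
   Moreover a completely positive map is not given in Kraus form: for one vector at a time, finitely
   many Kraus terms are split off so that the remainder vanishes on a finite-rank projection, and
   normality with separability makes the remainder small on the complement.

   Square roots and polar decompositions of operators are avoided. The inverses come from
   [(1 + s)^-1] with [s >= 0], positivity of [tau(D y)] comes from an iteration in [y], and the
   measurement of the direct part is rational in [s], so that its completeness is an algebraic
   identity. The outcome [r] is rare because [r psi = (1 + s)^-1 (psi - s psi)].

   The operator [T_p] is defined by sending [a psi] to [a t v_p^* psi] for [a] in [A]; the trace
   property makes the passage from [a psi] to [a v_p^* psi] isometric, hence [T_p] bounded. *)
From HB Require Import structures.
Require Import Defs.
From mathcomp Require Import all_boot all_order all_algebra.
From mathcomp Require Import complex ring lra.
From mathcomp Require Import all_classical all_reals all_analysis.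

Set Implicit Arguments.
Unset Strict Implicit.
Unset Printing Implicit Defensive.

Import Order.TTheory GRing.Theory Num.Theory.
Import numFieldNormedType.Exports.

Local Open Scope classical_set_scope.
Local Open Scope ring_scope.
Local Open Scope complex_scope.

(** * Geometry of Hilbert spaces *)

Section Scalars.
Context (R : realType).
Local Notation re := (@complex.Re R).
Local Notation im := (@complex.Im R).

Definition normc2 (z : R[i]) : R := re z ^+ 2 + im z ^+ 2.

Lemma reD (x y : R[i]) : re (x + y) = re x + re y.
Proof. by case: x y => [a b] [c d]. Qed.
Lemma reN (x : R[i]) : re (- x) = - re x.
Proof. by case: x. Qed.
Lemma reB (x y : R[i]) : re (x - y) = re x - re y.
Proof. by rewrite reD reN. Qed.
Lemma reZ (r : R) (x : R[i]) : re (r%:C * x) = r * re x.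
Proof. by case: x => a b /=; rewrite mul0r subr0. Qed.
Lemma reJ (x : R[i]) : re (Num.conj x) = re x.
Proof. by case: x. Qed.
Lemma re_sum (I : Type) (s : seq I) (P : pred I) (F : I -> R[i]) :
  re (\sum_(i <- s | P i) F i) = \sum_(i <- s | P i) re (F i).
Proof. by apply: (big_morph re reD). Qed.

Lemma normc2_ge0 z : 0 <= normc2 z.
Proof. by rewrite addr_ge0 ?sqr_ge0. Qed.
Lemma normc2J z : normc2 (Num.conj z) = normc2 z.
Proof. by case: z => a b; rewrite /normc2 /= sqrrN. Qed.
Lemma normc2M z w : normc2 (z * w) = normc2 z * normc2 w.
Proof. by case: z w => a b [c d]; rewrite /normc2 /=; ring. Qed.
Lemma normc2_real (r : R) : normc2 r%:C = r ^+ 2.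
Proof. by rewrite /normc2 /= expr0n addr0. Qed.
Lemma re_sqr_le z : re z ^+ 2 <= normc2 z.
Proof. by rewrite lerDl sqr_ge0. Qed.
Lemma normc2E z : `|z| = (Num.sqrt (normc2 z))%:C.
Proof. by rewrite normc_def. Qed.
Lemma mulcJ z : z * Num.conj z = (normc2 z)%:C.
Proof. by case: z => a b; apply/eqP; rewrite eq_complex /normc2 /=; apply/andP; split; apply/eqP; ring. Qed.

Lemma ge0_re (z : R[i]) : 0 <= z -> z = (re z)%:C /\ 0 <= re z.
Proof.
case: z => a b; rewrite lecE /= => /andP[/eqP -> ->].
by split.
Qed.

(** The discriminant argument along the direction [- t * conj c] with [t] real. The Cauchy-Schwarz
    inequalities below reduce to it. *)
Lemma quadratic_normc2 (a b : R) (c : R[i]) : 0 <= b ->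
  (forall z : R[i], 0 <= a + 2 * re (z * c) + normc2 z * b) ->
  normc2 c <= a * b.
Proof.
move=> b0 h; have c0 := normc2_ge0 c.
have reJc t : re (((- t)%:C * Num.conj c) * c) = - t * normc2 c.
  by case: c h c0 => x y h c0; rewrite /normc2 /=; ring.
have nJc t : normc2 ((- t)%:C * Num.conj c) = t ^+ 2 * normc2 c.
  by rewrite normc2M normc2_real normc2J sqrrN.
have {}h t : 0 <= a - 2 * t * normc2 c + t ^+ 2 * normc2 c * b.
  by have := h ((- t)%:C * Num.conj c); rewrite reJc nJc; lra.
move: b0; rewrite le_eqVlt => /orP[/eqP b0|b0].
  rewrite -b0 mulr0 leNgt; apply/negP => c1.
  (* With [b = 0] the form is affine in [t]; at this point it takes the value -1. *)
  have := h ((a + 1) / (2 * normc2 c)).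
  rewrite -b0 mulr0 addr0.
  have -> : 2 * ((a + 1) / (2 * normc2 c)) * normc2 c = a + 1.
    by field; lra.
  lra.
(* The minimiser of the form in [t]. *)
have := h b^-1.
have -> : a - 2 * b^-1 * normc2 c + b^-1 ^+ 2 * normc2 c * b =
          (a * b - normc2 c) / b by field; lra.
by rewrite pmulr_lge0 ?invr_gt0// subr_ge0.
Qed.

End Scalars.

Section Geometry.
Context (R : realType) (H : hilbertType R).
Implicit Types u v w : H.
Local Notation re := (@complex.Re R).
Local Notation "'[ u , v ]" := (inner H u v).

Lemma ipC u v : '[u, v] = Num.conj '[v, u].
Proof. by rewrite hermC expr0 mul1r. Qed.
Lemma ipDl u v w : '[u + v, w] = '[u, w] + '[v, w].
Proof. by rewrite linearDl. Qed.
Lemma ipDr u v w : '[w, u + v] = '[w, u] + '[w, v].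
Proof. by rewrite linearDr. Qed.
Lemma ipNl u w : '[- u, w] = - '[u, w].
Proof. by rewrite linearNl. Qed.
Lemma ipNr u w : '[w, - u] = - '[w, u].
Proof. by rewrite linearNr. Qed.
Lemma ipBl u v w : '[u - v, w] = '[u, w] - '[v, w].
Proof. by rewrite ipDl ipNl. Qed.
Lemma ipBr u v w : '[w, u - v] = '[w, u] - '[w, v].
Proof. by rewrite ipDr ipNr. Qed.
Lemma ipZl c u w : '[c *: u, w] = c * '[u, w].
Proof. by rewrite linearZl_LR. Qed.
Lemma ipZr c u w : '[w, c *: u] = Num.conj c * '[w, u].
Proof. by rewrite linearZr_LR. Qed.
Lemma ip0l w : '[0, w] = 0.
Proof. by rewrite linear0l. Qed.
Lemma ip0r w : '[w, 0] = 0.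
Proof. by rewrite linear0r. Qed.
Lemma ip_suml I (s : seq I) (P : pred I) (F : I -> H) w :
  '[\sum_(i <- s | P i) F i, w] = \sum_(i <- s | P i) '[F i, w].
Proof. by apply: (big_morph (fun u => '[u, w])) => [u v|]; rewrite ?ipDl ?ip0l. Qed.
(** Norms take values in [R[i]]; [sq] and [nr] are real-valued counterparts, so that estimates take
    place in an ordered field. *)
Definition sq u : R := re '[u, u].

Lemma ip_sq u : '[u, u] = (sq u)%:C.
Proof.
have /ge0_re[] // : 0 <= '[u, u] by rewrite inner_norm exprn_ge0.
Qed.
Lemma sq_ge0 u : 0 <= sq u.
Proof. by rewrite -lecR -ip_sq inner_norm exprn_ge0. Qed.
Lemma sq_eq0 u : sq u = 0 -> u = 0.
Proof.
move=> u0; apply/eqP; rewrite -normr_eq0 -sqrf_eq0 -inner_norm ip_sq u0.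
exact: eqxx.
Qed.

Lemma ip_eq0 u : (forall v, '[u, v] = 0) -> u = 0.
Proof. by move=> h; apply: sq_eq0; rewrite /sq h. Qed.

Lemma ip_inj u v : (forall w, '[u, w] = '[v, w]) -> u = v.
Proof.
by move=> h; apply/eqP; rewrite -subr_eq0; apply/eqP/ip_eq0 => w; rewrite ipBl h subrr.
Qed.

Lemma re_ipC u v : re '[u, v] = re '[v, u].
Proof. by rewrite ipC reJ. Qed.

Lemma sqD u v : sq (u + v) = sq u + 2 * re '[u, v] + sq v.
Proof. by rewrite /sq ipDl !ipDr !reD (re_ipC v u); ring. Qed.
Lemma sqN u : sq (- u) = sq u.
Proof. by rewrite /sq ipNl ipNr opprK. Qed.
Lemma sqB u v : sq (u - v) = sq u - 2 * re '[u, v] + sq v.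
Proof. by rewrite sqD sqN ipNr reN; ring. Qed.
Lemma sqZ c u : sq (c *: u) = normc2 c * sq u.
Proof. by rewrite /sq ipZl ipZr mulrA mulcJ ip_sq reZ. Qed.
Lemma sq0 : sq 0 = 0.
Proof. by rewrite /sq ip0l. Qed.
Lemma parallelogram u v : sq (u - v) = 2 * sq u + 2 * sq v - sq (u + v).
Proof. by rewrite sqB sqD; ring. Qed.

Lemma cauchy_schwarz u v : normc2 '[u, v] <= sq u * sq v.
Proof.
apply: quadratic_normc2 => [|z]; first exact: sq_ge0.
have -> : sq u + 2 * re (z * '[u, v]) + normc2 z * sq v = sq (u + Num.conj z *: v).
  by rewrite sqD sqZ normc2J ipZr conjCK.
exact: sq_ge0.
Qed.

Definition nr u : R := Num.sqrt (sq u).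

Lemma nr_ge0 u : 0 <= nr u. Proof. exact: sqrtr_ge0. Qed.
Lemma nr_sqr u : nr u ^+ 2 = sq u. Proof. by rewrite sqr_sqrtr ?sq_ge0. Qed.
Lemma nr_le u (r : R) : 0 <= r -> sq u <= r ^+ 2 -> nr u <= r.
Proof. by move=> r0 h; rewrite -(ler_pXn2r (n := 2)) ?nnegrE ?nr_ge0// nr_sqr. Qed.
Lemma normE u : `|u| = (nr u)%:C.
Proof.
apply: (@pexpIrn _ 2) => //; rewrite ?nnegrE ?lecR ?nr_ge0//.
by rewrite -inner_norm ip_sq -rmorphXn /= nr_sqr.
Qed.
Lemma nrD u v : nr (u + v) <= nr u + nr v.
Proof. by rewrite -lecR rmorphD /= -!normE ler_normD. Qed.
Lemma nrN u : nr (- u) = nr u.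
Proof. by rewrite /nr sqN. Qed.
Lemma nrB u v : nr (u - v) <= nr u + nr v.
Proof. by rewrite -(nrN v) nrD. Qed.
Lemma nrBC u v : nr (u - v) = nr (v - u).
Proof. by rewrite -nrN opprB. Qed.
Lemma nr0 : nr 0 = 0. Proof. by rewrite /nr sq0 sqrtr0. Qed.
Lemma nrZ c u : nr (c *: u) = Num.sqrt (normc2 c) * nr u.
Proof. by rewrite /nr sqZ sqrtrM ?normc2_ge0. Qed.
Lemma nrZr (r : R) u : 0 <= r -> nr (r%:C *: u) = r * nr u.
Proof. by move=> r0; rewrite nrZ normc2_real sqrtr_sqr ger0_norm. Qed.
Lemma nr_sum I (s : seq I) (P : pred I) (F : I -> H) :
  nr (\sum_(i <- s | P i) F i) <= \sum_(i <- s | P i) nr (F i).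
Proof.
elim/big_rec2: _ => [|i x y _ h]; first by rewrite nr0.
by apply: le_trans (nrD _ _) _; rewrite lerD2l.
Qed.
Lemma nr_eq0 u : nr u = 0 -> u = 0.
Proof. by move=> h; apply: sq_eq0; rewrite -nr_sqr h expr0n. Qed.
Lemma nr_small u : (forall e : R, 0 < e -> nr u < e) -> u = 0.
Proof.
move=> h; apply: nr_eq0; apply/eqP; rewrite eq_le nr_ge0 andbT leNgt.
by apply/negP => h0; have := h _ h0; rewrite ltxx.
Qed.
Lemma nr_dist u v w : nr (u - w) <= nr (u - v) + nr (v - w).
Proof. by rewrite -(subrKA v u (- w)) nrD. Qed.

Lemma normc2_ip_le u v : Num.sqrt (normc2 '[u, v]) <= nr u * nr v.
Proof. by rewrite -sqrtrM ?sq_ge0// ler_wsqrtr// cauchy_schwarz. Qed.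
Lemma re_le_sqrt (z : R[i]) : `|re z| <= Num.sqrt (normc2 z).
Proof. by rewrite -sqrtr_sqr ler_wsqrtr// re_sqr_le. Qed.
Lemma re_ip_le u v : `|re '[u, v]| <= nr u * nr v.
Proof. exact: le_trans (re_le_sqrt _) (normc2_ip_le _ _). Qed.

Definition lim_to (f : nat -> H) u :=
  forall e : R, 0 < e -> exists N, forall n, (N <= n)%N -> nr (f n - u) < e.

Lemma lim_toP (f : nat -> H) u : f @ \oo --> u <-> lim_to f u.
Proof.
split=> [/cvgrPdist_lt h e e0|h].
  have /h [N _ hN] : (0 : R[i]) < e%:C by rewrite ltcR.
  exists N => n /hN /=; rewrite normE ltcR nrBC//.
apply/cvgrPdist_lt => e e0.
have /andP [/eqP ei er] : (complex.Im e == 0) && (0 < complex.Re e).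
  by move: e0; rewrite ltcE /= .
have [N hN] := h _ er; exists N => // n /= /hN.
by rewrite normE ltcE /= ei eqxx nrBC.
Qed.

Lemma lim_to_unique (f : nat -> H) u v : lim_to f u -> lim_to f v -> u = v.
Proof.
move=> hu hv; apply/eqP; rewrite -subr_eq0; apply/eqP/nr_small => e e0.
have e2 : 0 < e / 2 by lra.
have [N hN] := hu _ e2; have [M hM] := hv _ e2.
have := hN (N + M)%N (leq_addr _ _); have := hM (N + M)%N (leq_addl _ _).
by have := nr_dist u (f (N + M)%N) v; rewrite (nrBC u (f _)); lra.
Qed.

Lemma complete_lim (f : nat -> H) :
  (forall e : R, 0 < e -> exists N, forall n m, (N <= n)%N -> (N <= m)%N ->
     nr (f n - f m) < e) -> exists u, lim_to f u.
Proof.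
move=> h; suff /cauchy_cvgP hc : cauchy (f @ \oo).
  by exists (lim (f @ \oo)); apply/lim_toP.
apply/cauchy_ballP => e e0.
have /andP [/eqP ei er] : (complex.Im e == 0) && (0 < complex.Re e).
  by move: e0; rewrite ltcE /= .
have [N hN] := h _ er.
exists ([set f n | n in [set n | (N <= n)%N]], [set f n | n in [set n | (N <= n)%N]]) => /=.
  by split; exists N => // n /= Nn; exists n.
move=> [_ _] /= [[n Nn <-] [m Nm <-]].
by rewrite -ball_normE /ball_/= normE ltcE /= ei eqxx hN.
Qed.

End Geometry.

(** * Bounded operators *)

Section Operators.
Context (R : realType) (H : hilbertType R).
Implicit Types (u v w : H) (x y z : bop H).
Local Notation re := (@complex.Re R).
Local Notation "'[ u , v ]" := (inner H u v).

Lemma bopP x y : (forall u, x u = y u) -> x = y.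
Proof. by move=> h; apply: val_inj; apply/funext. Qed.
Lemma bop_linear x : linear x.
Proof. by have /asboolP[] := bop_funP x. Qed.
Lemma bopuD x u v : x (u + v) = x u + x v.
Proof. by have := bop_linear x 1 u v; rewrite !scale1r. Qed.
Lemma bopu0 x : x 0 = 0.
Proof. by apply: (@addrI _ (x 0)); rewrite -bopuD !addr0. Qed.
Lemma bopuZ x c u : x (c *: u) = c *: x u.
Proof. by have := bop_linear x c u 0; rewrite bopu0 !addr0. Qed.
Lemma bopuN x u : x (- u) = - x u.
Proof. by rewrite -scaleN1r bopuZ scaleN1r. Qed.
Lemma bopuB x u v : x (u - v) = x u - x v.
Proof. by rewrite bopuD bopuN. Qed.
Lemma bopu_sum x I (s : seq I) (P : pred I) (F : I -> H) :
  x (\sum_(i <- s | P i) F i) = \sum_(i <- s | P i) x (F i).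
Proof. exact: (big_morph x (bopuD x) (bopu0 x)). Qed.

Lemma bopD x y u : (x + y) u = x u + y u. Proof. by []. Qed.
Lemma bopN x u : (- x) u = - x u. Proof. by []. Qed.
Lemma bopB x y u : (x - y) u = x u - y u. Proof. by []. Qed.
Lemma bopZ c x u : (c *: x) u = c *: x u. Proof. by []. Qed.
Lemma bop0 u : (0 : bop H) u = 0. Proof. by []. Qed.
Lemma bop1E u : bop1 H u = u. Proof. by []. Qed.
Lemma bopM x y u : bop_mul x y u = x (y u). Proof. by []. Qed.
Lemma bop_sum I (s : seq I) (P : pred I) (F : I -> bop H) u :
  (\sum_(i <- s | P i) F i) u = \sum_(i <- s | P i) F i u.
Proof. exact: (big_morph (fun x : bop H => x u) (fun x y => bopD x y u) (bop0 u)). Qed.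

Lemma bop_bounded x : exists2 C : R, 0 < C & forall u, nr (x u) <= C * nr u.
Proof.
have /asboolP[xl xc] := bop_funP x.
pose f := GRing.isLinear.Build _ _ _ _ (x : H -> H) xl.
pose g : {linear H -> H} := HB.pack (x : H -> H) f.
have /linear_bounded_continuous/linear_boundedP [M [Mr hM]] : continuous g by exact: xc.
have [r Mr'] := complex_realP _ Mr.
have r1 : M < (Num.max (r + 1) 1)%:C.
  by rewrite Mr' ltcR lt_max ltrDl ltr01.
exists (Num.max (r + 1) 1); first by rewrite lt_max ltr01 orbT.
by move=> u; have := hM _ r1 u; rewrite !normE -rmorphM /= lecR.
Qed.

Lemma mkbop (f : H -> H) (C : R) : linear f -> (forall u, nr (f u) <= C * nr u) ->
  exists x : bop H, forall u, x u = f u.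
Proof.
move=> fl fb; suff fc : continuous f.
  have fP : f \in bounded_operator (H := H) by apply/asboolP; split.
  by exists (Bop fP).
pose fm := GRing.isLinear.Build _ _ _ _ f fl.
pose g : {linear H -> H} := HB.pack f fm.
suff : continuous g by [].
apply/linear_bounded_continuous/linear_boundedP.
exists C%:C; split; first by rewrite complex_real.
move=> M CM u; rewrite !normE.
apply: (le_trans (y := C%:C * (nr u)%:C)); first by rewrite -rmorphM lecR fb.
by rewrite ler_wpM2r ?lecR ?nr_ge0// ltW.
Qed.

Lemma lim_to_bop x (f : nat -> H) u : lim_to f u -> lim_to (fun n => x (f n)) (x u).
Proof.
move=> h e e0; have [C C0 xC] := bop_bounded x.
have [N hN] := h (e / C) (divr_gt0 e0 C0).
exists N => n /hN h1; rewrite -bopuB; apply: le_lt_trans (xC _) _.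
by rewrite mulrC -ltr_pdivlMr.
Qed.

End Operators.

Section RealLimits.
Context (R : realType).

Definition rlim (f : nat -> R) (l : R) :=
  forall e : R, 0 < e -> exists N, forall n, (N <= n)%N -> `|f n - l| < e.

Lemma rlim_le (f : nat -> R) l a : (forall n, f n <= a) -> rlim f l -> l <= a.
Proof.
move=> h fl; rewrite leNgt; apply/negP => al.
have [|N hN] := fl (l - a); first by rewrite subr_gt0.
by have := hN N (leqnn _); have := h N; rewrite ltr_norml; lra.
Qed.

Lemma rlim_ge (f : nat -> R) l a : (forall n, a <= f n) -> rlim f l -> a <= l.
Proof.
move=> h fl; rewrite leNgt; apply/negP => al.
have [|N hN] := fl (a - l); first by rewrite subr_gt0.
by have := hN N (leqnn _); have := h N; rewrite ltr_norml; lra.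
Qed.

Lemma small_le (a b : R) : (forall e : R, 0 < e -> a <= b + e) -> a <= b.
Proof.
move=> h; rewrite leNgt; apply/negP => ba.
by have := h ((a - b) / 2); lra.
Qed.

Lemma inv_small (e : R) : 0 < e -> exists N, forall n, (N <= n)%N -> n.+1%:R^-1 < e.
Proof.
move=> e0; have [n hn] := ltr_add_invr e0; rewrite add0r in hn.
exists n => m nm; apply: le_lt_trans hn.
by rewrite lef_pV2 ?posrE ?ltr0n// ler_nat.
Qed.

End RealLimits.

(** * Minimal vectors and orthogonal projections *)

Section Projections.
Context (R : realType) (H : hilbertType R).
Implicit Types (u v w : H) (S : set H).
Local Notation re := (@complex.Re R).
Local Notation "'[ u , v ]" := (inner H u v).

Definition vsubspace S := S 0 /\ forall c u v, S u -> S v -> S (c *: u + v).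
Definition vclosure S u := forall e : R, 0 < e -> exists2 s, S s & nr (u - s) < e.
Definition vorth S u := forall s, S s -> '[u, s] = 0.

Lemma vsubspaceD S u v : vsubspace S -> S u -> S v -> S (u + v).
Proof. by move=> [_ h] hu hv; rewrite -[u]scale1r; apply: h. Qed.
Lemma vsubspaceZ S c u : vsubspace S -> S u -> S (c *: u).
Proof. by move=> [h0 h] hu; rewrite -[_ *: _]addr0; apply: h. Qed.

Lemma sub_vclosure S u : S u -> vclosure S u.
Proof. by move=> hu e e0; exists u; rewrite // subrr nr0. Qed.

Lemma vclosureP S c u v : vsubspace S -> vclosure S u -> vclosure S v ->
  vclosure S (c *: u + v).
Proof.
move=> hS hu hv e e0.
have k0 : 0 < Num.sqrt (normc2 c) + 1 by rewrite ltr_wpDl ?sqrtr_ge0.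
have [s Ss us] := hu (e / 2 / (Num.sqrt (normc2 c) + 1)) ltac:(by rewrite !divr_gt0).
have [t St vt] := hv (e / 2) ltac:(by rewrite divr_gt0).
exists (c *: s + t); first by apply: hS.2.
have -> : c *: u + v - (c *: s + t) = c *: (u - s) + (v - t).
  by rewrite scalerBr opprD addrACA.
apply: le_lt_trans (nrD _ _) _; rewrite nrZ.
suff : Num.sqrt (normc2 c) * nr (u - s) <= e / 2 by lra.
move: us; rewrite ltr_pdivlMr// => us.
have := nr_ge0 (u - s); have := sqrtr_ge0 (normc2 c); nra.
Qed.

Lemma vorth_closure S u w : vorth S u -> vclosure S w -> '[u, w] = 0.
Proof.
move=> uS wS; have [u0|u0] := eqVneq (nr u) 0.
  by rewrite (nr_eq0 u0) ip0l.
have {}u0 : 0 < nr u by rewrite lt_def u0 nr_ge0.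
suff h : Num.sqrt (normc2 '[u, w]) <= 0.
  apply/eqP; rewrite -normr_eq0 normc2E.
  have -> : Num.sqrt (normc2 '[u, w]) = 0 by apply/eqP; rewrite eq_le h sqrtr_ge0.
  by [].
apply: small_le => e e0.
have [s Ss ws] := wS _ (divr_gt0 e0 u0).
have -> : '[u, w] = '[u, w - s] by rewrite ipBr (uS _ Ss) subr0.
apply: le_trans (normc2_ip_le _ _) _.
by rewrite add0r mulrC -ler_pdivlMr// ltW.
Qed.

Lemma rlim_sq (f : nat -> H) u : lim_to f u -> rlim (fun n => sq (f n)) (sq u).
Proof.
move=> h e e0; have un := nr_ge0 u.
have d0 : 0 < Num.min 1 (e / (2 * nr u + 2)).
  by rewrite lt_min ltr01 divr_gt0//; lra.
have [N hN] := h _ d0; exists N => n /hN; rewrite lt_min => /andP[h1].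
rewrite ltr_pdivlMr; last by lra.
move=> h2; have fE : f n = u + (f n - u) by rewrite addrC subrK.
have := nrD u (f n - u); rewrite -fE => h3.
have := nr_dist u (f n) 0; rewrite !subr0 nrBC => h4.
have n0 := nr_ge0 (f n - u).
rewrite -!nr_sqr ltr_norml; apply/andP; split; nra.
Qed.

(** By the parallelogram law a norm-minimising sequence in a midpoint-convex set is Cauchy. The last
    clause bounds the distance to the minimiser by the excess norm, so any other minimising sequence
    has the same limit. It is applied to a translated subspace, for projections, and to the averages
    of an operator at a trace vector. *)
Lemma min_norm (K : set H) u0 : K u0 ->
  (forall u v, K u -> K v -> K ((2^-1)%:C *: (u + v))) ->
  exists f h, [/\ forall n, K (f n), lim_to f h &
    forall k, K k -> sq (k - h) <= 2 * (sq k - sq h)].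
Proof.
move=> K0 Km; pose E := [set sq k | k in K].
have E0 : has_inf E.
  split; first by exists (sq u0), u0.
  by exists 0 => _ [k _ <-]; exact: sq_ge0.
pose d := inf E.
have dle k : K k -> d <= sq k.
  by move=> Kk; apply: (ge_inf E0.2); exists k.
have ex n : exists k, K k /\ sq k < d + n.+1%:R^-1.
  have [_ [k Kk <-] kd] := @inf_adherent R E n.+1%:R^-1 ltac:(by rewrite invr_gt0) E0.
  by exists k.
have [f fP] := choice ex.
have mid k l : K k -> K l -> sq (k - l) <= 2 * sq k + 2 * sq l - 4 * d.
  move=> Kk Kl; have := dle _ (Km _ _ Kk Kl).
  by rewrite sqZ normc2_real parallelogram => h; lra.
have [|h fh] := @complete_lim R H f.
  move=> e e0; have [N hN] := inv_small (divr_gt0 (exprn_gt0 2 e0) (ltr0Sn R 3)).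
  exists N => n m Nn Nm; rewrite -(ltr_pXn2r (n := 2)) ?nnegrE ?nr_ge0 ?(ltW e0)//.
  rewrite nr_sqr; have := mid _ _ (fP n).1 (fP m).1.
  have := (fP n).2; have := (fP m).2; have := hN _ Nn; have := hN _ Nm.
  by move: (n.+1%:R^-1) (m.+1%:R^-1) => a b; lra.
exists f, h; split=> // [n|k Kk]; first exact: (fP n).1.
have sqh : rlim (fun n => sq (f n)) d.
  move=> e e0; have [N hN] := inv_small e0; exists N => n Nn.
  have := hN _ Nn; have := (fP n).2; have := dle _ (fP n).1.
  move: (n.+1%:R^-1) => a; by rewrite ltr_norml => *; apply/andP; split; lra.
have hd : sq h <= d.
  apply: small_le => e e0; have [N hN] := sqh _ (divr_gt0 e0 (ltr0Sn R 1)).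
  have [M hM] := rlim_sq fh (divr_gt0 e0 (ltr0Sn R 1)).
  have := hN (N + M)%N (leq_addr _ _); have := hM (N + M)%N (leq_addl _ _).
  by rewrite !ltr_norml; lra.
have kh : lim_to (fun n => k - f n) (k - h).
  move=> e /fh[N hN]; exists N => n /hN.
  suff -> : k - f n - (k - h) = - (f n - h) by rewrite nrN.
  by rewrite opprB [LHS]addrC subrKA opprB.
apply: small_le => e e0; have [N hN] := sqh _ (divr_gt0 e0 (ltr0Sn R 7)).
have [M hM] := rlim_sq kh (divr_gt0 e0 (ltr0Sn R 1)).
have := hN (N + M)%N (leq_addr _ _); have := hM (N + M)%N (leq_addl _ _).
have := mid _ _ Kk (fP (N + M)%N).1; rewrite !ltr_norml; lra.
Qed.

Lemma proj_exists S u : vsubspace S -> exists p, vclosure S p /\ vorth S (u - p).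
Proof.
move=> hS; pose K := [set u - s | s in S].
have K0 : K u by exists 0; [exact: hS.1 | rewrite subr0].
have [|f [h [fK fh hK]]] := min_norm K0.
  move=> _ _ [s Ss <-] [t St <-]; exists ((2^-1)%:C *: (s + t)).
    by apply: vsubspaceZ => //; apply: vsubspaceD.
  rewrite -[in LHS](scale1r u); have -> : (1 : R[i]) = (2^-1)%:C + (2^-1)%:C.
    by rewrite -rmorphD -[RHS]/((_)%:C); congr (_%:C); lra.
  by rewrite scalerDl [in RHS]addrACA -opprD scalerBr [in RHS]scalerDr.
exists (u - h); split.
  move=> e e0; have [N hN] := fh _ e0; have := hN N (leqnn _).
  have [s Ss <-] := fK N; exists s => //.
  by rewrite addrAC.
have -> : u - (u - h) = h by rewrite opprB addrC subrK.
(* A quadratic form with constant term 0: [h] has minimal norm in the closure of [K], so moving it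
   by a multiple of [s] cannot shorten it, and the discriminant bound gives ['[h, s] = 0]. *)
move=> s Ss; have hc : normc2 '[h, s] <= 0 * sq s.
  apply: quadratic_normc2 => [|z]; first exact: sq_ge0.
  have -> : 0 + 2 * re (z * '[h, s]) + normc2 z * sq s =
      sq (h + Num.conj z *: s) - sq h.
    by rewrite sqD sqZ normc2J ipZr conjCK; ring.
  rewrite subr_ge0; have hz : lim_to (fun n => f n + Num.conj z *: s) (h + Num.conj z *: s).
    move=> e /fh[N hN]; exists N => n /hN.
    by rewrite [in X in _ -> X]opprD addrACA subrr addr0.
  apply: rlim_ge (rlim_sq hz) => n.
  have Kn : K (f n + Num.conj z *: s).
    have [t St <-] := fK n; exists (t - Num.conj z *: s); last by rewrite opprB addrA addrAC.
    by rewrite -scaleNr addrC; apply: hS.2.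
  by have := sq_ge0 (f n + Num.conj z *: s - h); have := hK _ Kn; lra.
have {}hc : normc2 '[h, s] = 0 by apply/eqP; rewrite eq_le normc2_ge0 -(mul0r (sq s)) hc.
by apply/eqP; rewrite -normr_eq0 normc2E hc sqrtr0.
Qed.
End Projections.

(** * Riesz representation and adjoints *)

Section Riesz.
Context (R : realType) (H : hilbertType R).
Implicit Types (u v w : H) (S : set H) (x y z : bop H).
Local Notation re := (@complex.Re R).
Local Notation "'[ u , v ]" := (inner H u v).

Lemma projection_op S : vsubspace S -> exists P : bop H,
  [/\ forall u, vclosure S (P u), forall u, vorth S (u - P u),
      forall u, S u -> P u = u, forall u, vorth S u -> P u = 0 &
      is_adjoint P P].
Proof.
move=> hS; have [f fP] := choice (fun u => proj_exists u hS).
have uniq u p : vclosure S p -> vorth S (u - p) -> f u = p.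
  move=> cp op; apply/eqP; rewrite -subr_eq0; apply/eqP/sq_eq0.
  have cd : vclosure S (f u - p).
    by rewrite addrC -scaleN1r; apply: vclosureP => //; exact: (fP u).1.
  have od : vorth S (f u - p).
    move=> s Ss; have -> : f u - p = (u - p) - (u - f u).
      by rewrite opprB [RHS]addrC subrKA.
    by rewrite ipBl (op _ Ss) ((fP u).2 _ Ss) subrr.
  by rewrite /sq (vorth_closure od cd).
have fl : linear f.
  move=> c u v; apply: uniq.
    by apply: vclosureP => //; [exact: (fP u).1 | exact: (fP v).1].
  move=> s Ss; have -> : c *: u + v - (c *: f u + f v) = c *: (u - f u) + (v - f v).
    by rewrite scalerBr opprD addrACA.
  by rewrite ipDl ipZl ((fP u).2 _ Ss) ((fP v).2 _ Ss) mulr0 addr0.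
have fsa u v : '[f u, v] = '[u, f v].
  have e1 : '[u - f u, f v] = 0 := vorth_closure (fP u).2 (fP v).1.
  have e2 : '[v - f v, f u] = 0 := vorth_closure (fP v).2 (fP u).1.
  move/eqP: e1; rewrite ipBl subr_eq0 => /eqP ->.
  by move/eqP: e2; rewrite ipBl subr_eq0 => /eqP e2; rewrite ipC e2 -ipC.
have fb u : nr (f u) <= 1 * nr u.
  rewrite mul1r; apply: nr_le; first exact: nr_ge0.
  have uE : u = f u + (u - f u) by rewrite addrC subrK.
  have e : '[f u, u - f u] = 0 by rewrite ipC (vorth_closure (fP u).2 (fP u).1) rmorph0.
  rewrite nr_sqr {2}uE sqD e /=; have := sq_ge0 (u - f u); lra.
have [P PE] := mkbop fl fb; exists P; split.
- by move=> u; rewrite PE; exact: (fP u).1.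
- by move=> u; rewrite PE; exact: (fP u).2.
- move=> u Su; rewrite PE; apply: uniq; first exact: sub_vclosure.
  by move=> s _; rewrite subrr ip0l.
- by move=> u ou; rewrite PE; apply: uniq; [exact/sub_vclosure/hS.1 | rewrite subr0].
- by move=> u v; rewrite !PE.
Qed.

Lemma riesz (phi : H -> R[i]) (C : R) :
  (forall c u v, phi (c *: u + v) = c * phi u + phi v) ->
  (forall u, Num.sqrt (normc2 (phi u)) <= C * nr u) ->
  exists w, forall u, phi u = '[u, w].
Proof.
move=> phil phib.
have phiD u v : phi (u + v) = phi u + phi v by rewrite -[u]scale1r phil mul1r scale1r.
have phi0 : phi 0 = 0 by apply: (@addrI _ (phi 0)); rewrite -phiD !addr0.
have phiZ c u : phi (c *: u) = c * phi u by rewrite -[_ *: _]addr0 phil phi0 addr0.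
have phiB u v : phi (u - v) = phi u - phi v by rewrite phiD -scaleN1r phiZ mulN1r.
have [z0|] := pselect (forall u, phi u = 0).
  by exists 0 => u; rewrite z0 ip0r.
move=> /existsNP[u0 /eqP u0n].
pose S : set H := [set u | phi u = 0].
have hS : vsubspace S by split=> // c u v; rewrite /S /= phil => -> ->; rewrite mulr0 addr0.
have [p [cp op]] := proj_exists u0 hS.
have phip : phi p = 0.
  have C1 : 0 < `|C| + 1 by rewrite ltr_wpDl.
  suff h : Num.sqrt (normc2 (phi p)) <= 0.
    apply/eqP; rewrite -normr_eq0 normc2E.
    by have -> : Num.sqrt (normc2 (phi p)) = 0 by apply/eqP; rewrite eq_le h sqrtr_ge0.
  apply: small_le => e e0; have [s Ss ps] := cp _ (divr_gt0 e0 C1).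
  have -> : phi p = phi (p - s) by rewrite phiB Ss subr0.
  apply: le_trans (phib _) _; rewrite ltr_pdivlMr// in ps.
  have := ler_norm C; have := nr_ge0 (p - s); nra.
set z := u0 - p in op.
have phiz : phi z = phi u0 by rewrite phiB phip subr0.
have z0 : '[z, z] != 0.
  rewrite ip_sq; apply: contra_neq u0n => /complexI /sq_eq0 z0.
  by rewrite -phiz z0.
(* [z] is the component of [u0] orthogonal to the kernel of [phi], and [u - (phi u / phi z) *: z]
   lies in that kernel. *)
exists ((Num.conj (phi z / '[z, z])) *: z) => u.
rewrite ipZr conjCK.
have /eqP : '[u - (phi u / phi z) *: z, z] = 0.
  by rewrite ipC op ?rmorph0// /S /= phiB phiZ divfK ?subrr ?phiz.
rewrite ipBl ipZl subr_eq0 => /eqP ->.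
by field; rewrite phiz u0n z0.
Qed.

Lemma sesqui_op (B : H -> H -> R[i]) (C : R) :
  (forall c u v w, B (c *: u + v) w = c * B u w + B v w) ->
  (forall c u v w, B w (c *: u + v) = Num.conj c * B w u + B w v) ->
  (forall u v, Num.sqrt (normc2 (B u v)) <= C * nr u * nr v) ->
  exists x : bop H, forall u v, '[x u, v] = B u v.
Proof.
move=> Bl Br Bb.
have ex u : exists w, forall v, Num.conj (B u v) = '[v, w].
  apply: (@riesz _ (C * nr u)) => [c v w|v]; last by rewrite normc2J.
  by rewrite Br rmorphD rmorphM /= conjCK.
have [f fP] := choice ex.
have fE u v : '[f u, v] = B u v by rewrite ipC -fP conjCK.
have fl : linear f.
  by move=> c u v; apply: ip_inj => w; rewrite ipDl ipZl !fE Bl.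
have fb u : nr (f u) <= `|C| * nr u.
  have [h|h] := eqVneq (nr (f u)) 0; first by rewrite h mulr_ge0 ?nr_ge0.
  have {}h : 0 < nr (f u) by rewrite lt_def h nr_ge0.
  rewrite -(ler_pM2r h) -[X in X <= _]expr2 nr_sqr.
  have := Bb u (f u); rewrite -fE ip_sq normc2_real sqrtr_sqr ger0_norm ?sq_ge0// => h1.
  apply: le_trans h1 _; rewrite -!mulrA ler_wpM2r ?mulr_ge0 ?nr_ge0 ?ler_norm//.
by have [x xE] := mkbop fl fb; exists x => u v; rewrite xE fE.
Qed.

Lemma adj_exists x : exists y, forall u v, '[y u, v] = '[u, x v].
Proof.
have [C C0 xb] := bop_bounded x.
apply: (@sesqui_op _ C) => [c u v w|c u v w|u v].
- by rewrite ipDl ipZl.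
- by rewrite bopuD bopuZ ipDr ipZr.
- apply: le_trans (normc2_ip_le _ _) _; rewrite [C * _]mulrC -mulrA.
  by rewrite ler_wpM2l ?nr_ge0.
Qed.

Definition adj x : bop H := sval (cid (adj_exists x)).

Lemma adjl x u v : '[adj x u, v] = '[u, x v].
Proof. by rewrite /adj; case: cid. Qed.
Lemma adjr x u v : '[u, adj x v] = '[x u, v].
Proof. by rewrite ipC adjl -ipC. Qed.
Lemma is_adjointP x y : is_adjoint x y <-> y = adj x.
Proof.
split=> [h|-> u v]; last by rewrite adjr.
by apply: bopP => u; apply: ip_inj => v; rewrite adjl ipC -h -ipC.
Qed.
Lemma adjK x : adj (adj x) = x.
Proof. by apply/esym/is_adjointP => u v; rewrite adjl. Qed.
Lemma adjM x y : adj (bop_mul x y) = bop_mul (adj y) (adj x).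
Proof. by apply/esym/is_adjointP => u v; rewrite !bopM !adjr. Qed.
Lemma adjD x y : adj (x + y) = adj x + adj y.
Proof. by apply/esym/is_adjointP => u v; rewrite !bopD ipDl ipDr !adjr. Qed.
Lemma adjN x : adj (- x) = - adj x.
Proof. by apply/esym/is_adjointP => u v; rewrite !bopN ipNl ipNr !adjr. Qed.
Lemma adj_bopZ c x : adj (c *: x) = Num.conj c *: adj x.
Proof. by apply/esym/is_adjointP => u v; rewrite !bopZ ipZl ipZr !adjr conjCK. Qed.
Lemma adj_bop1 : adj (bop1 H) = bop1 H.
Proof. by apply/esym/is_adjointP => u v. Qed.
Lemma adj_bop0 : adj 0 = 0 :> bop H.
Proof. by apply/esym/is_adjointP => u v; rewrite !bop0 ip0l ip0r. Qed.

(* [rank1 e h] is the operator |e><h|. *)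
Lemma rank1_exists e h : exists x : bop H, forall u, x u = '[u, h] *: e.
Proof.
apply: (@mkbop _ _ _ (nr h * nr e)) => [c u v|u].
  by rewrite ipDl ipZl scalerDl scalerA.
by rewrite nrZ mulrAC ler_wpM2r ?nr_ge0// mulrC normc2_ip_le.
Qed.
Definition rank1 e h : bop H := sval (cid (rank1_exists e h)).
Lemma rank1E e h u : rank1 e h u = '[u, h] *: e.
Proof. by rewrite /rank1; case: cid. Qed.

Definition pos x := forall u, 0 <= '[x u, u].

Lemma pos_re x u : pos x -> '[x u, u] = (re '[x u, u])%:C /\ 0 <= re '[x u, u].
Proof. by move=> /(_ u)/ge0_re. Qed.

(** Polarisation: the quadratic form is real at [u], [v], [u + v] and [u + 'i *: v], which forces
    hermitian symmetry. *)
Lemma pos_sa x : pos x -> adj x = x.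
Proof.
move=> xp; apply/esym/is_adjointP => u v.
have im0 w : complex.Im '[x w, w] = 0 by rewrite (pos_re w xp).1.
rewrite [RHS]ipC; have := im0 (u + 'i *: v); have := im0 (u + v); move: (im0 u) (im0 v).
rewrite !bopuD !bopuZ !ipDl !ipDr !ipZl !ipZr.
case: '[x u, u] => ? ?; case: '[x v, v] => ? ?.
case: '[x u, v] => a b; case: '[x v, u] => c d /=.
move=> h1 h2 h3 h4; apply/eqP; rewrite eq_complex /=; apply/andP; split; apply/eqP; lra.
Qed.

Lemma posl x u v : pos x -> '[x u, v] = '[u, x v].
Proof. by move=> h; rewrite -{1}(pos_sa h) adjl. Qed.

Lemma pos_cauchy_schwarz x u v : pos x ->
  normc2 '[x u, v] <= re '[x u, u] * re '[x v, v].
Proof.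
move=> xp; apply: quadratic_normc2 => [|z]; first exact: (pos_re v xp).2.
have -> : re '[x u, u] + 2 * re (z * '[x u, v]) + normc2 z * re '[x v, v] =
   re '[x (u + Num.conj z *: v), u + Num.conj z *: v].
  rewrite bopuD bopuZ ipDl !ipDr !ipZl !ipZr conjCK !reD.
  rewrite mulrA [Num.conj z * z]mulrC mulcJ reZ.
  have -> : re (Num.conj z * '[x v, u]) = re (z * '[x u, v]).
    by rewrite (posl u v xp) [in RHS]ipC -[in RHS]reJ rmorphM /= conjCK.
  by ring.
exact: (pos_re _ xp).2.
Qed.

(** [1 + s] is bounded below by 1, hence injective with closed range; a vector [w] orthogonal to the
    range is orthogonal to [(1 + s) w], which forces [w = 0]. The resolvents used later are all
    obtained from this one. *)
Lemma inverse1p s : pos s -> exists g : bop H,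
  [/\ forall u, g u + s (g u) = u, forall u, g (u + s u) = u, pos g &
      forall u, nr (g u) <= nr u].
Proof.
move=> sp; pose T u := u + s u.
have Tge u : sq u <= sq (T u).
  rewrite sqD; have := (pos_re u sp).2; have := sq_ge0 (s u).
  by rewrite (re_ipC u); lra.
have Tl c u v : T (c *: u + v) = c *: T u + T v.
  by rewrite /T bopuD bopuZ scalerDr addrACA.
have TB u v : T (u - v) = T u - T v.
  by rewrite addrC -scaleN1r Tl scaleN1r addrC.
have TN u v : nr (u - v) <= nr (T u - T v).
  by rewrite -TB ler_wsqrtr.
pose S : set H := [set T u | u in setT].
have hS : vsubspace S.
  split; first by exists 0; rewrite // /T bopu0 addr0.
  by move=> c _ _ [u _ <-] [v _ <-]; exists (c *: u + v).
have Tsur v : exists u, T u = v.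
  have [p [cp op]] := proj_exists v hS.
  have vp : v = p.
    apply/eqP; rewrite -subr_eq0; apply/eqP/sq_eq0.
    have := op (T (v - p)) ltac:(by exists (v - p)); rewrite ipDr => /(congr1 re) /=.
    rewrite reD -(posl _ _ sp); have := (pos_re (v - p) sp).2; have := sq_ge0 (v - p).
    rewrite /sq; lra.
  rewrite -vp in cp.
  have ex n : exists u, nr (v - T u) < n.+1%:R^-1.
    have [_ [u _ <-] h] := cp n.+1%:R^-1 ltac:(by rewrite invr_gt0).
    by exists u.
  have [f fP] := choice ex.
  have [|u fu] := @complete_lim R H f.
    move=> e e0; have [N hN] := inv_small (divr_gt0 e0 (ltr0Sn R 1)).
    exists N => n m Nn Nm; apply: le_lt_trans (TN _ _) _.
    apply: le_lt_trans (nr_dist _ v _) _; rewrite nrBC.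
    have := lt_trans (fP n) (hN _ Nn); have := lt_trans (fP m) (hN _ Nm); lra.
  exists u; apply: (@lim_to_unique _ _ (fun n => T (f n))).
    move=> e e0; have [N hN] := fu _ (divr_gt0 e0 (ltr0Sn R 1)).
    have [M hM] := lim_to_bop s fu (divr_gt0 e0 (ltr0Sn R 1)).
    exists (N + M)%N => n nNM; have := hN n (leq_trans (leq_addr _ _) nNM).
    have := hM n (leq_trans (leq_addl _ _) nNM) => h1 h2.
    have -> : T (f n) - T u = (f n - u) + (s (f n) - s u) by rewrite opprD addrACA.
    by apply: le_lt_trans (nrD _ _) _; lra.
  move=> e e0; have [N hN] := inv_small e0; exists N => n Nn.
  by rewrite nrBC; apply: lt_trans (fP n) (hN _ Nn).
have [f fP] := choice Tsur.
have Tinj u v : T u = T v -> u = v.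
  move=> h; apply/eqP; rewrite -subr_eq0; apply/eqP/nr_eq0/eqP.
  by rewrite eq_le nr_ge0 andbT; apply: le_trans (TN _ _) _; rewrite h subrr nr0.
have fl : linear f by move=> c u v; apply: Tinj; rewrite Tl !fP.
have fb u : nr (f u) <= nr u by rewrite -{2}(fP u) ler_wsqrtr.
have fb1 u : nr (f u) <= 1 * nr u by rewrite mul1r.
have [g gE] := mkbop fl fb1; exists g; split=> [u|u|u|u]; rewrite ?gE //.
- exact: fP.
- by apply: Tinj; rewrite fP.
- rewrite -{2}(fP u) ipDr -(posl _ _ sp) ip_sq addr_ge0 ?sp// lecR sq_ge0 //.
Qed.

(** The bound makes the linear relation [G] the graph of an operator on its domain; working with a
    graph avoids choosing an operator [a] for each vector [a psi]. The extension is by continuity to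
    the closed domain and by 0 on its orthogonal complement. *)
Lemma extend_bop (G : H -> H -> Prop) (C : R) : G 0 0 -> 0 <= C ->
  (forall c u v u' v', G u v -> G u' v' -> G (c *: u + u') (c *: v + v')) ->
  (forall u v, G u v -> nr v <= C * nr u) ->
  exists T : bop H,
   [/\ forall u v, G u v -> T u = v,
       forall u, vorth [set a | exists b, G a b] u -> T u = 0 &
       forall u, nr (T u) <= C * nr u].
Proof.
move=> G0 C0 Gl Gb; pose S := [set a | exists b, G a b].
have hS : vsubspace S.
  by split; [exists 0 | move=> c u u' [v Gv] [v' Gv']; exists (c *: v + v'); apply: Gl].
have [P [Pc Po PS PO _]] := projection_op hS.
(* The closure of the graph, precomposed with the projection onto the closed domain. *)
pose L (u y : H) := forall e : R, 0 < e ->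
  exists a b, [/\ G a b, nr (P u - a) < e & nr (y - b) < e].
have Ll c (u y u' y' : H) : L u y -> L u' y' -> L (c *: u + u') (c *: y + y').
  move=> h h' e e0.
  have k0 : 0 < Num.sqrt (normc2 c) + 1 by rewrite ltr_wpDl ?sqrtr_ge0.
  have [a [b [Gab ua yb]]] := h (e / 2 / (Num.sqrt (normc2 c) + 1)) ltac:(by rewrite !divr_gt0).
  have [a' [b' [Gab' ua' yb']]] := h' (e / 2) ltac:(by rewrite divr_gt0).
  have key (p q p' q' : H) : nr (p - q) < e / 2 / (Num.sqrt (normc2 c) + 1) ->
      nr (p' - q') < e / 2 -> nr (c *: p + p' - (c *: q + q')) < e.
    rewrite ltr_pdivlMr// => h1 h2.
    have -> : c *: p + p' - (c *: q + q') = c *: (p - q) + (p' - q').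
      by rewrite scalerBr opprD addrACA.
    apply: le_lt_trans (nrD _ _) _; rewrite nrZ.
    have := nr_ge0 (p - q); have := sqrtr_ge0 (normc2 c); nra.
  exists (c *: a + a'), (c *: b + b'); split; first exact: Gl.
    by rewrite bopuD bopuZ; exact: key.
  exact: key.
have Lb (u y : H) : L u y -> nr y <= C * nr (P u).
  move=> h; apply: small_le => e e0.
  have k0 : 0 < e / (C + 1) by rewrite divr_gt0//; lra.
  have [a [b [Gab]]] := h _ k0; rewrite !ltr_pdivlMr; try lra.
  move=> h1 h2; have := Gb _ _ Gab.
  have := nr_dist y b 0; have := nr_dist a (P u) 0; rewrite !subr0 (nrBC a).
  have := nr_ge0 (P u - a); have := nr_ge0 (y - b); nra.
have L0 (y : H) : L 0 y -> y = 0.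
  move=> /Lb; rewrite bopu0 nr0 mulr0 => h; apply: nr_eq0; apply/eqP.
  by rewrite eq_le h nr_ge0.
have LG a b : G a b -> L a b.
  move=> Gab e e0; exists a, b; split=> //; last by rewrite subrr nr0.
  by rewrite PS ?subrr ?nr0//; exists b.
have Luniq (u y y' : H) : L u y -> L u y' -> y = y'.
  move=> h h'; apply/eqP; rewrite -subr_eq0; apply/eqP/L0.
  have := Ll (-1) _ _ _ _ h' h; rewrite !scaleN1r addNr addrC //.
have ex u : exists y : H, L u y.
  have exn n : exists ab : H * H, G ab.1 ab.2 /\ nr (P u - ab.1) < n.+1%:R^-1.
    have [a [b Gab] h] := Pc u n.+1%:R^-1 ltac:(by rewrite invr_gt0).
    by exists (a, b).
  have [f fP] := choice exn.
  have [|y fy] := @complete_lim R H (fun n => (f n).2).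
    move=> e e0; have k0 : 0 < e / (2 * (C + 1)) by rewrite divr_gt0//; lra.
    have [N hN] := inv_small k0.
    exists N => n m Nn Nm.
    have := lt_trans (fP n).2 (hN _ Nn); have := lt_trans (fP m).2 (hN _ Nm).
    rewrite !ltr_pdivlMr; try lra.
    have GD : G ((f n).1 - (f m).1) ((f n).2 - (f m).2).
      have := Gl (-1) _ _ _ _ (fP m).1 (fP n).1; rewrite !scaleN1r addrC.
      by rewrite [X in G _ X]addrC.
    have h1 := Gb _ _ GD; have h2 := nr_dist (f n).1 (P u) (f m).1.
    have h3 := ler_wpM2l C0 h2; rewrite (nrBC (f n).1 (P u)) in h3 h2.
    have := nr_ge0 (P u - (f m).1); have := nr_ge0 (P u - (f n).1).
    by lra.
  exists y => e e0; have [N hN] := inv_small e0; have [M hM] := fy _ e0.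
  exists (f (N + M)%N).1, (f (N + M)%N).2; split.
  - exact: (fP _).1.
  - exact: lt_trans (fP _).2 (hN _ (leq_addr _ _)).
  - by rewrite nrBC; apply: hM; exact: leq_addl.
have [f fP] := choice ex.
have fl : linear f by move=> c u v; apply: Luniq (fP _) _; exact: Ll.
have Pb u : nr (P u) <= nr u.
  apply: nr_le; first exact: nr_ge0.
  have uE : u = P u + (u - P u) by rewrite addrC subrK.
  have e : '[P u, u - P u] = 0 by rewrite ipC (vorth_closure (Po u) (Pc u)) rmorph0.
  rewrite nr_sqr {2}uE sqD e /=; have := sq_ge0 (u - P u); lra.
have fb u : nr (f u) <= C * nr u.
  by apply: le_trans (Lb _ _ (fP u)) _; rewrite ler_wpM2l.
have [T TE] := mkbop fl fb; exists T; split=> [u v Guv|u ou|u]; rewrite ?TE //.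
- exact: Luniq (fP u) (LG _ _ Guv).
- apply: L0; move=> e e0; have [a [b [Gab h1 h2]]] := fP u e e0.
  by exists a, b; split=> //; rewrite bopu0 -(PO _ ou).
Qed.

End Riesz.

(** * The weak* topology *)

Section WeakStar.
Context (R : realType) (H : hilbertType R).
Implicit Types (u v w : H) (x y z : bop H).
Local Notation re := (@complex.Re R).
Local Notation "'[ u , v ]" := (inner H u v).

Lemma ncD (a b : R[i]) :
  Num.sqrt (normc2 (a + b)) <= Num.sqrt (normc2 a) + Num.sqrt (normc2 b).
Proof. by rewrite -lecR rmorphD /= -!normc2E ler_normD. Qed.
Lemma ncN (a : R[i]) : Num.sqrt (normc2 (- a)) = Num.sqrt (normc2 a).
Proof. by case: a => p q; rewrite /normc2 /= !sqrrN. Qed.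
Lemma nc_sum I (s : seq I) (P : pred I) (F : I -> R[i]) :
  Num.sqrt (normc2 (\sum_(i <- s | P i) F i)) <= \sum_(i <- s | P i) Num.sqrt (normc2 (F i)).
Proof.
elim/big_rec2: _ => [|i x y _ h]; first by rewrite /normc2 /= expr0n addr0 sqrtr0.
by apply: le_trans (ncD _ _) _; rewrite lerD2l.
Qed.

Definition clim (f : nat -> R[i]) (l : R[i]) :=
  forall e : R, 0 < e -> exists N, forall n, (N <= n)%N ->
    Num.sqrt (normc2 (f n - l)) < e.

Lemma climP (f : nat -> R[i]) l : (f : nat -> R[i]^o) @ \oo --> (l : R[i]^o) <-> clim f l.
Proof.
have nC (a b : R[i]) : normc2 (a - b) = normc2 (b - a).
  by rewrite -opprB; case: (b - a) => p q; rewrite /normc2 /= !sqrrN.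
split=> [/cvgrPdist_lt h e e0|h].
  have /h [N _ hN] : (0 : R[i]) < e%:C by rewrite ltcR.
  by exists N => n /hN /=; rewrite normc2E ltcR nC.
apply/cvgrPdist_lt => e e0.
have /andP [/eqP ei er] : (complex.Im e == 0) && (0 < complex.Re e).
  by move: e0; rewrite ltcE /= .
have [N hN] := h _ er; exists N => // n /= /hN.
by rewrite normc2E ltcE /= ei eqxx nC.
Qed.

Lemma clim_re (f : nat -> R[i]) l : clim f l -> rlim (fun n => re (f n)) (re l).
Proof.
move=> h e /h[N hN]; exists N => n /hN; apply: le_lt_trans.
by rewrite -reB re_le_sqrt.
Qed.

Lemma prod_topology_cvgP (I : choiceType) (T : topologicalType)
    (F : set_system (prod_topology (fun _ : I => T))) (f : prod_topology (fun _ : I => T)) :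
  Filter F -> F --> f <-> forall i, (fun g : prod_topology (fun _ : I => T) => g i) @ F --> f i.
Proof.
move=> FF; rewrite cvg_sup; split=> h i.
  move: (h i); rewrite cvg_image; last by rewrite eqEsubset; split=> v // _; exists (cst v).
  apply: cvg_trans => W /=; rewrite ?nbhs_simpl /fmap /= => [[W' + <-]].
  by apply: filterS => g W'g /=; exists g.
move: (h i); rewrite cvg_image; last by rewrite eqEsubset; split=> v // _; exists (cst v).
move=> + W //=; rewrite ?nbhs_simpl => Q => /Q Q'; exists (@^~ i @^-1` W) => //.
by rewrite eqEsubset; split => [j [? + <-//]|j Wj]; exists (fun _ => j).
Qed.

Lemma weakstar_cvgP (F : set_system (weakstar H)) (x : weakstar H) : Filter F ->
  F --> x <-> forall w : predual H, (fun y : weakstar H => sval w y : R[i]^o) @ F -->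
    (sval w x : R[i]^o).
Proof.
move=> FF; pose Phi := (fun (y : bop H) => (fun w : predual H => sval w y) : {ptws predual H -> R[i]^o}).
split=> [h w|h].
  have : (Phi : weakstar H -> _) @ F --> Phi x.
    exact: cvg_trans (cvg_app _ h) (@initial_continuous _ _ Phi x).
  by move=> /prod_topology_cvgP/(_ w).
have hP : Phi @ F --> (Phi x : {ptws predual H -> R[i]^o}) by apply/prod_topology_cvgP.
move=> V [B [[A Aop <-] Ax] sBV]; apply: filterS sBV _.
by apply: hP; apply: open_nbhs_nbhs.
Qed.

Lemma sum_nat_cst_tail (V : nmodType) (f : nat -> V) N n : (forall k, (N <= k)%N -> f k = 0) ->
  (N <= n)%N -> \sum_(0 <= k < n) f k = \sum_(0 <= k < N) f k.
Proof.
move=> h Nn; rewrite (big_cat_nat _ Nn)//=.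
have -> : \sum_(N <= k < n) f k = 0; last by rewrite addr0.
by rewrite big_nat_cond big1// => k /andP[/andP[Nk _] _]; exact: h.
Qed.

Definition sq_summable (xi : nat -> H) := forall e : R, 0 < e ->
  exists N, forall m, \sum_(N <= k < m) sq (xi k) < e.

Lemma sum_norm_sq (xi : nat -> H) N m :
  \sum_(N <= k < m) (`|xi k| ^+ 2 : R[i]) = (\sum_(N <= k < m) sq (xi k))%:C.
Proof. by rewrite rmorph_sum /=; apply: eq_bigr => k _; rewrite -inner_norm ip_sq. Qed.

Lemma sq_summableP (xi : nat -> H) :
  cvgn (series (fun n => `|xi n| ^+ 2 : R[i]^o)) <-> sq_summable xi.
Proof.
have s0 N m : 0 <= \sum_(N <= k < m) sq (xi k) by apply: sumr_ge0 => k _; exact: sq_ge0.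
split=> [/cvg_cauchy/cauchy_seriesP h e e0|h].
  have /h [[A B] /= [[N _ hN] [M _ hM]] hAB] : (0 : R[i]) < e%:C by rewrite ltcR.
  exists (maxn N M) => m.
  have [mM|Mm] := ltnP m (maxn N M); first by rewrite big_geq// ltnW.
  have /= := hAB (maxn N M, m) (conj (hN _ (leq_maxl _ _)) (hM _ (leq_trans (leq_maxr _ _) Mm))).
  by rewrite sum_norm_sq ger0_norm ?lecR// ltcR.
have /cauchy_cvgP hc : cauchy (series (fun k => sq (xi k) : R^o) @ \oo).
  apply/cauchy_seriesP => e e0; have [N hN] := h _ e0.
  exists ([set n | (N <= n)%N], setT); first by split; [exists N | exact: filterT].
  move=> [n m] /= [Nn _]; rewrite ger0_norm//.
  have [mn|nm] := leqP m n; first by rewrite big_geq.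
  apply: le_lt_trans (hN m); rewrite [X in _ <= X](big_cat_nat (n := n)) ?(ltnW nm)//=.
  by rewrite lerDr s0.
apply/cvg_ex; exists (lim (series (fun k => sq (xi k) : R^o) @ \oo))%:C.
apply/climP => e e0; have /cvgrPdist_lt/(_ _ e0)[N _ hN] := hc.
exists N => n /hN /=; rewrite /series /= sum_norm_sq -rmorphB /= normc2_real sqrtr_sqr distrC.
by [].
Qed.

Lemma normal_functional_ip u v : normal_functional (fun x : bop H => '[x u, v]).
Proof.
pose d w n := if n == 0%N then w else 0 : H.
have dS w : sq_summable (d w).
  move=> e e0; exists 1%N => m; rewrite big_nat_cond big1 // => -[|k] /andP[/andP[]]//.
  by rewrite /d /= sq0.
exists (d u), (d v); split; [exact/sq_summableP/dS|exact/sq_summableP/dS|].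
move=> x; apply/climP => e e0; exists 1%N => n n1.
rewrite /series /= (sum_nat_cst_tail (N := 1%N))//; last first.
  by case=> // k _; rewrite /d /= bopu0 ip0l.
by rewrite big_nat1 /d /= subrr /normc2 /= expr0n addr0 sqrtr0.
Qed.

Lemma weakstar_clim (f : nat -> bop H) x : (f : nat -> weakstar H) @ \oo --> (x : weakstar H) ->
  forall u v, clim (fun n => '[f n u, v]) '[x u, v].
Proof.
move=> /weakstar_cvgP h u v; apply/climP.
exact: (h (exist _ _ (normal_functional_ip u v))).
Qed.

(** The uniform bound makes the tails of the series of a normal functional uniformly small, since
    [nr xi * nr eta] is at most half of [sq xi + sq eta]; strong convergence handles the finitely
    many remaining terms. *)
Lemma weakstar_strong (f : nat -> bop H) x (C : R) :
  (forall n u, nr (f n u) <= C * nr u) ->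
  (forall u, lim_to (fun n => f n u) (x u)) ->
  (f : nat -> weakstar H) @ \oo --> (x : weakstar H).
Proof.
move=> fC fx; apply/weakstar_cvgP => -[w [xi [eta [/sq_summableP xiS /sq_summableP etaS hw]]]] /=.
have [D D0 xD] := bop_bounded x.
apply/climP => e e0.
pose K := `|C| + D.
have K0 : 0 < K by rewrite ltr_wpDl.
have dK n u : nr (f n u - x u) <= K * nr u.
  apply: le_trans (nrB _ _) _; rewrite mulrDl lerD//.
  by apply: le_trans (fC _ _) _; rewrite ler_wpM2r ?nr_ge0 ?ler_norm.
have e1 : 0 < e / 4 / K by rewrite !divr_gt0.
have [N1 hN1] := xiS _ e1; have [N2 hN2] := etaS _ e1.
pose N := maxn N1 N2.
have tail m : \sum_(N <= k < m) nr (xi k) * nr (eta k) <= e / 4 / K.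
  have [mN|Nm] := leqP m N; first by rewrite big_geq ?ltW.
  apply: (le_trans (y := \sum_(N <= k < m) (2^-1 * sq (xi k) + 2^-1 * sq (eta k)))).
    apply: ler_sum => k _; rewrite -!nr_sqr.
    by have := sqr_ge0 (nr (xi k) - nr (eta k)); lra.
  rewrite big_split /= -!mulr_sumr.
  have part (z : nat -> H) M : (M <= N)%N ->
      \sum_(N <= k < m) sq (z k) <= \sum_(M <= k < m) sq (z k).
    move=> MN; rewrite [X in _ <= X](big_cat_nat (n := N)) ?(ltnW Nm)//=.
    by rewrite lerDr sumr_ge0// => k _; exact: sq_ge0.
  have := part xi _ (leq_maxl _ _); have := part eta _ (leq_maxr _ _).
  have := hN1 m; have := hN2 m; lra.
have fin n0 : forall d : R, 0 < d -> exists M, forall n, (M <= n)%N ->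
    \sum_(0 <= k < n0) nr (f n (xi k) - x (xi k)) * nr (eta k) < d.
  elim: n0 => [|n0 IH] d d0; first by exists 0%N => n _; rewrite big_geq.
  have [M hM] := IH _ (divr_gt0 d0 (ltr0Sn R 1)).
  have k0 : 0 < nr (eta n0) + 1 by rewrite ltr_wpDl ?nr_ge0.
  have [M' hM'] := fx (xi n0) (d / 2 / (nr (eta n0) + 1)) ltac:(by rewrite !divr_gt0).
  exists (M + M')%N => n nM; rewrite big_nat_recr //=.
  have := hM n (leq_trans (leq_addr _ _) nM).
  have := hM' n (leq_trans (leq_addl _ _) nM); rewrite ltr_pdivlMr//.
  have := nr_ge0 (f n (xi n0) - x (xi n0)); move: (\sum_(0 <= k < n0) _) => t; lra.
have [M hM] := fin N _ (divr_gt0 e0 (ltr0Sn R 3)); exists M => n Mn.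
have /climP h1 := hw (f n); have /climP h2 := hw x.
have [m1 hm1] := h1 _ (divr_gt0 e0 (ltr0Sn R 3)).
have [m2 hm2] := h2 _ (divr_gt0 e0 (ltr0Sn R 3)).
pose m := (N + (m1 + m2))%N.
have Nm : (N <= m)%N := leq_addr _ _.
have m1m : (m1 <= m)%N := leq_trans (leq_addr _ _) (leq_addl _ _).
have m2m : (m2 <= m)%N := leq_trans (leq_addl _ _) (leq_addl _ _).
have := hm1 _ m1m; have := hm2 _ m2m; rewrite /series /=.
set a := \sum_(0 <= k < m) _; set b := \sum_(0 <= k < m) _ => a2 b1.
have ba : Num.sqrt (normc2 (b - a)) <= e / 4 + K * (e / 4 / K).
  have -> : b - a = \sum_(0 <= k < m) '[f n (xi k) - x (xi k), eta k].
    by rewrite /a /b -sumrB; apply: eq_bigr => k _; rewrite ipBl.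
  apply: le_trans (nc_sum _ _ _) _.
  rewrite (big_cat_nat (n := N))//= lerD//.
    apply/ltW/le_lt_trans/(hM _ Mn); apply: ler_sum => k _; exact: normc2_ip_le.
  apply: (le_trans (y := K * \sum_(N <= k < m) nr (xi k) * nr (eta k))).
    rewrite mulr_sumr; apply: ler_sum => k _; apply: le_trans (normc2_ip_le _ _) _.
    by rewrite mulrA ler_wpM2r ?nr_ge0 ?dK.
  by rewrite ler_wpM2l ?tail ?ltW.
have KK : K * (e / 4 / K) = e / 4 by rewrite mulrC divfK ?gt_eqF.
have -> : w (f n) - w x = - (b - w (f n)) + ((b - a) + (a - w x)).
  by rewrite opprB addrA subrKA addrA subrK.
have := ncD (- (b - w (f n))) ((b - a) + (a - w x)); have := ncD (b - a) (a - w x).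
by rewrite ncN; lra.
Qed.

End WeakStar.

(** * Von Neumann algebras and conjugation maps *)

Section VonNeumann.
Context (R : realType) (H : hilbertType R).
Implicit Types (u v w : H) (x y z k : bop H).
Local Notation re := (@complex.Re R).
Local Notation "'[ u , v ]" := (inner H u v).

Lemma commutantP (A : set (bop H)) x : commutant A x <-> forall y, A y -> forall u, y (x u) = x (y u).
Proof.
split=> [h y Ay u|h y Ay]; first by have := h y Ay => /(congr1 (fun t => bop_fun t u)).
by apply: bopP => u; rewrite !bopM h.
Qed.

Section Algebra.
Variable A : set (bop H).
Hypothesis vnA : von_neumann_algebra A.

Lemma vnP x : A x <-> forall y, commutant A y -> forall u, y (x u) = x (y u).
Proof. by rewrite -commutantP vnA.2. Qed.
Lemma vn1 : A (bop1 H).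
Proof. by apply/vnP => y _ u; rewrite !bop1E. Qed.
Lemma vn0 : A 0.
Proof. by apply/vnP => y _ u; rewrite !bop0 bopu0. Qed.
Lemma vnD x y : A x -> A y -> A (x + y).
Proof. by move=> /vnP hx /vnP hy; apply/vnP => z Cz u; rewrite !bopD bopuD (hx _ Cz) (hy _ Cz). Qed.
Lemma vnN x : A x -> A (- x).
Proof. by move=> /vnP hx; apply/vnP => z Cz u; rewrite !bopN bopuN hx. Qed.
Lemma vnB x y : A x -> A y -> A (x - y).
Proof. by move=> hx hy; apply: vnD => //; exact: vnN. Qed.
Lemma vnZ c x : A x -> A (c *: x).
Proof. by move=> /vnP hx; apply/vnP => z Cz u; rewrite !bopZ bopuZ hx. Qed.
Lemma vnM x y : A x -> A y -> A (bop_mul x y).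
Proof. by move=> /vnP hx /vnP hy; apply/vnP => z Cz u; rewrite !bopM (hx _ Cz) (hy _ Cz). Qed.
Lemma vn_sum I (s : seq I) (P : pred I) (F : I -> bop H) :
  (forall i, P i -> A (F i)) -> A (\sum_(i <- s | P i) F i).
Proof. by move=> h; elim/big_rec: _ => [|i x Pi]; [exact: vn0|apply: vnD; exact: h]. Qed.
Lemma vn_adj x : A x -> A (adj x).
Proof. by have [[_ _ _ h] _] := vnA; move=> /h[y Ay /is_adjointP <-]. Qed.
Lemma vn_inv x (g : bop H) : A x -> (forall u, g (x u) = u) -> (forall u, x (g u) = u) -> A g.
Proof.
move=> /vnP hx gx xg; apply/vnP => y Cy u.
by rewrite -[y (g u)]gx -(hx _ Cy) xg.
Qed.

Lemma comm_adj x : commutant A x -> commutant A (adj x).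
Proof.
move=> /commutantP h; apply/commutantP => y Ay u; apply: ip_inj => w.
by rewrite adjl -[y]adjK !adjl h //; exact: vn_adj.
Qed.

Lemma comm_vn : von_neumann_algebra (commutant A).
Proof.
split; last by rewrite vnA.2.
split.
- by apply/commutantP => y _ u; rewrite !bop0 bopu0.
- move=> c x y /commutantP hx /commutantP hy; apply/commutantP => z Az u.
  by rewrite !bopD !bopZ bopuD bopuZ (hx _ Az) (hy _ Az).
- move=> x y /commutantP hx /commutantP hy; apply/commutantP => z Az u.
  by rewrite !bopM (hx _ Az) (hy _ Az).
- by move=> x Cx; exists (adj x); [exact: comm_adj | apply/is_adjointP].
Qed.

End Algebra.

Definition cj k x : bop H := bop_mul (adj k) (bop_mul x k).

Lemma ip_cj k x u v : '[cj k x u, v] = '[x (k u), k v].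
Proof. by rewrite /cj !bopM adjl. Qed.

Lemma sq_summable_bop x (xi : nat -> H) : sq_summable xi -> sq_summable (fun n => x (xi n)).
Proof.
move=> h e e0; have [C C0 xC] := bop_bounded x.
have C2 : 0 < C ^+ 2 by rewrite exprn_gt0.
have [N hN] := h _ (divr_gt0 e0 C2); exists N => m.
apply: (le_lt_trans (y := C ^+ 2 * \sum_(N <= i < m) sq (xi i))).
  rewrite mulr_sumr; apply: ler_sum => i _.
  by rewrite -!nr_sqr -exprMn lerXn2r ?nnegrE ?mulr_ge0 ?nr_ge0// ltW.
by rewrite mulrC -ltr_pdivlMr.
Qed.

Lemma normal_functional_cj k (w : bop H -> R[i]) : normal_functional w -> normal_functional (w \o cj k).
Proof.
move=> [xi [eta [/sq_summableP hx /sq_summableP he hw]]].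
exists (fun n => k (xi n)), (fun n => k (eta n)); split.
- exact/sq_summableP/sq_summable_bop.
- exact/sq_summableP/sq_summable_bop.
- move=> x /=; have := hw (cj k x); rewrite (_ : (fun n => _) = (fun n => '[x (k (xi n)), k (eta n)])) //.
  by apply/funext => n; rewrite ip_cj.
Qed.

Lemma normal_map_pred (T : bop H -> bop H) :
  (forall w : bop H -> R[i], normal_functional w -> normal_functional (w \o T)) -> normal_map T.
Proof.
move=> h x; have F0 : Filter (nbhs (x : weakstar H)) by typeclasses eauto.
have FF := fmap_filter (T : weakstar H -> weakstar H) F0.
apply: (weakstar_cvgP (T x) FF).2 => -[w hw] /=.
exact: (weakstar_cvgP x F0).1 cvg_id (exist _ _ (h w hw)).
Qed.

Lemma cj_linear k : linear (cj k).
Proof. by move=> c x y; apply: bopP => u; rewrite /cj !bopD !bopZ !bopM bopD bopZ bopuD bopuZ. Qed.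

Lemma cj_normal_cp k : normal_cp (cj k).
Proof.
split; last by apply: normal_map_pred => w; exact: normal_functional_cj.
split; first exact: cj_linear.
move=> n X hX v; have := hX (fun i => k (v i)).
rewrite (_ : \sum_(i < n) _ = \sum_(i < n) \sum_(j < n) '[(map_mx (cj k) X) i j (v j), v i])//.
by apply: eq_bigr => i _; apply: eq_bigr => j _; rewrite mxE ip_cj.
Qed.

Lemma cj_bimodule (C : set (bop H)) k : commutant C k -> commutant C (adj k) ->
  bimodule_map C (cj k).
Proof.
move=> /commutantP hk /commutantP hk' a b x Ca Cb; apply: bopP => u.
by rewrite /cj !bopM hk// hk'.
Qed.

Lemma cj1 k : cj k (bop1 H) = bop_mul (adj k) k.
Proof. by apply: bopP => u; rewrite /cj !bopM bop1E. Qed.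

Lemma cj0 x : cj 0 x = 0.
Proof. by apply: bopP => u; rewrite /cj adj_bop0 !bopM !bop0. Qed.

Lemma cp_pos (T : bop H -> bop H) x : completely_positive T -> pos x -> pos (T x).
Proof.
move=> [_ h] px u; have := h 1%N (const_mx x).
have px' : positive_opmx (const_mx x : 'M[bop H]_1).
  by move=> v; rewrite !big_ord1 mxE.
by move=> /(_ px' (fun=> u)); rewrite !big_ord1 mxE mxE.
Qed.

Lemma linearTD (T : bop H -> bop H) : linear T -> forall x y, T (x + y) = T x + T y.
Proof. by move=> h x y; have := h 1 x y; rewrite !scale1r. Qed.
Lemma linearT0 (T : bop H -> bop H) : linear T -> T 0 = 0.
Proof. by move=> h; apply: (@addrI _ (T 0)); rewrite -(linearTD h) !addr0. Qed.
Lemma linearTZ (T : bop H -> bop H) : linear T -> forall c x, T (c *: x) = c *: T x.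
Proof. by move=> h c x; have := h c x 0; rewrite (linearT0 h) !addr0. Qed.
Lemma linearTN (T : bop H -> bop H) : linear T -> forall x, T (- x) = - T x.
Proof. by move=> h x; rewrite -scaleN1r (linearTZ h) scaleN1r. Qed.
Lemma linearTB (T : bop H -> bop H) : linear T -> forall x y, T (x - y) = T x - T y.
Proof. by move=> h x y; rewrite (linearTD h) (linearTN h). Qed.
Lemma linearT_sum (T : bop H -> bop H) : linear T ->
  forall I (s : seq I) (P : pred I) (F : I -> bop H),
  T (\sum_(i <- s | P i) F i) = \sum_(i <- s | P i) T (F i).
Proof. by move=> h I s P F; exact: (big_morph T (linearTD h) (linearT0 h)). Qed.

Lemma sum_over_fin (S : set nat) (I : nat -> bop H -> bop H) N (T : bop H -> bop H) :
  (forall (k : nat) x, (N <= k)%N -> I k x = 0) ->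
  (forall x, T x = \sum_(0 <= k < N | k \in S) I k x) -> sum_over S I T.
Proof.
move=> h hT x; apply: cvg_near_cst; exists N => // n /= Nn.
rewrite hT big_mkcond [RHS]big_mkcond /=.
by apply: sum_nat_cst_tail => // k Nk; case: ifP => // _; exact: h.
Qed.

End VonNeumann.

(** * Kraus operators by deflation *)

Section Kraus.
Context (R : realType) (H : hilbertType R).
Implicit Types (u v w e h zeta : H) (x y z k : bop H).
Local Notation re := (@complex.Re R).
Local Notation "'[ u , v ]" := (inner H u v).

(** Symmetry of the cross terms is extracted from nonnegativity: the imaginary parts at [z = 1] and
    [z = 'i] force [q] to be the conjugate of [p]. *)
Lemma quadratic_normc2_hermitian (a b : R) (p q : R[i]) : 0 <= b ->
  (forall z : R[i], 0 <= a%:C + (Num.conj z * p + z * q) + (normc2 z)%:C * b%:C) ->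
  normc2 p <= a * b.
Proof.
move=> b0 h; have qp : q = Num.conj p.
  have [/(congr1 (@complex.Im R)) + _] := ge0_re (h 1).
  have [/(congr1 (@complex.Im R)) + _] := ge0_re (h 'i).
  case: p q {h} => p1 p2 [q1 q2]; rewrite /normc2 /= => h1 h2.
  by apply/eqP; rewrite eq_complex /=; apply/andP; split; apply/eqP; lra.
rewrite -(normc2J p) -qp; apply: quadratic_normc2 => // z.
have [_] := ge0_re (h z); rewrite !reD -rmorphM /= qp.
by rewrite -[re (Num.conj z * p)]reJ rmorphM /= conjCK; lra.
Qed.

(** Bordering a matrix by one row and one column: positivity of its image at size [n.+1] yields
    Cauchy-Schwarz for a completely positive map at size [n]. *)
Definition block_opmx n (X : 'M[bop H]_n) (Y Y' : 'I_n -> bop H) z : 'M[bop H]_n.+1 :=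
  \matrix_(i, j) match unlift ord0 i, unlift ord0 j with
    | None, None => z | None, Some j => Y j | Some i, None => Y' i
    | Some i, Some j => X i j end.

Lemma block_opmxE n (X : 'M[bop H]_n) Y Y' z (v : 'I_n.+1 -> H) :
  \sum_(i < n.+1) \sum_(j < n.+1) '[block_opmx X Y Y' z i j (v j), v i] =
  \sum_(i < n) \sum_(j < n) '[X i j (v (lift ord0 j)), v (lift ord0 i)] +
  (\sum_(j < n) '[Y j (v (lift ord0 j)), v ord0] +
   \sum_(i < n) '[Y' i (v ord0), v (lift ord0 i)]) + '[z (v ord0), v ord0].
Proof.
rewrite big_ord_recl big_ord_recl /block_opmx mxE unlift_none.
rewrite (eq_bigr (fun j => '[Y j (v (lift ord0 j)), v ord0])); last first.
  by move=> j _; rewrite mxE unlift_none liftK.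
rewrite [X in _ + X = _](eq_bigr (fun i => '[Y' i (v ord0), v (lift ord0 i)] +
    \sum_(j < n) '[X i j (v (lift ord0 j)), v (lift ord0 i)])); last first.
  move=> i _; rewrite big_ord_recl mxE unlift_none liftK; congr (_ + _).
  by apply: eq_bigr => j _; rewrite mxE !liftK.
by rewrite big_split /=; ring.
Qed.

Lemma map_block_opmx (T : bop H -> bop H) n (X : 'M[bop H]_n) Y Y' z :
  map_mx T (block_opmx X Y Y' z) = block_opmx (map_mx T X) (T \o Y) (T \o Y') (T z).
Proof.
apply/matrixP => i j; rewrite !mxE.
by case: unliftP => [i' _|_]; case: unliftP => [j' _|_] //; rewrite mxE.
Qed.

Lemma cp_sum_ge0 (T : bop H -> bop H) n (X : 'M[bop H]_n) (v : 'I_n -> H) :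
  completely_positive T -> positive_opmx X ->
  0 <= \sum_(i < n) \sum_(j < n) '[T (X i j) (v j), v i].
Proof.
move=> cT Xp; have := cT.2 _ _ Xp v; congr (0 <= _).
by apply: eq_bigr => i _; apply: eq_bigr => j _; rewrite mxE.
Qed.

(** Testing the image of the bordered matrix at the vectors [(c *: w, v)] gives a nonnegative
    quadratic form in [c], to which the discriminant bound applies. *)
Lemma cp_cauchy_schwarz (T : bop H -> bop H) n (X : 'M[bop H]_n) Y Y' z (v : 'I_n -> H) w :
  completely_positive T -> pos z -> positive_opmx X -> positive_opmx (block_opmx X Y Y' z) ->
  normc2 (\sum_(j < n) '[T (Y j) (v j), w]) <=
  re (\sum_(i < n) \sum_(j < n) '[T (X i j) (v j), v i]) * re '[T z w, w].
Proof.
move=> cT zp Xp hp; have [Tzw Tzw0] := pos_re w (cp_pos cT zp).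
have [TXE _] := ge0_re (cp_sum_ge0 v cT Xp).
apply: (quadratic_normc2_hermitian (q := \sum_(i < n) '[T (Y' i) w, v i])) => // c.
have := cT.2 _ _ hp (fun i => if unlift ord0 i is Some i' then v i' else c *: w).
rewrite map_block_opmx block_opmxE unlift_none.
rewrite -Tzw -TXE; congr (0 <= _).
congr (_ + _ + _).
- by apply: eq_bigr => i _; apply: eq_bigr => j _; rewrite mxE !liftK.
- rewrite !mulr_sumr; congr (_ + _); apply: eq_bigr => i _; rewrite liftK /=.
    by rewrite ipZr.
  by rewrite bopuZ ipZl.
- by rewrite bopuZ ipZl ipZr mulrA mulcJ.
Qed.

Lemma ip_rank1 e h u v : '[rank1 e h u, v] = '[u, h] * '[e, v].
Proof. by rewrite rank1E ipZl. Qed.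

Lemma pos_rank1 e : pos (rank1 e e).
Proof. by move=> u; rewrite ip_rank1 [X in _ * X]ipC mulcJ lecR normc2_ge0. Qed.

Lemma rank1M e h x : bop_mul (rank1 e h) x = rank1 e (adj x h).
Proof. by apply: bopP => u; rewrite bopM !rank1E adjr. Qed.

Lemma rank1Dr c e h h' : rank1 e (c *: h + h') = Num.conj c *: rank1 e h + rank1 e h'.
Proof. by apply: bopP => u; rewrite bopD bopZ !rank1E ipDr ipZr scalerDl scalerA. Qed.

Lemma pos_rank1_le e : pos ((sq e)%:C *: bop1 H - rank1 e e).
Proof.
move=> u; rewrite bopB bopZ bop1E ipBl ipZl ip_rank1 [X in _ - _ * X]ipC mulcJ ip_sq.
by rewrite -rmorphM -rmorphB lecR subr_ge0 mulrC cauchy_schwarz.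
Qed.

Section Deflation.
Variables (A : set (bop H)) (T : bop H -> bop H).
Hypotheses (vnA : von_neumann_algebra A) (cT : completely_positive T).
Hypothesis bT : bimodule_map (commutant A) T.

(** For [T = \sum_i cj k_i] this operator is [\sum_i '[e, k_i zeta] *: k_i], a combination of the
    Kraus operators. Here it is built from [T] alone; boundedness comes from Cauchy-Schwarz between
    [rank1 v v] and [rank1 e e]. *)
Lemma choi_op_exists e zeta : exists a : bop H, forall u v, '[a u, v] = '[T (rank1 e v) u, zeta].
Proof.
have [C C0 T1b] := bop_bounded (T (bop1 H)).
pose c := re '[T (rank1 e e) zeta, zeta].
have c0 : 0 <= c by exact: (pos_re _ (cp_pos cT (pos_rank1 e))).2.
apply: (@sesqui_op _ _ _ (Num.sqrt (C * c))) => [b u v w|b u v w|u v].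
- by rewrite bopuD bopuZ ipDl ipZl.
- by rewrite rank1Dr (linearTD cT.1) (linearTZ cT.1) bopD bopZ ipDl ipZl.
have h : normc2 '[T (rank1 e v) u, zeta] <= re '[T (rank1 v v) u, u] * c.
  have := @cp_cauchy_schwarz T 1 (const_mx (rank1 v v)) (fun=> rank1 e v)
    (fun=> rank1 v e) (rank1 e e) (fun=> u) zeta cT (pos_rank1 e).
  rewrite !big_ord1 mxE; apply.
    by move=> t; rewrite !big_ord1 mxE; exact: pos_rank1.
  move=> t; rewrite block_opmxE !big_ord1 mxE !ip_rank1.
  set p := t (lift ord0 ord0); set q := t ord0.
  rewrite (ipC v p) (ipC e q).
  set s := '[p, v]; set r := '[q, e].
  have -> : s * Num.conj s + (s * Num.conj r + r * Num.conj s) + r * Num.conj r =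
    (s + r) * Num.conj (s + r) by rewrite rmorphD /=; ring.
  by rewrite mulcJ lecR normc2_ge0.
(* The operator inequality [rank1 v v <= sq v] reduces this to the bound [C] on [T(1)]. *)
have h2 : re '[T (rank1 v v) u, u] <= sq v * (C * sq u).
  have [_] := pos_re u (cp_pos cT (pos_rank1_le v)).
  rewrite (linearTB cT.1) (linearTZ cT.1) bopB bopZ ipBl ipZl reB reZ subr_ge0.
  move=> /le_trans; apply; rewrite ler_wpM2l ?sq_ge0//.
  apply: le_trans (ler_norm _) _; apply: le_trans (re_ip_le _ _) _.
  by rewrite -nr_sqr expr2 mulrA ler_wpM2r ?nr_ge0.
rewrite -!mulrA /nr -!sqrtrM ?mulr_ge0 ?sq_ge0 ?(ltW C0)//; apply: ler_wsqrtr.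
apply: le_trans h _; apply: le_trans (ler_wpM2r c0 h2) _; rewrite le_eqVlt; apply/orP; left.
by apply/eqP; ring.
Qed.

(** One step of a Cholesky-type elimination. With [a] as above and [c =
    '[T (rank1 e e) zeta, zeta]], the Kraus operator is [a] divided by the square root of [c].
    Cauchy-Schwarz for [T] at all matrix sizes says that subtracting it leaves a completely positive
    map, and this scaling removes all of [T] at [rank1 e e] and [zeta]. *)
Lemma deflate e zeta : exists k, [/\ A k,
  completely_positive (fun x => T x - cj k x) &
  '[T (rank1 e e) zeta, zeta] = '[cj k (rank1 e e) zeta, zeta]].
Proof.
have [a aE] := choi_op_exists e zeta.
have Aa : A a.
  apply/(vnP vnA) => b Cb u; apply: ip_inj => v.
  have C1 : commutant A (bop1 H) := vn1 (comm_vn vnA).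
  (* [rank1 e (adj b v)] is the product of [rank1 e v] and [b], so the module property of [T]
     becomes commutation of [a] with [b]. *)
  rewrite -adjr !aE -rank1M.
  have := bT (rank1 e v) C1 Cb => /(congr1 (fun t : bop H => t u)).
  rewrite !bopM !bop1E => <-; congr ('[T _ u, _]).
  by apply: bopP => t; rewrite !bopM bop1E.
have [cE c0] := pos_re zeta (cp_pos cT (pos_rank1 e)).
set c := re _ in cE c0.
(* In the order of complete positivity this is [cj a <= c T], before division by [c]. *)
have key n (X : 'M[bop H]_n) (v : 'I_n -> H) : positive_opmx X ->
    re (\sum_(i < n) \sum_(j < n) '[X i j (a (v j)), a (v i)]) <=
    re (\sum_(i < n) \sum_(j < n) '[T (X i j) (v j), v i]) * c.
  move=> Xp; have [BE B0] := ge0_re (Xp (fun i => a (v i))).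
  set B := \sum_(i < n) _ in BE B0 *.
  (* The block matrix is [(1, L)^* X (1, L)] with [L = |a v><e|]. *)
  pose Y j := \sum_(i < n) bop_mul (rank1 e (a (v i))) (X i j).
  pose Y' i := \sum_(j < n) bop_mul (X i j) (rank1 (a (v j)) e).
  pose z := B *: rank1 e e.
  have zp : pos z by move=> u; rewrite bopZ ipZl mulr_ge0 ?pos_rank1// BE lecR.
  have := @cp_cauchy_schwarz T n X Y Y' z v zeta cT zp Xp.
  have -> : \sum_(j < n) '[T (Y j) (v j), zeta] = B.
    rewrite /B exchange_big; apply: eq_bigr => j _.
    rewrite (linearT_sum cT.1) bop_sum ip_suml; apply: eq_bigr => i _.
    by rewrite rank1M -aE adjr.
  have Tz : T z = B *: T (rank1 e e) by rewrite /z (linearTZ cT.1).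
  rewrite Tz bopZ ipZl BE reZ normc2_real => h.
  have {h} : re B ^+ 2 <= re (\sum_(i < n) \sum_(j < n) '[T (X i j) (v j), v i]) * (re B * c).
    apply: h => t; rewrite block_opmxE.
    set r := '[t ord0, e]; set q := fun i => t (lift ord0 i).
    have := Xp (fun i => q i + r *: a (v i)).
    congr (0 <= _).
    transitivity (\sum_(i < n) \sum_(j < n) ('[X i j (q j), q i] +
      ('[X i j (q j), a (v i)] * Num.conj r + '[X i j (a (v j)), q i] * r) +
      '[X i j (a (v j)), a (v i)] * (r * Num.conj r))).
      apply: eq_bigr => i _; apply: eq_bigr => j _.
      by rewrite bopuD bopuZ ipDl !ipDr !ipZl !ipZr; ring.
    under eq_bigr do rewrite !big_split /=.
    rewrite !big_split /=; congr (_ + (_ + _) + _).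
    - rewrite exchange_big; apply: eq_bigr => j _.
      rewrite /Y bop_sum ip_suml; apply: eq_bigr => i _.
      by rewrite bopM ip_rank1 -ipC.
    - apply: eq_bigr => i _; rewrite /Y' bop_sum ip_suml; apply: eq_bigr => j _.
      by rewrite bopM rank1E bopuZ ipZl mulrC.
    - transitivity (B * '[rank1 e e (t ord0), t ord0]); last by rewrite BE -ipZl.
      rewrite ip_rank1 (ipC e) -/r /B big_distrl; apply: eq_bigr => i _.
      by rewrite big_distrl; apply: eq_bigr => j _.
  move: B0; rewrite le_eqVlt => /orP[/eqP <- _|B0].
    by apply: mulr_ge0 => //; have [_] := ge0_re (cp_sum_ge0 v cT Xp).
  by rewrite expr2 mulrCA mulrC ler_pM2l.
have nk : normc2 ((Num.sqrt c^-1)%:C : R[i]) = c^-1.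
  by rewrite normc2_real sqr_sqrtr ?invr_ge0.
pose k := (Num.sqrt c^-1)%:C *: a.
have kE x u v : '[cj k x u, v] = c^-1%:C * '[x (a u), a v].
  by rewrite ip_cj /k !bopZ bopuZ ipZl ipZr mulrA mulcJ nk.
exists k; split; first exact: vnZ.
  split=> [b x y|n X Xp v].
    by rewrite cT.1 cj_linear opprD scalerBr addrACA.
  have Tp := cp_sum_ge0 v cT Xp.
  have [TE _] := ge0_re Tp; have [BE B0] := ge0_re (Xp (fun i => a (v i))).
  rewrite (_ : \sum_(i < n) _ = \sum_(i < n) \sum_(j < n) '[T (X i j) (v j), v i] -
     c^-1%:C * \sum_(i < n) \sum_(j < n) '[X i j (a (v j)), a (v i)]); last first.
    rewrite mulr_sumr -sumrB; apply: eq_bigr => i _.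
    by rewrite mulr_sumr -sumrB; apply: eq_bigr => j _; rewrite mxE bopB ipBl kE.
  rewrite TE BE -rmorphM -rmorphB lecR subr_ge0.
  (* If [c = 0], its inverse is 0 by convention, so [k = 0] and nothing is subtracted. *)
  have [->|cn0] := eqVneq c 0.
    by rewrite invr0 mul0r; have [] := ge0_re Tp.
  have cp : 0 < c by rewrite lt_def cn0.
  by rewrite mulrC ler_pdivrMr// key.
rewrite kE ip_rank1 (ipC e).
have -> : '[a zeta, e] = c%:C by rewrite aE cE.
rewrite mulcJ normc2_real cE -rmorphM /=; congr (_%:C).
have [->|cn0] := eqVneq c 0; first by rewrite invr0 mul0r.
by rewrite expr2 mulrA mulVf// mul1r.
Qed.

End Deflation.

(** Deflation repeated along [e], for a fixed [zeta]. What is left on the other directions is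
    controlled later by normality of [T], so no infinite Kraus sum is formed. *)
Lemma kraus_list (A : set (bop H)) (T : bop H -> bop H) (e : nat -> H) zeta n :
  von_neumann_algebra A -> completely_positive T -> bimodule_map (commutant A) T ->
  exists ks : seq (bop H), [/\ forall k, k \in ks -> A k,
    completely_positive (fun x => T x - \sum_(k <- ks) cj k x) &
    forall j, (j < n)%N -> '[T (rank1 (e j) (e j)) zeta, zeta] =
       '[(\sum_(k <- ks) cj k (rank1 (e j) (e j))) zeta, zeta]].
Proof.
move=> vnA cT bT; elim: n => [|n [ks [Aks cks hks]]].
  exists [::]; split=> //; rewrite (_ : (fun x => _) = T)//.
  by apply/funext => x; rewrite big_nil subr0.
pose S x := T x - \sum_(k <- ks) cj k x.
have bS : bimodule_map (commutant A) S.
  move=> a b x Ca Cb; rewrite /S bT//.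
  have -> : \sum_(k <- ks) cj k (bop_mul a (bop_mul x b)) =
      \sum_(k <- ks) bop_mul a (bop_mul (cj k x) b).
    rewrite big_seq [RHS]big_seq; apply: eq_bigr => k /Aks Ak.
    by rewrite (cj_bimodule (C := commutant A)) ?vnA.2//; exact: vn_adj.
  apply: bopP => u; rewrite bopB !bopM bop_sum bopB bop_sum bopuB bopu_sum.
  by congr (_ - _); apply: eq_bigr => k _; rewrite !bopM.
have [k [Ak ck hk]] := deflate vnA cks bS (e n) zeta.
have SE x : T x - \sum_(j <- k :: ks) cj j x = S x - cj k x.
  by rewrite big_cons /S opprD addrA addrAC.
exists (k :: ks); split.
- by move=> j; rewrite inE => /orP[/eqP ->|/Aks].
- by rewrite (_ : (fun x => _) = (fun x => S x - cj k x))//; apply/funext => x; rewrite SE.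
- have key j : '[S (rank1 (e j) (e j)) zeta, zeta] = '[cj k (rank1 (e j) (e j)) zeta, zeta] ->
     '[T (rank1 (e j) (e j)) zeta, zeta] =
     '[(\sum_(k <- k :: ks) cj k (rank1 (e j) (e j))) zeta, zeta].
    move=> h; apply/eqP; rewrite -subr_eq0 -ipBl -bopB SE bopB ipBl h subrr //.
  move=> j; rewrite ltnS leq_eqVlt => /orP[/eqP ->|/hks hj]; apply: key; first exact: hk.
  (* At an earlier [j] the old remainder is already 0, while [cj k] and the new remainder are both
     nonnegative there; hence [cj k] contributes nothing. *)
  have S0 : '[S (rank1 (e j) (e j)) zeta, zeta] = 0 by rewrite /S bopB ipBl hj subrr.
  have := cp_pos ck (pos_rank1 (e j)) zeta.
  have := cp_pos (cj_normal_cp k).1 (pos_rank1 (e j)) zeta.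
  rewrite bopB ipBl -/(S _) S0 sub0r oppr_ge0 => h1 h2.
  by apply/eqP; rewrite eq_le h1 h2.
Qed.

End Kraus.

(** * An approximate identity of finite rank *)

Section ApproximateIdentity.
Context (R : realType) (H : hilbertType R).
Implicit Types (u v w e h : H) (x y z k : bop H).
Local Notation re := (@complex.Re R).
Local Notation "'[ u , v ]" := (inner H u v).

Lemma idem_nr x : adj x = x -> (forall u, x (x u) = x u) -> forall u, nr (x u) <= nr u.
Proof.
move=> xa xx u; apply: nr_le; first exact: nr_ge0.
rewrite nr_sqr; have uE : u = x u + (u - x u) by rewrite addrC subrK.
have e : '[x u, u - x u] = 0 by rewrite -{1}xa adjl bopuB xx subrr ip0r.
by rewrite {2}uE sqD e /=; have := sq_ge0 (u - x u); lra.
Qed.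

Lemma idem_pos x : adj x = x -> (forall u, x (x u) = x u) -> pos (bop1 H - x).
Proof.
move=> xa xx u; rewrite bopB bop1E.
have e : '[u - x u, x u] = 0 by rewrite -{2}xa adjr bopuB xx subrr ip0l.
have -> : '[u - x u, u] = '[u - x u, u - x u] by rewrite [RHS]ipBr e subr0.
by rewrite ip_sq lecR sq_ge0.
Qed.

Section GramSchmidt.
Variable d : nat -> H.
(** If [x] already fixes [d n], this vector is 0. The family is orthonormal up to zeros, hence the
    condition ['[e, e] *: e = e] below in place of a norm condition. *)
Let vec (x : bop H) n := (nr (d n - x (d n)))^-1%:C *: (d n - x (d n)).
Fixpoint gs_proj n := if n is m.+1 then gs_proj m + rank1 (vec (gs_proj m) m) (vec (gs_proj m) m)
  else 0.
Definition gs_vec n := vec (gs_proj n) n.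

Lemma gs_projS n : gs_proj n.+1 = gs_proj n + rank1 (vec (gs_proj n) n) (vec (gs_proj n) n).
Proof. by []. Qed.

Lemma gs_projE n : gs_proj n = \sum_(0 <= j < n) rank1 (gs_vec j) (gs_vec j).
Proof. by elim: n => [|n IH]; [rewrite big_geq | rewrite big_nat_recr //= -IH]. Qed.

Lemma adj_rank1 e h : adj (rank1 e h) = rank1 h e.
Proof.
apply/esym/is_adjointP => u v.
by rewrite ip_rank1 rank1E ipZr (ipC e) mulrC.
Qed.

Lemma gs_step x n (e := vec x n) : adj x = x -> (forall u, x (x u) = x u) ->
  [/\ x e = 0, '[e, e] *: e = e & x (d n) + '[d n, e] *: e = d n].
Proof.
move=> xa xx; pose r := d n - x (d n).
have xr : x r = 0 by rewrite /r bopuB xx subrr.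
have eE : e = (nr r)^-1%:C *: r by [].
have [r0|r0] := eqVneq (nr r) 0.
  have rr := nr_eq0 r0.
  rewrite eE rr scaler0 ip0l ip0r scaler0 addr0 bopu0; split=> //.
  by apply/esym/eqP; rewrite -subr_eq0 -/r rr.
have sr : sq r = nr r ^+ 2 by rewrite nr_sqr.
have dr : '[d n, r] = (nr r ^+ 2)%:C.
  have -> : d n = x (d n) + r by rewrite addrC subrK.
  by rewrite ipDl -{1}xa adjl xr ip0r add0r ip_sq sr.
split.
- by rewrite eE bopuZ xr scaler0.
- rewrite ip_sq eE sqZ normc2_real sr -exprMn mulVf// expr1n.
  by rewrite -[(1%:C)]/(1 : R[i]) scale1r.
- rewrite eE ipZr dr [Num.conj _](conjc_real (nr r)^-1) scalerA -!rmorphM /=.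
  have -> : (nr r)^-1 * nr r ^+ 2 * (nr r)^-1 = 1 by field.
  by rewrite -[(1%:C)]/(1 : R[i]) scale1r /r addrC subrK.
Qed.

Lemma gs_proj_idem n : adj (gs_proj n) = gs_proj n /\
  forall u, gs_proj n (gs_proj n u) = gs_proj n u.
Proof.
elim: n => [|n [xa xx]]; first by split=> [|u]; [exact: adj_bop0 | rewrite !bop0].
have [xe ee _] := gs_step n xa xx; rewrite gs_projS; set x := gs_proj n in xa xx xe ee *.
set e := vec x n in xe ee *; split; first by rewrite adjD adj_rank1 xa.
move=> u; rewrite !bopD !rank1E bopuD bopuZ xe scaler0 addr0 xx; congr (_ + _).
by rewrite ipDl -{1}xa adjl xe ip0r add0r ipZl -scalerA ee.
Qed.

Lemma gs_proj_fix n m : (n < m)%N -> gs_proj m (d n) = d n.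
Proof.
elim: m => // m IH; have [xa xx] := gs_proj_idem m.
have [xe ee dd] := gs_step m xa xx.
rewrite ltnS leq_eqVlt => /orP[/eqP ->|/IH h]; rewrite gs_projS bopD rank1E // h.
set t := '[d n, _]; have -> : t = 0 by rewrite /t -{1}h -{1}xa adjl xe ip0r.
by rewrite scale0r addr0.
Qed.

End GramSchmidt.

Lemma approximate_identity : separable H -> exists e : nat -> H,
  let E n := \sum_(0 <= j < n) rank1 (e j) (e j) in
  [/\ forall n, pos (bop1 H - E n),
      forall n u, nr (E n u) <= nr u &
      forall u, lim_to (fun n => E n u) u].
Proof.
move=> [D cD dD].
have near u (r : R) : 0 < r -> exists2 v, D v & nr (u - v) < r.
  move=> r0; have [|//|v [uv Dv]] := dD (ball u r%:C).
  - by exists u; apply: ballxx; rewrite ltcR.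
  - exact: ball_open.
  exists v => //; move: uv; rewrite -ball_normE /ball_ /= normE ltcR //.
have [v0 Dv0 _] := near 0 1 ltr01.
(* Indices outside the image of the injection [g] get the filler value 0; every point of [D] is
   still reached. *)
have [f fD] : exists f : nat -> H, forall v, D v -> exists n, f n = v.
  have [g gi] := countable_injP _ cD.
  have ex n : exists v, forall w, D w -> g w = n -> v = w.
    have [[v [Dv gv]]|no] := pselect (exists v, D v /\ g v = n).
      by exists v => w Dw gw; apply: gi; rewrite ?inE// gv gw.
    by exists 0 => w Dw gw; case: no; exists w.
  by have [f fP] := choice ex; exists f => v Dv; exists (g v); exact: fP.
exists (gs_vec f) => E; have EE n : E n = gs_proj f n by rewrite gs_projE.
split=> [n|n u|u r r0]; rewrite ?EE.
- by have [] := gs_proj_idem f n; exact: idem_pos.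
- by have [] := gs_proj_idem f n => xa xx; exact: idem_nr.
- have [v Dv uv] := near u (r / 2) ltac:(by rewrite divr_gt0).
  have [n nv] := fD v Dv; exists n.+1 => m nm; rewrite EE.
  have [xa xx] := gs_proj_idem f m.
  have -> : gs_proj f m u - u = gs_proj f m (u - v) - (u - v).
    by rewrite bopuB -nv gs_proj_fix// opprB addrA subrK.
  by apply: le_lt_trans (nrB _ _) _; have := idem_nr xa xx (u - v); lra.
Qed.

End ApproximateIdentity.

(** * Dominated operators *)

Section Fidelity.
Context (R : realType) (H : hilbertType R).
Implicit Types (u v w e h xi : H) (x y z k F : bop H).
Local Notation re := (@complex.Re R).
Local Notation "'[ u , v ]" := (inner H u v).

Definition tracial_vector (A : set (bop H)) (psi : H) := sq psi = 1 /\
  forall a b, A a -> A b -> '[a (b psi), psi] = '[b (a psi), psi].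

Definition inverse_pair (A : set (bop H)) x y :=
  [/\ A x, A y, pos x, pos y & (forall u, x (y u) = u) /\ (forall u, y (x u) = u)].

Definition dominated (A : set (bop H)) (psi : H) F := pos F /\
  forall x y, inverse_pair A x y -> forall xi,
    re '[F xi, xi] <= re '[y psi, psi] * re '[x xi, xi].

Lemma posD x y : pos x -> pos y -> pos (x + y).
Proof. by move=> hx hy u; rewrite bopD ipDl addr_ge0. Qed.
Lemma posZ (r : R) x : 0 <= r -> pos x -> pos (r%:C *: x).
Proof. by move=> r0 hx u; rewrite bopZ ipZl mulr_ge0// lecR. Qed.
Lemma pos_bop1 : pos (bop1 H).
Proof. by move=> u; rewrite bop1E ip_sq lecR sq_ge0. Qed.
Lemma pos_sum I (s : seq I) (P : pred I) (f : I -> bop H) :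
  (forall i, P i -> pos (f i)) -> pos (\sum_(i <- s | P i) f i).
Proof.
move=> h; elim/big_rec: _ => [u|i x Pi]; first by rewrite bop0 ip0l.
by apply: posD; exact: h.
Qed.

Lemma dominated_rank1 (A : set (bop H)) psi : dominated A psi (rank1 psi psi).
Proof.
split; first exact: pos_rank1.
move=> x y [_ _ xp yp [xy yx]] xi; rewrite ip_rank1 (ipC psi xi) mulcJ /=.
rewrite -{1}(xy psi) -(posl _ _ xp).
apply: le_trans (pos_cauchy_schwarz _ _ xp) _.
by rewrite mulrC xy re_ipC.
Qed.

Section Algebra.
Variables (A : set (bop H)) (psi : H).
Hypotheses (vnA : von_neumann_algebra A) (trA : tracial_vector A psi).

(* With [0 <= y <= 1] and [y_(n+1) = y_n - y_n^2], [y] is the strong sum of the [y_n^2]. *)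
Lemma trace_mul_ge0 D y : A D -> A y -> pos D -> pos y -> 0 <= re '[D (y psi), psi].
Proof.
move=> AD Ay Dp yp.
have [C C0 yC] := bop_bounded y.
(* Scaling puts [y] between 0 and 1, a range preserved by passing from [f] to [f - f ^ 2]. *)
pose y0 := C^-1%:C *: y.
pose f := fix f n := if n is m.+1 then f m - bop_mul (f m) (f m) else y0.
have fS n : f n.+1 = f n - bop_mul (f n) (f n) by [].
have inv n : [/\ A (f n), pos (f n) & pos (bop1 H - f n)].
  elim: n => [|n [Af fp fp1]].
    split; [exact: vnZ | by apply: posZ; rewrite ?invr_ge0 ?(ltW C0) |].
    move=> u; rewrite bopB bop1E bopZ ipBl ipZl ip_sq (pos_re u yp).1 -rmorphM -rmorphB lecR.
    rewrite subr_ge0 mulrC ler_pdivrMr//.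
    apply: le_trans (ler_norm _) _; apply: le_trans (re_ip_le _ _) _.
    by rewrite -nr_sqr expr2 mulrAC ler_wpM2r ?nr_ge0// mulrC.
  have Aff := vnM vnA Af Af.
  have ffp : pos (bop_mul (f n) (f n)).
    by move=> u; rewrite bopM (posl _ _ fp) ip_sq lecR sq_ge0.
  rewrite fS; split; first exact: vnB.
    (* For [f] commuting with [1 - f], one has [f - f ^ 2 = f (1 - f) f + (1 - f) f (1 - f)], a sum
       of two positive operators. *)
    move=> u; have := addr_ge0 (fp1 (f n u)) (fp (u - f n u)).
    rewrite !bopB !bop1E !bopM !bopuB !ipBl !ipBr.
    by congr (0 <= _); ring.
  by rewrite opprB addrCA addrC; apply: posD => //.
(* The difference is [tau(D f_n ^ 2)], which the trace property turns into
   ['[D (f n psi), f n psi]]. *)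
have step n : 0 <= re '[D (f n psi), psi] - re '[D (f n.+1 psi), psi].
  have [Af fp _] := inv n.
  rewrite -reB -ipBl -bopuB fS bopB bopM opprB addrC subrK.
  have -> : '[D (f n (f n psi)), psi] = '[D (f n psi), f n psi].
    by have := trA.2 _ _ (vnM vnA AD Af) Af; rewrite !bopM => ->; rewrite (posl _ psi fp).
  exact: (pos_re _ Dp).2.
have mono n : re '[D (f n psi), psi] <= re '[D (f 0%N psi), psi].
  by elim: n => // n; apply: le_trans; rewrite -subr_ge0.
have sums n : \sum_(0 <= k < n) sq (f k psi) <= re '[f 0%N psi, psi].
  have [_ fp _] := inv n.
  suff -> : \sum_(0 <= k < n) sq (f k psi) = re '[f 0%N psi, psi] - re '[f n psi, psi].
    by rewrite gerBl (pos_re _ fp).2.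
  elim: n {fp} => [|n IH]; first by rewrite big_geq// subrr.
  have [_ fp _] := inv n.
  rewrite big_nat_recr // [LHS]/= IH fS bopB bopM ipBl reB (posl (f n psi) psi fp) /sq.
  by ring.
(* The squares have bounded partial sums, so some [f n psi] is small. There the decreasing values of
   [tau(D f_n)] are at least [- r], and so is the value at [n = 0]. *)
have small (r : R) : 0 < r -> exists n, sq (f n psi) < r.
  move=> r0; apply: contrapT => /forallNP h.
  have hr n : r <= sq (f n psi) by rewrite leNgt; apply/negP/h.
  have [n hn] : exists n, re '[f 0%N psi, psi] < r *+ n.
    have q0 : 0 <= `|re '[f 0%N psi, psi]| / r by rewrite divr_ge0// ltW.
    exists (Num.bound (`|re '[f 0%N psi, psi]| / r)).
    have := archi_boundP q0; rewrite ltr_pdivrMr// mulr_natl => h0.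
    exact: le_lt_trans (ler_norm _) h0.
  have := sums n; rewrite leNgt => /negP; apply; apply: lt_le_trans hn _.
  rewrite -[n in r *+ n]subn0 -sumr_const_nat; exact: ler_sum.
suff h : 0 <= re '[D (f 0%N psi), psi].
  move: h; rewrite -[f 0%N]/y0 /y0 bopZ bopuZ ipZl reZ pmulr_rge0// invr_gt0 //.
have [K K0 DK] := bop_bounded D.
rewrite -[X in X <= _]subr0 lerBlDr; apply: small_le => r r0.
have rK : 0 < (r / K) ^+ 2 by rewrite exprn_gt0// divr_gt0.
have [n hn] := small _ rK.
have nrn : nr (f n psi) <= r / K.
  by apply: nr_le; rewrite ?(ltW hn)// ltW// divr_gt0.
have := mono n.
have p1 : nr psi = 1 by rewrite /nr trA.1 sqrtr1.
have := re_ip_le (D (f n psi)) psi; rewrite p1 mulr1 ler_norml => /andP[h1 _].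
have := DK (f n psi); have : K * nr (f n psi) <= r by rewrite mulrC -ler_pdivlMr.
lra.
Qed.

(** The operator [a] may fail to be invertible; adding [d] makes [yd = d + a y (adj a)] invertible
    with inverse [xd], and domination of [F] applies to this pair. What remains is the operator
    inequality [(adj a) xd a <= x]; [d] is then sent to 0. *)
Lemma dominated_conj F a x y xi : dominated A psi F -> A a -> inverse_pair A x y ->
  re '[F (a xi), a xi] <= re '[y (adj a psi), adj a psi] * re '[x xi, xi].
Proof.
move=> [Fp Fd] Aa [Ax Ay xp yp [xy yx]].
set t := re '[y _, _]; set X := re '[x xi, xi].
have X0 : 0 <= X := (pos_re xi xp).2.
have t0 : 0 <= t := (pos_re _ yp).2.
suff h (d : R) : 0 < d -> re '[F (a xi), a xi] <= (t + d) * X.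
  apply: small_le => r r0; have X1 : 0 < X + 1 by rewrite ltr_wpDl.
  have d0 : 0 < r / (X + 1) by rewrite divr_gt0.
  apply: le_trans (h _ d0) _; rewrite mulrDl lerD2l.
  by rewrite mulrAC ler_pdivrMr// ler_wpM2l ?(ltW r0)// lerDl.
move=> d0; pose y1 := bop_mul a (bop_mul y (adj a)).
have y1p : pos y1 by move=> u; rewrite /y1 !bopM -adjr yp.
have Aa' := vn_adj vnA Aa.
have Ay1 : A y1 by do 2?apply: vnM.
pose s := d^-1%:C *: y1.
have sp : pos s by apply: posZ; rewrite ?invr_ge0 ?ltW.
have [g [gs1 gs2 gp _]] := inverse1p sp.
have Ag : A g.
  apply: (vn_inv vnA (x := bop1 H + s)) => [|u|u]; rewrite ?bopD ?bop1E//.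
  by apply: vnD => //; [exact: vn1 | exact: vnZ].
pose yd := d%:C *: bop1 H + y1.
pose xd := d^-1%:C *: g.
have dd : d%:C * d^-1%:C = 1 :> R[i] by rewrite -rmorphM /= divff ?gt_eqF.
have ydE u : yd u = d%:C *: (u + s u).
  by rewrite scalerDr /s bopZ scalerA dd scale1r /yd bopD bopZ bop1E.
have pair : inverse_pair A xd yd.
  split.
  - exact: vnZ.
  - by apply: vnD => //; apply: vnZ => //; exact: vn1.
  - by apply: posZ; rewrite ?invr_ge0 ?ltW.
  - by apply: posD => //; apply: posZ; [exact: ltW | exact: pos_bop1].
  - split=> u.
      by rewrite /xd bopZ ydE bopuZ scalerA mulrC dd scale1r gs2.
    by rewrite ydE /xd bopZ bopuZ -scalerDr scalerA dd scale1r gs1.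
have [_ _ xdp _ [xy1 yx1]] := pair.
have tE : re '[yd psi, psi] = t + d.
  rewrite /yd bopD bopZ bop1E ipDl ipZl reD reZ -/(sq psi) trA.1 mulr1 addrC.
  by rewrite /y1 !bopM -(adjr a).
apply: le_trans (Fd _ _ pair (a xi)) _.
rewrite tE ler_wpM2l ?addr_ge0 ?(ltW d0)//.
(* With [c = '[xd (a xi), a xi] = '[adj a eta, xi]], Cauchy-Schwarz for the form [x] at
   [y (adj a eta)] and [xi] gives [c ^ 2 <= c * X], because [y1 <= yd]. *)
pose eta := xd (a xi).
set c := re '[xd _, _]; have [cE c0] := pos_re (a xi) xdp.
have h1 : normc2 '[x (y (adj a eta)), xi] <= re '[y (adj a eta), adj a eta] * X.
  apply: le_trans (pos_cauchy_schwarz _ _ xp) _.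
  by rewrite xy re_ipC.
have h2 : '[x (y (adj a eta)), xi] = c%:C by rewrite xy adjl.
have h3 : re '[y (adj a eta), adj a eta] <= c.
  have -> : c = re '[yd eta, eta] by rewrite re_ipC /eta yx1.
  rewrite /yd bopD bopZ bop1E ipDl reD ipZl reZ -/(sq eta).
  by rewrite /y1 !bopM -(adjr a) lerDr mulr_ge0 ?sq_ge0 ?ltW.
move: h1; rewrite h2 normc2_real => h1.
have [c00|cn] := eqVneq c 0; first by rewrite c00.
have cp : 0 < c by rewrite lt_def cn.
rewrite -(ler_pM2l cp) -expr2; apply: le_trans h1 _.
by rewrite ler_wpM2r.
Qed.

End Algebra.
End Fidelity.
Arguments pos_bop1 {R H}.

(** * Preservation of domination by LOCC maps *)

Section Monotone.
Context (R : realType) (H : hilbertType R).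
Implicit Types (u v w xi : H) (x y z F : bop H).
Local Notation re := (@complex.Re R).
Local Notation "'[ u , v ]" := (inner H u v).

Variables (A : set (bop H)) (psi : H).
Hypotheses (sepH : separable H) (vnA : von_neumann_algebra A) (trA : tracial_vector A psi).

Lemma bimodule1 (C : set (bop H)) T b : von_neumann_algebra C -> bimodule_map C T -> C b ->
  T b = bop_mul b (T (bop1 H)) /\ T b = bop_mul (T (bop1 H)) b.
Proof.
move=> vnC bT Cb; have C1 := vn1 vnC; split.
  have := bT b (bop1 H) (bop1 H) Cb C1.
  rewrite (_ : bop_mul b (bop_mul _ _) = b); last by apply: bopP => u; rewrite !bopM !bop1E.
  by move=> ->; apply: bopP => u; rewrite !bopM bop1E.
have := bT (bop1 H) b (bop1 H) C1 Cb.
rewrite (_ : bop_mul (bop1 H) (bop_mul _ _) = b); last by apply: bopP => u; rewrite !bopM !bop1E.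
by move=> ->; apply: bopP => u; rewrite !bopM bop1E.
Qed.

Lemma bimodule_unit T : bimodule_map (commutant A) T -> A (T (bop1 H)).
Proof.
move=> bT; apply/(vnP vnA) => b Cb u.
have [e1 e2] := bimodule1 (comm_vn vnA) bT Cb.
by have := congr1 (fun t : bop H => t u) e1; rewrite e2 !bopM.
Qed.

Lemma pos_sub x y : pos x -> pos y -> (forall u, re '[x u, u] <= re '[y u, u]) -> pos (y - x).
Proof.
move=> xp yp h u; rewrite bopB ipBl (pos_re u xp).1 (pos_re u yp).1 -rmorphB lecR subr_ge0.
exact: h.
Qed.

Lemma pos_upper F : pos F -> exists2 C : R, 0 < C & pos (C%:C *: bop1 H - F).
Proof.
move=> Fp; have [C C0 FC] := bop_bounded F; exists C => //.
apply: pos_sub => //; first by apply: posZ; [exact: ltW|exact: pos_bop1].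
move=> u; rewrite bopZ bop1E ipZl reZ -/(sq u) -nr_sqr.
apply: le_trans (ler_norm _) _; apply: le_trans (re_ip_le _ _) _.
by rewrite expr2 mulrA ler_wpM2r ?nr_ge0.
Qed.

(** For a Kraus sum [T = \sum cj k], domination at each [k] gives the factor
    [\sum tau(k y (adj k)) = tau(T(1) y)]. Finitely many terms are split off here; by [F <= C] the
    remainder [S] satisfies [S(F) <= C S(1)], at [xi] the value of [S(1)] is that of [S(1 - E N)],
    and [S(1 - E N) <= T(1 - E N)] is small there by normality. *)
Lemma dominated_cp T F x y xi : normal_cp T -> bimodule_map (commutant A) T ->
  dominated A psi F -> inverse_pair A x y ->
  re '[T F xi, xi] <= re '[T (bop1 H) (y psi), psi] * re '[x xi, xi].
Proof.
move=> [cT nT] bT dF xy; have [Ax Ay xp yp _] := xy; have Fp := dF.1.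
have [e] := approximate_identity sepH.
set E := fun n => \sum_(0 <= j < n) rank1 (e j) (e j) => -[E1 Eb Elim].
have [C C0 FC] := pos_upper Fp.
have limE : (E : nat -> weakstar H) @ \oo --> (bop1 H : weakstar H).
  by apply: (weakstar_strong (C := 1)) => [n u|u]; rewrite ?mul1r//; exact: Elim.
have limTE : (fun n => T (E n) : weakstar H) @ \oo --> (T (bop1 H) : weakstar H).
  exact: cvg_comp limE (nT (bop1 H)).
have {}limTE := clim_re (weakstar_clim limTE xi xi).
have X0 := (pos_re xi xp).2.
apply: small_le => r r0; have [N hN] := limTE _ (divr_gt0 r0 C0).
have [ks [Aks cS hS]] := kraus_list e xi N vnA cT bT.
pose S z := T z - \sum_(k <- ks) cj k z.
have {}cS : completely_positive S := cS.
have TE z : re '[T z xi, xi] = \sum_(k <- ks) re '[z (k xi), k xi] + re '[S z xi, xi].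
  rewrite /S bopB ipBl reB bop_sum ip_suml re_sum.
  by under [X in _ = _ + (_ - X)]eq_bigr do rewrite ip_cj; rewrite addrC subrK.
have h1 : \sum_(k <- ks) re '[F (k xi), k xi] <=
    re '[T (bop1 H) (y psi), psi] * re '[x xi, xi].
  apply: (le_trans (y := (\sum_(k <- ks) re '[y (adj k psi), adj k psi]) * re '[x xi, xi])).
    rewrite mulr_suml big_seq [X in _ <= X]big_seq; apply: ler_sum => k /Aks Ak.
    exact: (dominated_conj vnA trA).
  rewrite ler_wpM2r//.
  (* The part [S(1)] of [T(1)] left over is positive in [A] and has nonnegative trace against [y];
     the trace property rewrites [tau(k y (adj k))] as [tau((adj k) k y)]. *)
  have AD : A (S (bop1 H)).
    apply: vnB => //; first exact: bimodule_unit.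
    rewrite big_seq; apply: vn_sum => // k /Aks Ak; rewrite cj1.
    by apply: vnM => //; exact: vn_adj.
  have := trace_mul_ge0 vnA trA AD Ay (cp_pos cS pos_bop1) yp.
  rewrite /S bopB ipBl reB subr_ge0; apply: le_trans.
  rewrite bop_sum ip_suml re_sum big_seq [X in _ <= X]big_seq; apply: ler_sum => k /Aks Ak.
  rewrite cj1 bopM adjl adjr.
  have := trA.2 _ _ (vn_adj vnA Ak) (vnM vnA Ak Ay); rewrite !bopM => h.
  by rewrite -adjl h.
have SE : re '[S (E N) xi, xi] = 0.
  rewrite /E (linearT_sum cS.1) bop_sum ip_suml re_sum big_nat_cond big1// => j /andP[/andP[_ jN] _].
  by rewrite /S bopB ipBl hS// subrr.
have h2 : re '[S F xi, xi] <= C * re '[S (bop1 H) xi, xi].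
  have [_] := pos_re xi (cp_pos cS FC).
  rewrite (linearTB cS.1) (linearTZ cS.1) bopB bopZ ipBl ipZl reB reZ.
  by rewrite subr_ge0.
have h3 : re '[S (bop1 H) xi, xi] <= re '[T (bop1 H) xi, xi] - re '[T (E N) xi, xi].
  have -> : re '[S (bop1 H) xi, xi] = re '[S (bop1 H - E N) xi, xi].
    by rewrite (linearTB cS.1) bopB ipBl reB SE subr0.
  rewrite -reB -ipBl -bopB -(linearTB cT.1) TE lerDr; apply: sumr_ge0 => k _.
  exact: (pos_re _ (E1 N)).2.
have := hN N (leqnn _); rewrite ltr_norml ltr_pdivlMr// => /andP[h4 h5].
rewrite TE lerD// (le_trans h2)//.
have : - (r / C) < re '[T (E N) xi, xi] - re '[T (bop1 H) xi, xi] by [].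
move: h3 h4 h5; set p := re _; set q := re _; set t := re _ => h3 h4 h5 h6.
have {h6} : q - t <= r / C by lra.
rewrite ler_pdivlMr// mulrC => h6; apply: le_trans h6.
by rewrite ler_pM2l.
Qed.

Lemma dominated0 : dominated A psi 0.
Proof.
split=> [u|x y [_ _ xp yp _] xi]; rewrite bop0 ip0l //.
by rewrite mulr_ge0 ?(pos_re _ xp).2 ?(pos_re _ yp).2.
Qed.

(** The operators [F k] may differ because, in the Heisenberg picture, [I k] acts on what the later
    rounds chosen after outcome [k] produce. Finite partial sums keep convergence questions out of
    the induction. *)
Definition preserves_dominated (I : nat -> bop H -> bop H) := forall N (F : nat -> bop H),
  (forall k, dominated A psi (F k)) -> dominated A psi (\sum_(0 <= k < N) I k (F k)).

Lemma rlim_ge_from (f : nat -> R) l a N : (forall n, (N <= n)%N -> a <= f n) -> rlim f l -> a <= l.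
Proof.
move=> h fl; apply: (@rlim_ge _ (fun n => f (n + N)%N)) => [n|r /fl[M hM]].
  by apply: h; exact: leq_addl.
by exists M => n Mn; apply: hM; exact: leq_trans (leq_addr _ _).
Qed.

Lemma sum_nonneg_le (f : nat -> R) l N : (forall n, 0 <= f n) ->
  rlim (fun n => \sum_(0 <= k < n) f k) l -> \sum_(0 <= k < N) f k <= l.
Proof.
move=> f0; apply: (rlim_ge_from (N := N)) => n Nn.
by rewrite (big_cat_nat _ Nn)//= lerDl sumr_ge0.
Qed.

Lemma total_rlim (I : nat -> bop H -> bop H) T x u v : total_map I T ->
  rlim (fun n => \sum_(0 <= k < n) re '[I k x u, v]) (re '[T x u, v]).
Proof.
move=> /(_ x)/weakstar_clim/(_ u v)/clim_re h r /h[N hN]; exists N => n /hN.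
rewrite bop_sum ip_suml re_sum; congr (`|_ - _| < _).
by apply: eq_bigl => k; rewrite in_setT.
Qed.

(** Write the maps as [P_k \o Q_k]. In the right case [Q_k(F_k) <= tau(q_k y) x] with
    [q_k = Q_k(1)], the unital map [P_k] fixes [x], and the [q_k] sum to 1. In the left case
    [Q_k(F_k) <= tau(y) x] and [P_k(x) = x P_k(1)], where the [P_k(1)] sum to 1. *)
Lemma one_way_preserves I : one_way A I -> preserves_dominated I.
Proof.
case=> -[[cI [T [[cT nT] T1] IT]] loc] N F dF.
  have ex k : exists PQ, [/\ UCPsigma A PQ.1, CPsigma (commutant A) PQ.2 & PQ.1 \o PQ.2 = I k].
    by have [P hP [Q hQ] <-] := loc k; exists (P, Q).
  have [PQ hPQ] := choice ex; split.
    by apply: pos_sum => k _; exact: (cp_pos (cI k).1 (dF k).1).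
  move=> x y xy xi; have [Ax Ay xp yp _] := xy.
  pose q k := (PQ k).2 (bop1 H).
  have Aq k : A (q k) by have [_ [_ bQ] _] := hPQ k; exact: bimodule_unit.
  have qE k : I k (bop1 H) = q k.
    have [[[_ P1] bP] _ <-] := hPQ k.
    have [e1 _] := bimodule1 vnA bP (Aq k); rewrite /= e1 P1.
    by apply: bopP => u; rewrite bopM bop1E.
  have t0 k : 0 <= re '[q k (y psi), psi].
    apply: (trace_mul_ge0 vnA trA) => //; rewrite -qE.
    by exact: (cp_pos (cI k).1 pos_bop1).
  rewrite bop_sum ip_suml re_sum.
  apply: (le_trans (y := (\sum_(0 <= k < N) re '[q k (y psi), psi]) * re '[x xi, xi])).
    rewrite mulr_suml; apply: ler_sum => k _.
    have [[[[cP _] P1] bP] [nQ bQ] <-] := hPQ k.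
    have QFp : pos ((PQ k).2 (F k)) := cp_pos nQ.1 (dF k).1.
    have : pos ((re '[q k (y psi), psi])%:C *: x - (PQ k).2 (F k)).
      apply: pos_sub => //; first exact: posZ.
      by move=> u; rewrite bopZ ipZl reZ; exact: dominated_cp.
    move=> /(cp_pos cP)/(pos_re xi)[_].
    rewrite (linearTB cP.1) (linearTZ cP.1) (bimodule1 vnA bP Ax).1 P1 bopB bopZ bopM bop1E.
    by rewrite ipBl ipZl reB reZ subr_ge0.
  rewrite ler_wpM2r ?(pos_re _ xp).2//.
  (* Partial sums of the [q k] stay below 1; the defect is positive in [A], so its trace against [y]
     is nonnegative. *)
  have AD : A (bop1 H - \sum_(0 <= k < N) q k).
    by apply: vnB => //; [exact: vn1 | apply: vn_sum].
  have Dp : pos (bop1 H - \sum_(0 <= k < N) q k).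
    apply: pos_sub; last first.
    - move=> u; rewrite bop_sum ip_suml re_sum.
      have -> : '[bop1 H u, u] = '[T (bop1 H) u, u] by rewrite T1.
      apply: sum_nonneg_le => [k|]; last first.
        move=> r r0; have [M hM] := total_rlim (bop1 H) u u IT r0; exists M => n /hM.
        by under eq_bigr do rewrite qE.
      by apply: (pos_re _ _).2; rewrite -qE; exact: (cp_pos (cI k).1 pos_bop1).
    - exact: pos_bop1.
    - apply: pos_sum => k _; rewrite -qE; exact: (cp_pos (cI k).1 pos_bop1).
  have := trace_mul_ge0 vnA trA AD Ay Dp yp.
  by rewrite bopB bop1E ipBl reB subr_ge0 bop_sum ip_suml re_sum.
have ex k : exists PQ, [/\ CPsigma A PQ.1, UCPsigma (commutant A) PQ.2 & PQ.1 \o PQ.2 = I k].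
  by have [P hP [Q hQ] <-] := loc k; exists (P, Q).
have [PQ hPQ] := choice ex; split.
  by apply: pos_sum => k _; exact: (cp_pos (cI k).1 (dF k).1).
move=> x y xy xi; have [Ax Ay xp yp _] := xy.
have t0 := (pos_re psi yp).2.
rewrite bop_sum ip_suml re_sum.
(* In [x P_k(1)] the factor [x] is moved to the second argument, leaving a partial sum of the total
   map at the identity. *)
apply: (le_trans (y := re '[y psi, psi] * \sum_(0 <= k < N) re '[I k (bop1 H) xi, x xi])).
  rewrite mulr_sumr; apply: ler_sum => k _.
  have [[nP bP] [[nQ Q1] bQ] <-] := hPQ k; have cP := nP.1.
  have : pos ((re '[y psi, psi])%:C *: x - (PQ k).2 (F k)).
    apply: pos_sub; [exact: (cp_pos nQ.1 (dF k).1) | exact: posZ |].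
    move=> u; rewrite bopZ ipZl reZ; have := dominated_cp u nQ bQ (dF k) xy.
    by rewrite Q1 bop1E.
  move=> /(cp_pos cP)/(pos_re xi)[_].
  rewrite (linearTB cP.1) (linearTZ cP.1) (bimodule1 vnA bP Ax).1 bopB bopZ bopM.
  by rewrite ipBl ipZl reB reZ subr_ge0 (posl _ _ xp) /= Q1.
rewrite ler_wpM2l//; apply: le_trans (sum_nonneg_le N _ (total_rlim (bop1 H) xi (x xi) IT)) _.
  move=> k; rewrite -(posl _ _ xp).
  have [[nP bP] [[nQ Q1] bQ] <-] := hPQ k; rewrite /= Q1 -bopM -(bimodule1 vnA bP Ax).1.
  exact: (pos_re _ (cp_pos nP.1 xp)).2.
by rewrite T1 bop1E re_ipC.
Qed.

Lemma dominated_lim (f : nat -> bop H) F : (forall n, dominated A psi (f n)) -> pos F ->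
  (forall u, rlim (fun n => re '[f n u, u]) (re '[F u, u])) -> dominated A psi F.
Proof.
move=> df Fp hf; split=> // x y xy xi; apply: rlim_le (hf xi) => n.
exact: (df n).2.
Qed.

Lemma rlim_sum (I : Type) (s : seq I) (f : I -> nat -> R) (l : I -> R) :
  (forall i, rlim (f i) (l i)) -> rlim (fun n => \sum_(i <- s) f i n) (\sum_(i <- s) l i).
Proof.
move=> h; elim: s => [|i s IH] r r0.
  by exists 0%N => n _; rewrite !big_nil subrr normr0.
have [N hN] := IH _ (divr_gt0 r0 (ltr0Sn R 1)).
have [M hM] := h i _ (divr_gt0 r0 (ltr0Sn R 1)).
exists (N + M)%N => n nNM; rewrite !big_cons.
have := hN n (leq_trans (leq_addr _ _) nNM); have := hM n (leq_trans (leq_addl _ _) nNM).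
by rewrite !ltr_norml; lra.
Qed.

Lemma linked_preserves J I : preserves_dominated I -> (forall k, normal_cp (I k)) ->
  linked A J I -> preserves_dominated J.
Proof.
move=> pI cI [[cJ _] [K owK [e [f ef fe] [S [_ trivS hS]]]]] N F dF.
pose IK m := I (e m).1 \o K (e m).1 (e m).2.
have cK k i : normal_cp (K k i) by have [[[h _] _]|[[h _] _]] := owK k.
have linIK m : linear (IK m).
  by move=> c x y; rewrite /IK /= (cK _ _).1.1 (cI _).1.1.
(* The blocks are disjoint, so this sum has at most one term: it is the operator seen by the
   fine-grained outcome [m]. *)
pose G m := \sum_(0 <= j < N | m \in S j) F j.
have dG m : dominated A psi (G m).
  have [[j [jN mj]]|no] := pselect (exists j, (j < N)%N /\ m \in S j).
    rewrite /G (_ : \sum_(0 <= j < N | m \in S j) F j = F j)//.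
    rewrite (big_rem j) /=; last by rewrite mem_index_iota.
    rewrite mj big1_seq ?addr0// => i /andP[mi].
    rewrite mem_rem_uniq ?iota_uniq// inE => /andP[/eqP ij _]; case: ij.
    apply: (trivS i j) => //; exists m; split; exact/set_mem.
  rewrite /G big1_seq; first exact: dominated0.
  by move=> j /andP[mj]; rewrite mem_index_iota => /= jN; case: no; exists j.
apply: (@dominated_lim (fun n => \sum_(0 <= m < n) IK m (G m))).
(* The first [n] relabelled outcomes fit in a square of side [M]. Padding with 0 turns their sum
   into an iterated one, to which preservation applies first for each [K k] and then for [I]. *)
- move=> n; have [M hM] : exists M, forall m, (m < n)%N -> ((e m).1 < M)%N /\ ((e m).2 < M)%N.
    exists (\max_(m < n) maxn (e m).1 (e m).2).+1 => m mn; rewrite !ltnS.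
    by split; apply: leq_trans (leq_bigmax (Ordinal mn)); rewrite ?leq_maxl ?leq_maxr.
  pose L k i := if (f (k, i) < n)%N then G (f (k, i)) else 0.
  have dL k i : dominated A psi (L k i).
    by rewrite /L; case: ifP => // _; exact: dominated0.
  suff -> : \sum_(0 <= m < n) IK m (G m) =
      \sum_(0 <= k < M) I k (\sum_(0 <= i < M) K k i (L k i)).
    by apply: pI => k; apply: one_way_preserves.
  transitivity (\sum_(p <- [seq e m | m <- index_iota 0 n]) I p.1 (K p.1 p.2 (G (f p)))).
    by rewrite big_map; apply: eq_bigr => m _; rewrite ef.
  transitivity (\sum_(p <- [seq (k, i) | k <- index_iota 0 M, i <- index_iota 0 M] |
      (f p < n)%N) I p.1 (K p.1 p.2 (G (f p)))).
    rewrite -[RHS]big_filter; apply: perm_big; apply: uniq_perm.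
    - by rewrite map_inj_uniq ?iota_uniq//; exact: can_inj ef.
    - by rewrite filter_uniq// allpairs_uniq ?iota_uniq// => -[a b] [c d].
    - move=> p; rewrite mem_filter; apply/mapP/andP => [[m]|[pn _]].
        rewrite mem_index_iota => /andP[_ mn] ->; rewrite ef; split=> //.
        apply/allpairsP; exists (e m); split; last exact: surjective_pairing.
          by rewrite mem_index_iota (hM m mn).1.
        by rewrite mem_index_iota (hM m mn).2.
      by exists (f p); rewrite ?fe// mem_index_iota.
  rewrite big_mkcond big_allpairs; apply: eq_bigr => k _.
  rewrite (linearT_sum (cI k).1.1); apply: eq_bigr => i _; rewrite /L.
  by case: ifP => // _; rewrite (linearT0 (cK k i).1.1) (linearT0 (cI k).1.1).
- by apply: pos_sum => j _; exact: (cp_pos (cJ j).1 (dF j).1).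
- move=> u; rewrite bop_sum ip_suml re_sum.
  have := rlim_sum (index_iota 0 N) (fun j => clim_re (weakstar_clim (hS j (F j)) u u)).
  move=> h r /h[n0 hn0]; exists n0 => n /hn0.
  have -> : \sum_(0 <= m < n) IK m (G m) =
      \sum_(0 <= j < N) \sum_(0 <= m < n | m \in S j) IK m (F j).
    transitivity (\sum_(0 <= m < n) \sum_(0 <= j < N | m \in S j) IK m (F j)).
      by apply: eq_bigr => m _; rewrite /G (linearT_sum (linIK m)).
    exact: exchange_big_dep.
  by rewrite bop_sum ip_suml re_sum.
Qed.

Lemma LOCC_dominated T F : LOCC A T -> dominated A psi F -> dominated A psi (T F).
Proof.
move=> [[[cT nT] T1] [n [I [ow0 lk tot]]]] dF.
have h l : (l <= n)%N -> preserves_dominated (I l) /\ forall k, normal_cp (I l k).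
  elim: l => [_|l IH ln].
    split; first exact: one_way_preserves.
    by have [[[h _] _]|[[h _] _]] := ow0.
  have [pl cl] := IH (ltnW ln); split; first exact: linked_preserves pl cl (lk l ln).
  by have [[h _] _] := lk l ln.
have [pn cn] := h n (leqnn n).
apply: (@dominated_lim (fun N => \sum_(0 <= k < N) I n k F)).
- by move=> N; exact: pn.
- exact: (cp_pos cT dF.1).
- move=> u r r0; have [N hN] := total_rlim F u u tot r0; exists N => m /hN.
  by rewrite bop_sum ip_suml re_sum.
Qed.

End Monotone.

(** * The converse *)

Section Converse.
Context (R : realType) (H : hilbertType R).
Implicit Types (u v w xi : H) (x y z F : bop H).
Local Notation re := (@complex.Re R).
Local Notation "'[ u , v ]" := (inner H u v).

Lemma norm1_sq u : `|u| = 1 <-> sq u = 1.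
Proof.
have h : `|u| ^+ 2 = (sq u)%:C by rewrite -inner_norm ip_sq.
split=> [e|e]; first by move: h; rewrite e expr1n => /complexI.
by rewrite normE /nr e sqrtr1.
Qed.

Lemma trace_tracial (A : set (bop H)) psi : von_neumann_algebra A -> trace_vector A psi ->
  tracial_vector A psi.
Proof.
move=> vnA [/norm1_sq p1 [tau [[_ _ _ tr] _ tauE]]]; split=> // a b Aa Ab.
have := tr a b Aa Ab; rewrite -!tauE /vector_functional ?bopM //; exact: vnM.
Qed.

(** The derivative vanishes at an interior minimum: absorb the cubic term into the quadratic one,
    divide by [t], and let [t] tend to 0 from either side. *)
Lemma cubic_eq0 (a b c d : R) : 0 < d ->
  (forall t, `|t| <= d -> 0 <= t * a + t ^+ 2 * b + t ^+ 3 * c) -> a = 0.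
Proof.
move=> d0 h; pose K := `|b| + d * `|c|.
have K0 : 0 <= K by rewrite addr_ge0 ?mulr_ge0 // ltW.
have key t : `|t| <= d -> 0 <= t * a + t ^+ 2 * K.
  move=> td; apply: le_trans (h t td) _; rewrite -addrA lerD2l.
  have -> : t ^+ 2 * b + t ^+ 3 * c = t ^+ 2 * (b + t * c) by ring.
  rewrite ler_wpM2l ?sqr_ge0//; apply: lerD; first exact: ler_norm.
  by apply: le_trans (ler_norm _) _; rewrite normrM ler_wpM2r.
have small (s : R) : (forall t, 0 < t -> t <= d -> 0 <= t * s + t ^+ 2 * K) -> 0 <= s.
  move=> hs; apply: small_le => e e0.
  pose t := Num.min d (e / (K + 1)).
  have K1 : 0 < K + 1 by lra.
  have t0 : 0 < t by rewrite lt_min d0 divr_gt0.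
  have := hs t t0 ltac:(by rewrite ge_min lexx).
  rewrite expr2 -mulrA -mulrDr pmulr_rge0// => h1; apply: le_trans h1 _; rewrite lerD2l.
  have : t <= e / (K + 1) by rewrite ge_min lexx orbT.
  by rewrite ler_pdivlMr//; lra.
apply/eqP; rewrite eq_le; apply/andP; split.
  rewrite -oppr_ge0; apply: small => t t0 td.
  by have := key (- t); rewrite normrN sqrrN gtr0_norm// mulNr mulrN => /(_ td).
by apply: small => t t0 td; apply: key; rewrite gtr0_norm.
Qed.

Lemma functional_norm_ge (w : bop H -> R[i]) x (r : R) :
  (forall u, nr (x u) <= nr u) -> (functional_norm w < r%:E)%E -> re (w x) < r.
Proof.
move=> xc hw; rewrite -lte_fin; apply: le_lt_trans hw.
apply: (@le_trans _ _ (complex.Re `|w x|)%:E).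
  by rewrite lee_fin normc2E /=; apply: le_trans (ler_norm _) (re_le_sqrt _).
by apply: ereal_sup_ubound; exists x => //= u; rewrite !normE lecR.
Qed.

(** Testing the norm at minus the projection [P] onto [psi0] turns closeness into the lower bound
    [(T(P) psi, psi) > 1 - e], while domination of [T(P)] bounds the same number from above. *)
Lemma convertible_ineq (A : set (bop H)) psi0 psi : separable H ->
  von_neumann_algebra A -> tracial_vector A psi0 -> sq psi = 1 ->
  approx_convertible A psi psi0 ->
  forall x y, inverse_pair A x y -> 1 <= re '[y psi0, psi0] * re '[x psi, psi].
Proof.
move=> sepH vnA trA p1 conv x y xy; apply: small_le => e e0.
have [T LT hT] := conv e e0.
have p01 := trA.1.
have np0 : nr psi0 = 1 by rewrite /nr p01 sqrtr1.
have r1 u : nr (- rank1 psi0 psi0 u) <= nr u.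
  rewrite nrN rank1E nrZ np0 mulr1.
  by apply: le_trans (normc2_ip_le _ _) _; rewrite np0 mulr1.
have := functional_norm_ge (x := - rank1 psi0 psi0) r1 hT.
rewrite /predual_map /vector_functional /=.
have [lin _] := LT.1.1.1.
rewrite (linearTN lin) !bopN !ipNl opprK reD reN ip_rank1 ip_sq p01 mul1r /= => h.
have := (LOCC_dominated sepH vnA trA LT (dominated_rank1 A psi0)).2 x y xy psi.
by lra.
Qed.

Lemma convertible_trace (A : set (bop H)) psi0 psi : separable H ->
  von_neumann_algebra A -> tracial_vector A psi0 -> sq psi = 1 ->
  approx_convertible A psi psi0 ->
  forall a, A a -> '[a psi, psi] = '[a psi0, psi0].
Proof.
move=> sepH vnA trA p1 conv.
have main := convertible_ineq sepH vnA trA p1 conv.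
have p01 := trA.1.
have sa (h : bop H) : A h -> adj h = h -> re '[h psi, psi] = re '[h psi0, psi0].
  move=> Ah hsa; have [C C0 hC] := bop_bounded h.
  set om := re '[h psi, psi]; set tau := re '[h psi0, psi0].
  pose c := sq (h psi0).
  suff : om - tau = 0 by lra.
  (* Within this radius [s = 1 + 2 t h] is positive. *)
  have d0 : 0 < (2 * C)^-1 by rewrite invr_gt0 mulr_gt0.
  apply: (@cubic_eq0 _ (2 * c - tau * om) (2 * c * om) _ d0) => t td.
  have him u : '[h u, u] = (re '[h u, u])%:C.
    have e : '[h u, u] = Num.conj '[h u, u] by rewrite -{1}hsa adjl -ipC.
    case: '[h u, u] e => p q [] /= e; congr Complex; lra.
  pose s := (2 * t)%:C *: h + bop1 H.
  have tC : `|2 * t| * C <= 1.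
    rewrite normrM (ger0_norm (x := 2))//.
    have : `|t| * (2 * C) <= 1 by rewrite -ler_pdivlMr ?mulr_gt0// div1r.
    by lra.
  have sp : pos s.
    move=> u; rewrite bopD bopZ bop1E ipDl ipZl him ip_sq -rmorphM -rmorphD lecR.
    have : `|(2 * t) * re '[h u, u]| <= sq u.
      rewrite normrM -nr_sqr -[X in _ <= X]mul1r.
      apply: le_trans (ler_wpM2r (sqr_ge0 _) tC); rewrite -mulrA ler_wpM2l//.
      by apply: le_trans (re_ip_le _ _) _; rewrite expr2 mulrA ler_wpM2r ?nr_ge0.
    by rewrite ler_norml => /andP[]; lra.
  have [g [gs1 gs2 gp gb]] := inverse1p sp.
  have As : A s by apply: vnD => //; [exact: vnZ | exact: vn1].
  have Ag : A g.
    apply: (vn_inv vnA (x := bop1 H + s)) => [|u|u]; rewrite ?bopD ?bop1E//.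
    by apply: vnD => //; exact: vn1.
  (* [x = 1 + t h] is half of [1 + s], so its inverse is twice the resolvent of [s] and has norm at
     most 2. *)
  pose x := (2^-1)%:C *: (bop1 H + s); pose y := 2%:C *: g.
  have c2 : 2%:C * (2^-1)%:C = 1 :> R[i] by rewrite -rmorphM /= divff.
  have xE u : x u = u + t%:C *: h u.
    rewrite /x bopZ bopD bop1E /s bopD bopZ bop1E [_ + u]addrC addrA scalerDr.
    rewrite scalerA -rmorphM /= mulrA mulVf// mul1r; congr (_ + _).
    rewrite -[X in X + _]scale1r -[X in _ + X]scale1r -scalerDl scalerA.
    have -> : (2^-1)%:C * (1 + 1) = 1 :> R[i] by rewrite -[RHS]c2 mulrC rmorphD.
    by rewrite scale1r.
  have xy : forall u, x (y u) = u.
    by move=> u; rewrite /x /y !bopZ !bopuZ scalerA mulrC c2 scale1r bopD bop1E gs1.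
  have yx : forall u, y (x u) = u.
    by move=> u; rewrite /x /y !bopZ !bopuZ scalerA c2 scale1r bopD bop1E gs2.
  have pair : inverse_pair A x y.
    split=> //; [|exact: vnZ| |exact: posZ].
    - by apply: vnZ => //; apply: vnD => //; exact: vn1.
    - by apply: posZ; rewrite ?invr_ge0//; apply: posD => //; exact: pos_bop1.
  have yc : re '[y (h psi0), h psi0] <= 2 * c.
    rewrite /y bopZ ipZl reZ ler_wpM2l// /c -nr_sqr.
    apply: le_trans (ler_norm _) _; apply: le_trans (re_ip_le _ _) _.
    by rewrite expr2 ler_wpM2r ?nr_ge0.
  clearbody x y; have := main x y pair.
  have -> : re '[x psi, psi] = 1 + t * om.
    by rewrite xE ipDl ipZl reD reZ -/(sq psi) p1.
  (* The exact resolvent expansion to second order, [y = 1 - t h + t^2 h y h]. *)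
  have yE u : y u = u - t%:C *: h u + (t ^+ 2)%:C *: h (y (h u)).
    have e1 v : y v = v - t%:C *: h (y v).
      by apply/eqP; rewrite -subr_eq opprK -[X in _ == X](xy v) xE.
    have e2 v : y v = v - t%:C *: y (h v).
      by apply/eqP; rewrite -subr_eq opprK -bopuZ -bopuD -xE yx.
    rewrite {1}e1 {1}e2 bopuB bopuZ scalerBr opprB scalerA -rmorphM /= -expr2.
    by rewrite [X in u + X]addrC addrA.
  have -> : re '[y psi0, psi0] = 1 - t * tau + t ^+ 2 * re '[y (h psi0), h psi0].
    rewrite yE ipDl ipBl !ipZl reD reB !reZ -/(sq psi0) p01.
    have -> // : '[h (y (h psi0)), psi0] = '[y (h psi0), h psi0].
    by rewrite -{1}hsa adjl.
  have om1 : 0 <= 1 + t * om.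
    have [_ _ xp _ _] := pair; have := (pos_re psi xp).2.
    by rewrite xE ipDl ipZl reD reZ -/(sq psi) p1.
  (* Replacing [q] by its bound [2 * c] makes the inequality cubic in [t], with linear coefficient
     [om - tau]. *)
  have := ler_wpM2r om1 (ler_wpM2l (sqr_ge0 t) yc).
  move: (re '[y (h psi0), h psi0]) => q h1 h2.
  have e : (1 - t * tau + t ^+ 2 * q) * (1 + t * om) = (1 - t * tau) * (1 + t * om) +
    t ^+ 2 * q * (1 + t * om) by ring.
  rewrite e in h2; have := le_trans h2 (lerD (lexx _) h1); rewrite -subr_ge0.
  by congr (0 <= _); ring.
have rea (a : bop H) : A a -> re '[a psi, psi] = re '[a psi0, psi0].
  move=> Aa; have := sa (a + adj a) ltac:(by apply: vnD => //; exact: vn_adj).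
  rewrite adjD adjK addrC => /(_ erefl); rewrite !bopD !ipDl !reD !adjl.
  by rewrite !(re_ipC _ (a _)); lra.
(* The imaginary part at [a] is the real part at [- 'i *: a]. *)
move=> a Aa; apply/eqP; rewrite eq_complex rea// eqxx /=; apply/eqP.
have := rea (- 'i *: a) ltac:(exact: vnZ).
rewrite !bopZ !ipZl; case: '[a psi, psi] => p q; case: '[a psi0, psi0] => p' q' /=; lra.
Qed.

Lemma convertible_trace_vector (A : set (bop H)) psi0 psi : separable H ->
  von_neumann_algebra A -> trace_vector A psi0 -> `|psi| = 1 ->
  approx_convertible A psi psi0 -> trace_vector A psi.
Proof.
move=> sepH vnA tv p1 conv; have trA := trace_tracial vnA tv.
have eqA := convertible_trace sepH vnA trA ((norm1_sq psi).1 p1) conv.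
have [_ [tau [h1 h2 h3]]] := tv; split=> //; exists tau; split=> // a Aa.
by rewrite -h3// /vector_functional eqA.
Qed.

End Converse.

(** * Averaging over the unitaries of a factor *)

Section Averaging.
Context (R : realType) (H : hilbertType R).
Implicit Types (u v w xi : H) (x y z h : bop H).
Local Notation re := (@complex.Re R).
Local Notation "'[ u , v ]" := (inner H u v).

Lemma projection_commutes (S : set H) (P x : bop H) : vsubspace S ->
  (forall u, vclosure S (P u)) -> (forall u, vorth S (u - P u)) ->
  (forall u, S u -> S (x u)) -> (forall u, S u -> S (adj x u)) ->
  forall u, x (P u) = P (x u).
Proof.
move=> hS Pc Po Sx Sx' u; apply/eqP; rewrite -subr_eq0; apply/eqP/sq_eq0.
have c1 : vclosure S (x (P u) - P (x u)).
  rewrite addrC -scaleN1r; apply: vclosureP => // e e0.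
  have [C C0 xC] := bop_bounded x.
  have [s Ss us] := Pc u _ (divr_gt0 e0 C0); exists (x s); first exact: Sx.
  by rewrite -bopuB; apply: le_lt_trans (xC _) _; rewrite mulrC -ltr_pdivlMr.
have o1 : vorth S (x (P u) - P (x u)).
  move=> s Ss; have -> : x (P u) - P (x u) = (x u - P (x u)) - x (u - P u).
    by rewrite bopuB opprB [RHS]addrC subrKA.
  by rewrite ipBl (Po _ _ Ss) -adjr (Po _ _ (Sx' _ Ss)) subrr.
by rewrite /sq (vorth_closure o1 c1).
Qed.

Lemma vclosure_bound (S : set H) u (r : R) : vclosure S u ->
  (forall s, S s -> Num.sqrt (normc2 '[u, s]) <= r * nr s) -> 0 <= r -> nr u <= r.
Proof.
move=> cu hu r0; have [->|u0] := eqVneq (nr u) 0; first by [].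
have {}u0 : 0 < nr u by rewrite lt_def u0 nr_ge0.
apply: small_le => e e0.
have k0 : 0 < r / nr u + 1 by rewrite ltr_wpDl// divr_ge0// ltW.
have [s Ss us] := cu _ (divr_gt0 e0 k0).
rewrite -(ler_pM2r u0) -expr2 nr_sqr.
have -> : sq u = re '[u, s] + re '[u, u - s] by rewrite ipBr reB addrC subrK.
have h1 := le_trans (le_trans (ler_norm _) (re_le_sqrt _)) (hu s Ss).
have h2 := le_trans (ler_norm _) (re_ip_le u (u - s)).
have h3 : nr s <= nr u + nr (u - s) by have := nr_dist s u 0; rewrite !subr0 (nrBC s) addrC.
have h4 : nr (u - s) * (r + nr u) <= e * nr u.
  have : nr (u - s) * (r / nr u + 1) <= e by rewrite -ler_pdivlMr// ltW.
  move=> /(ler_wpM2r (ltW u0)); congr (_ <= _).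
  by rewrite -mulrA mulrDl mul1r divfK ?gt_eqF.
have := ler_wpM2l r0 h3; lra.
Qed.

Lemma bop_closure_eq (S : set H) (x y : bop H) : (forall u, S u -> x u = y u) ->
  forall u, vclosure S u -> x u = y u.
Proof.
move=> h u cu; apply/eqP; rewrite -subr_eq0 -bopB; apply/eqP/nr_small => e e0.
have [C C0 xC] := bop_bounded (x - y).
have [s Ss us] := cu _ (divr_gt0 e0 C0).
have -> : (x - y) u = (x - y) (u - s) by rewrite [RHS]bopuB [(x - y) s]bopB h// subrr subr0.
by apply: le_lt_trans (xC _) _; rewrite mulrC -ltr_pdivlMr.
Qed.

Variables (A : set (bop H)) (psi : H).
Hypotheses (vnA : von_neumann_algebra A) (trA : tracial_vector A psi).
Hypothesis facA : A `&` commutant A = [set c *: bop1 H | c in [set: R[i]]].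

Lemma factor_scalar x : A x -> commutant A x -> exists c, x = c *: bop1 H.
Proof.
move=> Ax Cx; have : (A `&` commutant A) x by [].
by rewrite facA => -[c _ <-]; exists c.
Qed.

Let vnB' := comm_vn vnA.

(** Cyclicity of the trace: the 2-norms of [a b] and of its adjoint agree. *)
Lemma trace_swap_sq a b : A a -> A b -> sq (a (b psi)) = sq (adj b (adj a psi)).
Proof.
move=> Aa Ab; have Aa' := vn_adj vnA Aa; have Ab' := vn_adj vnA Ab.
rewrite /sq.
have := trA.2 (bop_mul (adj b) (adj a)) (bop_mul a b) (vnM vnA Ab' Aa') (vnM vnA Aa Ab).
by rewrite !bopM !adjl => ->; exact: re_ipC.
Qed.

Lemma trace_adj_sq a : A a -> sq (a psi) = sq (adj a psi).
Proof. by move=> Aa; have := trace_swap_sq Aa (vn1 vnA); rewrite adj_bop1 !bop1E. Qed.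

(** The projection onto the closure of [K] lies in [A] and in its commutant, so it is scalar by
    factoriality; it kills [psi], so it is 0. *)
Lemma orth_invariant0 (K : set H) : vsubspace K ->
  (forall x u, A x -> K u -> K (x u)) -> (forall x u, commutant A x -> K u -> K (x u)) ->
  vorth K psi -> forall u, K u -> u = 0.
Proof.
move=> hK KA KB opsi u Ku; have [P [Pc Po PS PO Psa]] := projection_op hK.
have AP : A P.
  apply/(vnP vnA) => y Cy w; apply: (projection_commutes hK Pc Po) => v; first exact: KB.
  by apply: KB; exact: (vn_adj vnB').
have CP : commutant A P.
  apply/commutantP => y Ay w; apply: (projection_commutes hK Pc Po) => v; first exact: KA.
  by apply: KA; exact: vn_adj.
have [c Pc1] := factor_scalar AP CP.
have := PO _ opsi; rewrite Pc1 bopZ bop1E => h.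
have c0 : c = 0.
  have /(congr1 (@sq _ _)) := h; rewrite sqZ trA.1 mulr1 sq0 => c0.
  by apply/eqP; rewrite -normr_eq0 normc2E c0 sqrtr0.
by rewrite -(PS _ Ku) Pc1 c0 scale0r.
Qed.

(** By the trace property [nr (x (a psi)) = nr (adj a (adj x psi)) = 0], so [x] kills all [a psi],
    hence all [b (a psi)] with [b] in the commutant. Factoriality makes the span of the latter
    dense. *)
Lemma separating x : A x -> x psi = 0 -> x = 0.
Proof.
move=> Ax xp.
have x'p : adj x psi = 0 by apply: sq_eq0; rewrite -(trace_adj_sq Ax) xp sq0.
have xap a : A a -> x (a psi) = 0.
  by move=> Aa; apply: sq_eq0; rewrite trace_swap_sq// x'p bopu0 sq0.
pose K : set H := [set u | forall a b, A a -> commutant A b -> '[u, b (a psi)] = 0].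
have hK : vsubspace K.
  split=> [a b _ _|c u v hu hv a b Aa Cb]; first by rewrite ip0l.
  by rewrite ipDl ipZl hu// hv// mulr0 addr0.
have K0 : forall u, K u -> u = 0.
  apply: (orth_invariant0 hK).
  - move=> z u Az Ku a b Aa Cb; rewrite -adjr.
    rewrite ((commutantP _ _).1 Cb _ (vn_adj vnA Az)) -(bopM (adj z)); apply: Ku => //.
    by apply: vnM => //; exact: vn_adj.
  - move=> z u Cz Ku a b Aa Cb; rewrite -adjr -(bopM (adj z)); apply: Ku => //.
    by apply: (vnM vnB') => //; apply: (vn_adj vnB').
  - move=> s Ks; rewrite ipC.
    by have := Ks _ _ (vn1 vnA) (vn1 vnB'); rewrite !bop1E => ->; rewrite rmorph0.
have x0 u : adj x u = 0.
  apply: K0 => a b Aa Cb.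
  by rewrite adjl ((commutantP _ _).1 Cb _ Ax) xap// bopu0 ip0r.
by rewrite -[x]adjK; apply: bopP => u; apply: ip_inj => v; rewrite adjl x0 ip0r bop0 ip0l.
Qed.

(** The projection onto the orthogonal complement of the vectors [b psi] lies in [A] and kills the
    separating vector [psi]. *)
Lemma commutant_cyclic u : (forall b, commutant A b -> '[u, b psi] = 0) -> u = 0.
Proof.
move=> hu; pose K : set H := [set v | forall b, commutant A b -> '[v, b psi] = 0].
have hK : vsubspace K.
  split=> [b _|c v w hv hw b Cb]; first by rewrite ip0l.
  by rewrite ipDl ipZl hv// hw// mulr0 addr0.
have [P [Pc Po PS PO Psa]] := projection_op hK.
have AP : A P.
  have inv y v : commutant A y -> K v -> K (y v).
    move=> Cy Kv b Cb; rewrite -adjr -(bopM (adj y)); apply: Kv.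
    by apply: (vnM vnB') => //; apply: (vn_adj vnB').
  apply/(vnP vnA) => y Cy w; apply: (projection_commutes hK Pc Po) => v; first exact: inv.
  by apply: inv; exact: (vn_adj vnB').
have P0 : P = 0.
  apply: separating => //; apply: PO => s Ks.
  by rewrite ipC; have := Ks _ (vn1 vnB'); rewrite bop1E => ->; rewrite rmorph0.
by rewrite -(PS u hu) P0.
Qed.

Lemma commutant_dense u (r : R) : 0 < r -> exists2 b, commutant A b & nr (b psi - u) < r.
Proof.
move=> r0; pose S : set H := [set v | exists2 b, commutant A b & v = b psi].
have hS : vsubspace S.
  split; first by exists 0; [exact: (vn0 vnB')|].
  move=> c _ _ [b Cb ->] [d Cd ->]; exists (c *: b + d) => //.
  by apply: (vnD vnB') => //; exact: (vnZ vnB').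
have [p [cp op]] := proj_exists u hS.
have up : u - p = 0 by apply: commutant_cyclic => b Cb; apply: op; exists b.
have {}up : u = p by apply/eqP; rewrite -subr_eq0 up.
have [_ [b Cb ->] h] := cp _ r0; exists b => //.
by rewrite nrBC up.
Qed.

Definition unitary_in (v : bop H) := [/\ A v, forall u, adj v (v u) = u & forall u, v (adj v u) = u].

Lemma unitary_nr (v : bop H) u : unitary_in v -> nr (v u) = nr u.
Proof. by move=> [_ h _]; rewrite /nr /sq -adjl h. Qed.

Lemma unitary_adj (v : bop H) : unitary_in v -> unitary_in (adj v).
Proof. by move=> [Av h1 h2]; split=> [|u|u]; rewrite ?adjK //; exact: vn_adj. Qed.

Lemma unitary_mul (v w : bop H) : unitary_in v -> unitary_in w -> unitary_in (bop_mul v w).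
Proof.
move=> [Av v1 v2] [Aw w1 w2]; split=> [|u|u]; first exact: vnM.
  by rewrite adjM !bopM v1 w1.
by rewrite adjM !bopM w2 v2.
Qed.

Lemma unitary_bop1 : unitary_in (bop1 H).
Proof. by split=> [|u|u]; rewrite ?adj_bop1//; exact: vn1. Qed.

(* Cayley transform: [w = (1 - i h)^-1] and [2 w - 1 = (1 + i h) (1 - i h)^-1] is unitary. *)
Lemma commutes_unitary_sa (s : bop H) h : (forall v : bop H, unitary_in v -> forall u, s (v u) = v (s u)) ->
  A h -> adj h = h -> forall u, s (h u) = h (s u).
Proof.
move=> sv Ah hsa.
have hhp : pos (bop_mul h h).
  by move=> u; rewrite bopM -{1}hsa adjl ip_sq lecR sq_ge0.
have [g [g1 g2 gp _]] := inverse1p hhp.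
have gsa := pos_sa gp.
have Ag : A g.
  apply: (vn_inv vnA (x := bop1 H + bop_mul h h)) => [|u|u]; rewrite ?bopD ?bop1E//.
  by apply: vnD => //; [exact: vn1 | exact: vnM].
have gh u : g (h u) = h (g u).
  have e : h u = h (g u) + bop_mul h h (h (g u)).
    by rewrite -{1}(g1 u) bopuD !bopM.
  by rewrite e g2.
(* [(1 + i h) (1 + h^2)^-1] inverts [1 - i h], so a resolvent of the positive operator [h^2] is
   enough. *)
pose w := bop_mul (bop1 H + 'i *: h) g.
pose q := bop1 H - 'i *: h.
have iin v : 'i *: ('i *: v) = - v :> H by rewrite scalerA -expr2 sqr_i scaleN1r.
have qE u : q u = u - 'i *: h u by [].
have wE u : w u = g u + 'i *: h (g u) by [].
have pq u : q u + 'i *: h (q u) = u + h (h u).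
  by rewrite qE bopuB bopuZ scalerBr iin opprK addrA subrK.
have qp u : q (u + 'i *: h u) = u + h (h u).
  by rewrite qE bopuD bopuZ scalerDr iin opprB [_ - 'i *: _]addrC addrA addrK.
have gq u : g (q u) = q (g u) by rewrite !qE bopuB bopuZ gh.
have Aw : A w.
  by apply: vnM => //; apply: vnD => //; [exact: vn1 | exact: vnZ].
have adjw : adj w = bop_mul g q.
  rewrite /w adjM adjD adj_bopZ adj_bop1 hsa gsa; congr (bop_mul g (_ + _)).
  apply: bopP => u; rewrite bopN !bopZ -scaleNr; congr (_ *: _).
  by apply/eqP; rewrite eq_complex /= oppr0 !eqxx.
clearbody q w.
have wq u : w (q u) = u by rewrite wE gq pq; exact: g1.
have qw u : q (w u) = u by rewrite wE qp; exact: g1.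
pose v := 2%:C *: w - bop1 H.
have ww u : adj w (w u) = g u by rewrite adjw bopM qw.
have wsum u : adj w u + w u = 2%:C *: g u.
  rewrite adjw bopM gq qE wE addrACA addNr addr0 -[X in X + _]scale1r -[X in _ + X]scale1r.
  by rewrite -scalerDl; congr (_ *: _); rewrite -[RHS]/((1 + 1)%:C) rmorphD.
have ww' u : w (adj w u) = g u by rewrite adjw bopM gq wq.
have Uv : unitary_in v.
  have adjv : adj v = 2%:C *: adj w - bop1 H.
    rewrite /v adjD adjN adj_bopZ adj_bop1; congr (_ *: _ - _).
    exact: conjc_real.
  have vE u : v u = 2%:C *: w u - u by [].
  have vE' u : adj v u = 2%:C *: adj w u - u by rewrite adjv.
  split; first by apply: vnB => //; [exact: vnZ | exact: vn1].
    move=> u; rewrite vE' vE bopuB bopuZ ww -wsum scalerBr scalerDr opprB.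
    by rewrite [_ + 2%:C *: w u]addrC addrK addrC subrK.
  move=> u; rewrite vE vE' bopuB bopuZ ww' -wsum scalerBr scalerDr opprB.
  by rewrite addrK addrC subrK.
have sw u : s (w u) = w (s u).
  have := sv v Uv u; rewrite /v !bopB !bopZ !bop1E bopuB bopuZ => /addIr.
  move=> /(congr1 (fun t => (2^-1)%:C *: t)); rewrite !scalerA -rmorphM /=.
  by rewrite mulVf// rmorph1 !scale1r.
have sq' u : s (q u) = q (s u) by rewrite -[LHS]qw -sw wq.
move=> u; have := sq' u; rewrite !qE bopuB bopuZ => /addrI/oppr_inj.
by move=> /(congr1 (fun t => 'i *: t)); rewrite !iin => /oppr_inj.
Qed.

Lemma commutes_unitary (s : bop H) : (forall v : bop H, unitary_in v -> forall u, s (v u) = v (s u)) ->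
  commutant A s.
Proof.
move=> sv; apply/commutantP => a Aa u; have Aa' := vn_adj vnA Aa.
have sa h : A h -> adj h = h -> forall u, s (h u) = h (s u) by exact: commutes_unitary_sa.
have h1 := sa (a + adj a) (vnD vnA Aa Aa') _ u.
have h2 := sa ('i *: (a - adj a)) (vnZ vnA _ (vnB vnA Aa Aa')) _ u.
have {}h1 : s (a u) + s (adj a u) = a (s u) + adj a (s u).
  by rewrite -bopuD; apply: h1; rewrite adjD adjK addrC.
have {}h2 : s (a u) - s (adj a u) = a (s u) - adj a (s u).
  have /h2 : adj ('i *: (a - adj a)) = 'i *: (a - adj a).
    rewrite adj_bopZ adjD adjN adjK -[in RHS]opprB scalerN -scaleNr addrC; congr (_ *: _).
    by apply/eqP; rewrite eq_complex /= oppr0 !eqxx.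
  rewrite !bopZ bopuZ => /(congr1 (fun t => (- 'i) *: t)); rewrite !scalerA mulNr -expr2 sqr_i opprK.
  by rewrite !scale1r !bopB bopuB.
have e (p q : H) : (p + q) + (p - q) = 2%:C *: p.
  by rewrite addrACA subrr addr0 -{1 2}[p]scale1r -scalerDl; congr (_ *: _); rewrite -[RHS]/((1 + 1)%:C) rmorphD.
have := e (s (a u)) (s (adj a u)); rewrite h1 h2 e => /(congr1 (fun t => (2^-1)%:C *: t)).
by rewrite !scalerA -rmorphM /= mulVf// rmorph1 !scale1r.
Qed.

Definition admissible (l : seq (R * bop H)) :=
  (forall p, p \in l -> 0 <= p.1 /\ unitary_in p.2) /\ \sum_(p <- l) p.1 = 1.

Definition average (l : seq (R * bop H)) x : bop H := \sum_(p <- l) p.1%:C *: cj p.2 x.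

Lemma averageE l x u : average l x u = \sum_(p <- l) p.1%:C *: adj p.2 (x (p.2 u)).
Proof. by rewrite /average bop_sum; apply: eq_bigr => p _; rewrite bopZ /cj !bopM. Qed.

Lemma average_in l x : admissible l -> A x -> A (average l x).
Proof.
move=> [hl _] Ax; rewrite /average big_seq; apply: vn_sum => // p /hl[_ [Ap _ _]].
by apply: vnZ => //; do 2?apply: vnM => //; exact: vn_adj.
Qed.

Lemma average_bounded l x (C : R) : admissible l -> (forall u, nr (x u) <= C * nr u) ->
  forall u, nr (average l x u) <= C * nr u.
Proof.
move=> [hl l1] xC u; rewrite averageE; apply: le_trans (nr_sum _ _ _) _.
rewrite -[X in _ <= X]mul1r -l1 mulr_suml big_seq [X in _ <= X]big_seq.
apply: ler_sum => p /hl[p0 Up]; rewrite nrZr// ler_wpM2l// (unitary_nr _ (unitary_adj Up)).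
by apply: le_trans (xC _) _; rewrite unitary_nr.
Qed.

Lemma trace_unitary (v : bop H) x : unitary_in v -> A x -> '[adj v (x (v psi)), psi] = '[x psi, psi].
Proof.
move=> [Av v1 v2] Ax.
have := trA.2 (adj v) (bop_mul x v) (vn_adj vnA Av) (vnM vnA Ax Av).
by rewrite !bopM => ->; rewrite v2.
Qed.

Lemma average_trace l x : admissible l -> A x -> '[average l x psi, psi] = '[x psi, psi].
Proof.
move=> [hl l1] Ax; rewrite averageE ip_suml.
transitivity (\sum_(p <- l) p.1%:C * '[x psi, psi]).
  by rewrite big_seq [RHS]big_seq; apply: eq_bigr => p /hl[_ Up]; rewrite ipZl trace_unitary.
by rewrite -mulr_suml -rmorph_sum l1 mul1r.
Qed.

Lemma averageD l x y : average l (x + y) = average l x + average l y.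
Proof.
apply: bopP => u; rewrite bopD !averageE -big_split; apply: eq_bigr => p _.
by rewrite bopD bopuD scalerDr.
Qed.

Lemma average_scalar l c : admissible l -> average l (c *: bop1 H) = c *: bop1 H.
Proof.
move=> [hl l1]; apply: bopP => u; rewrite averageE bopZ bop1E.
transitivity (\sum_(p <- l) p.1%:C *: (c *: u)).
  rewrite big_seq [RHS]big_seq; apply: eq_bigr => p /hl[_ [_ h _]].
  by rewrite bopZ bop1E bopuZ h.
by rewrite -scaler_suml -rmorph_sum l1 scale1r.
Qed.

(* The minimal vector in the closure of the averages of [y] applied to [psi] is [s psi], with
   [s] in [A] commuting with all unitaries of [A], hence scalar. *)
Lemma averaging0 y (e : R) : A y -> '[y psi, psi] = 0 -> 0 < e ->
  exists l, admissible l /\ nr (average l y psi) < e.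
Proof.
move=> Ay y0 e0.
pose K : set H := [set k | exists l, admissible l /\ k = average l y psi].
have K0 : K (average [:: (1, bop1 H)] y psi).
  exists [:: (1, bop1 H)]; split=> //; split; last by rewrite big_seq1.
  by move=> p; rewrite inE => /eqP ->; split=> //; exact: unitary_bop1.
have [|f [eta [fK feta hK]]] := min_norm K0.
  move=> _ _ [l [hl ->]] [m [hm ->]].
  (* The midpoint of two averages is the average over the concatenated lists with halved weights. *)
  pose half (p : R * bop H) := (2^-1 * p.1, p.2).
  exists (map half l ++ map half m); split; last first.
    rewrite !averageE big_cat !big_map /= scalerDr !scaler_sumr.
    by congr (_ + _); apply: eq_bigr => p _; rewrite scalerA -rmorphM.
  split=> [p|].
    by rewrite mem_cat => /orP[]/mapP[p' p'l ->] /=; [have [h ?] := hl.1 p' p'l|have [h ?] := hm.1 p' p'l];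
      split=> //; rewrite mulr_ge0.
  rewrite big_cat !big_map /= -!mulr_sumr hl.2 hm.2; lra.
have [l lP] := choice fK.
have ladm n : admissible (l n) by case: (lP n).
pose s n := average (l n) y.
have sE n : s n psi = f n by case: (lP n).
have [C C0 yC] := bop_bounded y.
have sb n u : nr (s n u) <= C * nr u by apply: average_bounded.
have As n : A (s n) by exact: average_in.
(* On the dense set of vectors [b psi] with [b] in the commutant, [s n (b psi) = b (f n)] tends to
   [b eta]; the common bound [C] extends convergence to every [u]. *)
have ex u : exists v : H, lim_to (fun n => s n u) v.
  apply: complete_lim => d d0.
  have [b Cb bu] := commutant_dense u (divr_gt0 d0 (mulr_gt0 (ltr0Sn R 3) C0)).
  have [N hN] := lim_to_bop b feta (divr_gt0 d0 (ltr0Sn R 3)).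
  exists N => n m Nn Nm.
  have h k : (N <= k)%N -> nr (s k u - b eta) < d / 2.
    move=> Nk; have := nr_dist (s k u) (s k (b psi)) (b eta).
    have -> : s k (b psi) = b (f k).
      by rewrite -sE ((commutantP _ _).1 Cb _ (As k)).
    have := hN k Nk; have := sb k (u - b psi).
    rewrite bopuB ((commutantP _ _).1 Cb _ (As k)) sE.
    move: bu; rewrite nrBC ltr_pdivlMr ?mulr_gt0//; lra.
  have := nr_dist (s n u) (b eta) (s m u); rewrite (nrBC (b eta)).
  by have := h n Nn; have := h m Nm; lra.
have [S SP] := choice ex.
have Sl : linear S.
  move=> c u v; apply: (lim_to_unique (SP _)) => d d0.
  have k0 : 0 < Num.sqrt (normc2 c) + 1 by rewrite ltr_wpDl ?sqrtr_ge0.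
  have [N hN] := SP u _ (divr_gt0 (divr_gt0 d0 (ltr0Sn R 1)) k0).
  have [M hM] := SP v _ (divr_gt0 d0 (ltr0Sn R 1)).
  exists (N + M)%N => n nNM; have := hN n (leq_trans (leq_addr _ _) nNM).
  have := hM n (leq_trans (leq_addl _ _) nNM) => h1; rewrite ltr_pdivlMr// => h2.
  have -> : s n (c *: u + v) - (c *: S u + S v) = c *: (s n u - S u) + (s n v - S v).
    by rewrite bopuD bopuZ scalerBr opprD addrACA.
  apply: le_lt_trans (nrD _ _) _; rewrite nrZ.
  have := nr_ge0 (s n u - S u); lra.
have Sb u : nr (S u) <= C * nr u.
  apply: small_le => d d0; have [N hN] := SP u d d0.
  have := hN N (leqnn _); have := sb N u; have := nr_dist (S u) (s N u) 0.
  by rewrite !subr0 nrBC; lra.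
have [z zE] := mkbop Sl Sb.
have zlim u : lim_to (fun n => s n u) (z u) by rewrite zE.
have Az : A z.
  apply/(vnP vnA) => b Cb u; apply: (lim_to_unique (lim_to_bop b (zlim u))).
  move=> d /(zlim (b u))[N hN]; exists N => n /hN.
  by rewrite ((commutantP _ _).1 Cb _ (As n)).
have zpsi : z psi = eta.
  apply: (lim_to_unique (zlim psi)) => d /feta[N hN]; exists N => n /hN.
  by rewrite sE.
have zcomm (v : bop H) : unitary_in v -> forall u, z (v u) = v (z u).
  move=> Uv; have [Av v1 v2] := Uv.
  (* Composing the averaging unitaries with [v] stays in [K] and keeps the norm, by the trace
     property. This is thus another minimising sequence, with the same limit [eta]. *)
  have vzv : adj v (z (v psi)) = eta.
    apply: (lim_to_unique (f := fun n => adj v (s n (v psi)))).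
      exact: lim_to_bop (zlim _).
    move=> d d0; have d2 : 0 < d ^+ 2 / 2 by rewrite divr_gt0 ?exprn_gt0.
    have [N hN] := rlim_sq feta d2; exists N => n /hN; rewrite ltr_norml => /andP[_ h].
    have Kn : K (adj v (s n (v psi))).
      pose m (p : R * bop H) := (p.1, bop_mul p.2 v).
      exists (map m (l n)); split; last first.
        rewrite averageE big_map /s averageE bopu_sum; apply: eq_bigr => p _ /=.
        by rewrite bopuZ adjM !bopM.
      split; last by rewrite big_map (ladm n).2.
      by move=> p /mapP[p' /(ladm n).1[h1 h2] ->]; split=> //; exact: unitary_mul.
    have := hK _ Kn.
    have -> : sq (adj v (s n (v psi))) = sq (f n).
      rewrite -!nr_sqr (unitary_nr _ (unitary_adj Uv)) !nr_sqr -sE trace_swap_sq//.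
      by rewrite -nr_sqr (unitary_nr _ (unitary_adj Uv)) nr_sqr -trace_adj_sq.
    move=> h2; rewrite -(ltr_pXn2r (n := 2)) ?nnegrE ?nr_ge0 ?(ltW d0)// nr_sqr; lra.
  (* Agreement at the separating vector [psi] is agreement of operators. *)
  have : bop_mul (adj v) (bop_mul z v) - z = 0.
    apply: separating; last by rewrite bopB !bopM vzv zpsi subrr.
    by apply: vnB => //; apply: vnM => //; [exact: vn_adj | exact: vnM].
  move=> /eqP; rewrite subr_eq0 => /eqP zE' u.
  by rewrite -[in RHS]zE' !bopM v2.
have [c zc] := factor_scalar Az (commutes_unitary zcomm).
(* [eta] is [c *: psi], and averages keep the trace, which is 0 at [y]. *)
have eta0 : eta = 0.
  have : '[eta, psi] = 0.
    have h : forall n, '[f n, psi] = 0 by move=> n; rewrite -sE average_trace.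
    apply/eqP; rewrite -normr_eq0 normc2E.
    suff -> : Num.sqrt (normc2 '[eta, psi]) = 0 by [].
    apply/eqP; rewrite eq_le sqrtr_ge0 andbT; apply: small_le => d d0.
    have [N hN] := feta d d0; have := hN N (leqnn _).
    have -> : '[eta, psi] = '[eta - f N, psi] by rewrite ipBl h subr0.
    have := normc2_ip_le (eta - f N) psi; rewrite {2}/nr trA.1 sqrtr1 mulr1 nrBC.
    lra.
  rewrite -zpsi zc bopZ bop1E ipZl ip_sq trA.1 mulr1 => ->.
  by rewrite scale0r.
have [N hN] := feta e e0; exists (l N); split=> //.
by have := hN N (leqnn _); rewrite eta0 subr0 -sE.
Qed.

Lemma averaging y (e : R) : A y -> 0 < e ->
  exists l, admissible l /\ nr (average l y psi - '[y psi, psi] *: psi) < e.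
Proof.
move=> Ay e0; pose y0 := y - '[y psi, psi] *: bop1 H.
have [||l [al hl]] := @averaging0 y0 e _ _ e0.
- by apply: vnB => //; apply: vnZ => //; exact: vn1.
- by rewrite /y0 bopB bopZ bop1E ipBl ipZl ip_sq trA.1 mulr1 subrr.
exists l; split=> //; move: hl; rewrite /y0 averageD -scaleNr average_scalar//.
by rewrite bopD bopZ bop1E scaleNr.
Qed.

End Averaging.

(** * The conversion protocol *)

Section Protocol.
Context (R : realType) (H : hilbertType R).
Implicit Types (u v w xi : H) (x y z h : bop H).
Local Notation re := (@complex.Re R).
Local Notation "'[ u , v ]" := (inner H u v).

Lemma clim_unique (f : nat -> R[i]) (a b : R[i]) : clim f a -> clim f b -> a = b.
Proof.
move=> ha hb; apply/eqP; rewrite -subr_eq0 -normr_eq0 normc2E.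
suff -> : Num.sqrt (normc2 (a - b)) = 0 by [].
apply/eqP; rewrite eq_le sqrtr_ge0 andbT; apply: small_le => e e0.
have [N hN] := ha _ (divr_gt0 e0 (ltr0Sn R 1)); have [M hM] := hb _ (divr_gt0 e0 (ltr0Sn R 1)).
have := hN _ (leq_addr M N); have := hM _ (leq_addl N M).
have -> : a - b = - (f (N + M)%N - a) + (f (N + M)%N - b) by rewrite opprB subrKA.
by have := ncD (- (f (N + M)%N - a)) (f (N + M)%N - b); rewrite ncN; lra.
Qed.

Lemma climD (f g : nat -> R[i]) (a b : R[i]) : clim f a -> clim g b ->
  clim (fun n => f n + g n) (a + b).
Proof.
move=> ha hb e e0.
have [N hN] := ha _ (divr_gt0 e0 (ltr0Sn R 1)); have [M hM] := hb _ (divr_gt0 e0 (ltr0Sn R 1)).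
exists (N + M)%N => n nNM; rewrite opprD addrACA; apply: le_lt_trans (ncD _ _) _.
have := hN n (leq_trans (leq_addr _ _) nNM); have := hM n (leq_trans (leq_addl _ _) nNM); lra.
Qed.

Lemma normal_functional_linear (w : bop H -> R[i]) : normal_functional w ->
  forall x y, w (x + y) = w x + w y.
Proof.
move=> [xi [eta [_ _ hw]]] x y.
have /climP hx := hw x; have /climP hy := hw y; have /climP hxy := hw (x + y).
apply: clim_unique hxy _; move=> e /(climD hx hy)[N hN]; exists N => n /hN.
rewrite /series /= -big_split; congr (Num.sqrt (normc2 (_ - _)) < _).
by apply: eq_bigr => k _; apply/esym/ipDl.
Qed.

Lemma normal_mapD (S T : bop H -> bop H) : normal_map S -> normal_map T ->
  normal_map (fun x => S x + T x).
Proof.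
move=> nS nT x; have F0 : Filter (nbhs (x : weakstar H)) by typeclasses eauto.
have FF := fmap_filter ((fun x => S x + T x) : weakstar H -> weakstar H) F0.
apply: (weakstar_cvgP (S x + T x) FF).2 => -[w hw] /=.
have wD := normal_functional_linear hw.
rewrite wD.
have hS := (weakstar_cvgP (S x) (fmap_filter (S : weakstar H -> weakstar H) F0)).1 (nS x) (exist _ _ hw).
have hT := (weakstar_cvgP (T x) (fmap_filter (T : weakstar H -> weakstar H) F0)).1 (nT x) (exist _ _ hw).
have := @cvgD _ R[i]^o _ _ F0 (fun y : weakstar H => w (S y)) (fun y : weakstar H => w (T y))
  _ _ hS hT.
have hE : (fun y : weakstar H => w (S y + T y) : R[i]^o) =
    (fun y : weakstar H => w (S y) : R[i]^o) + (fun y : weakstar H => w (T y) : R[i]^o).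
  by apply/funext => y; rewrite wD.
by rewrite -hE.
Qed.

Lemma normal_cpD (S T : bop H -> bop H) : normal_cp S -> normal_cp T ->
  normal_cp (fun x => S x + T x).
Proof.
move=> [[lS pS] nS] [[lT pT] nT]; split; last exact: normal_mapD.
split=> [c x y|n X hX v]; first by rewrite lS lT scalerDr addrACA.
have := addr_ge0 (pS n X hX v) (pT n X hX v); congr (0 <= _).
rewrite -big_split; apply: eq_bigr => i _; rewrite -big_split; apply: eq_bigr => j _.
by rewrite !mxE bopD ipDl.
Qed.

Lemma normal_cp0 : normal_cp (fun _ : bop H => 0 : bop H).
Proof.
have := cj_normal_cp (0 : bop H); rewrite (_ : cj 0 = (fun=> 0))//.
by apply/funext => x; rewrite cj0.
Qed.

Lemma normal_cp_sum (I : nat -> bop H -> bop H) n : (forall k, normal_cp (I k)) ->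
  normal_cp (fun x => \sum_(0 <= k < n) I k x).
Proof.
move=> h; elim: n => [|n IH].
  rewrite (_ : (fun x => _) = (fun=> 0)); first exact: normal_cp0.
  by apply/funext => x; rewrite big_geq.
rewrite (_ : (fun x => _) = (fun x => \sum_(0 <= k < n) I k x + I n x)); first exact: normal_cpD.
by apply/funext => x; rewrite big_nat_recr.
Qed.

Lemma ip_diff_le x xi eta : (forall u, nr (x u) <= nr u) ->
  Num.sqrt (normc2 ('[x xi, xi] - '[x eta, eta])) <= nr (xi - eta) * (nr xi + nr eta).
Proof.
move=> xc.
have -> : '[x xi, xi] - '[x eta, eta] = '[x (xi - eta), xi] + '[x eta, xi - eta].
  by rewrite bopuB ipBl ipBr; ring.
apply: le_trans (ncD _ _) _; rewrite mulrDr; apply: lerD.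
  by apply: le_trans (normc2_ip_le _ _) _; rewrite ler_wpM2r ?nr_ge0.
by apply: le_trans (normc2_ip_le _ _) _; rewrite mulrC ler_wpM2l ?nr_ge0.
Qed.

Lemma functional_norm_le (w : bop H -> R[i]) (r : R) :
  (forall x, (forall u, nr (x u) <= nr u) -> Num.sqrt (normc2 (w x)) <= r) ->
  (functional_norm w <= r%:E)%E.
Proof.
move=> h; apply: ge_ereal_sup => _ [x xc <-]; rewrite lee_fin normc2E; apply: h => u.
by have := xc u; rewrite !normE lecR.
Qed.

Variables (A : set (bop H)) (psi : H).
Hypotheses (vnA : von_neumann_algebra A) (trA : tracial_vector A psi).
Hypothesis facA : A `&` commutant A = [set c *: bop1 H | c in [set: R[i]]].

Let commA := comm_vn vnA.

(** Measure with the [K k] in the commutant, then apply the unitary [V k] of [A] depending on the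
    outcome. In the Heisenberg picture the correction acts first, so each [cj (K k) \o cj (V k)] is
    left local: the outer map is a bimodule map over [A], the inner one is unital. One round
    suffices. *)
Lemma local_instrument_LOCC (K V : nat -> bop H) N :
  (forall k, commutant A (K k)) -> (forall k, unitary_in A (V k)) ->
  (forall k, (N <= k)%N -> K k = 0) ->
  (forall u, \sum_(0 <= k < N) adj (K k) (K k u) = u) ->
  LOCC A (fun x => \sum_(0 <= k < N) cj (K k) (cj (V k) x)).
Proof.
move=> CK UV K0 K1; pose I k := cj (K k) \o cj (V k).
have V1 k : cj (V k) (bop1 H) = bop1 H.
  by apply: bopP => u; have [_ h _] := UV k; rewrite cj1 bopM h bop1E.
have cI k : normal_cp (I k).
  split.
    have [lK pK] := (cj_normal_cp (K k)).1; have [lV pV] := (cj_normal_cp (V k)).1.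
    split=> [c x y|n X hX]; first by rewrite /I /= lV lK.
    have := pK _ _ (pV _ _ hX); congr positive_opmx.
    by apply/matrixP => i j; rewrite !mxE.
  apply: normal_map_pred => w hw.
  exact: (normal_functional_cj (V k) (normal_functional_cj (K k) hw)).
have ucpT : normal_ucp (fun x => \sum_(0 <= k < N) I k x).
  split; first exact: normal_cp_sum.
  apply: bopP => u; rewrite bop_sum bop1E -[RHS]K1; apply: eq_bigr => k _.
  by rewrite -[I k _]/(cj (K k) (cj (V k) (bop1 H))) V1 cj1 bopM.
have tot : total_map I (fun x => \sum_(0 <= k < N) I k x).
  apply: (@sum_over_fin _ _ _ _ N) => [k x Nk|x].
    by rewrite /I /= K0// cj0.
  by apply: eq_bigl => k; rewrite in_setT.
split=> //; exists 0%N, (fun=> I); split=> //; right; split.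
  by split=> //; exists (fun x => \sum_(0 <= k < N) I k x).
move=> k; exists (cj (K k)).
  split; first exact: cj_normal_cp.
  by apply: cj_bimodule => //; exact: (vn_adj commA).
exists (cj (V k)) => //; split; first by split; [exact: cj_normal_cp|].
have [AV _ _] := UV k.
by apply: (cj_bimodule (C := commutant A)); rewrite vnA.2//; exact: vn_adj.
Qed.

Let S : set H := [set a psi | a in A].

Lemma trace_subspace : vsubspace S.
Proof.
split; first by exists 0; [exact: vn0|].
move=> c _ _ [a Aa <-] [b Ab <-]; exists (c *: a + b) => //.
by apply: vnD => //; exact: vnZ.
Qed.

Lemma nr_unitary_psi (a v : bop H) : A a -> unitary_in A v -> nr (a (adj v psi)) = nr (a psi).
Proof.
move=> Aa Uv; have [Av _ _] := Uv; congr Num.sqrt.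
rewrite (trace_swap_sq vnA trA Aa (vn_adj vnA Av)) adjK.
by rewrite -nr_sqr (unitary_nr _ Uv) nr_sqr -(trace_adj_sq vnA trA Aa).
Qed.

(** Right multiplication by [adj v], that is [a psi] to [a (adj v psi)], is isometric by the trace
    property and commutes with [A]; [T] is [t] after it. The value at [psi] is [t (adj v psi)], so
    applying [v] afterwards gives [t psi]. *)
Lemma twisted_op (t v : bop H) (C : R) : commutant A t -> unitary_in A v -> 0 <= C ->
  (forall u, nr (t u) <= C * nr u) -> exists T : bop H,
  [/\ commutant A T, forall a, A a -> T (a psi) = a (t (adj v psi)),
      forall u, vorth S u -> T u = 0 & forall u, nr (T u) <= C * nr u].
Proof.
move=> /commutantP Ct Uv C0 tC.
pose G (u w : H) := exists a, [/\ A a, u = a psi & w = a (t (adj v psi))].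
have [||u w [a [Aa -> ->]]|T [TG T0 TC]] := @extend_bop _ _ G C _ C0.
- by exists 0; split=> //; exact: vn0.
- move=> c u w u' w' [a [Aa -> ->]] [b [Ab -> ->]]; exists (c *: a + b); split=> //.
  by apply: vnD => //; exact: vnZ.
- by rewrite Ct// -(nr_unitary_psi Aa Uv).
have Ta a : A a -> T (a psi) = a (t (adj v psi)) by move=> Aa; apply: TG; exists a.
have TS u : vorth S u -> T u = 0.
  by move=> hu; apply: T0 => _ [w [a [Aa -> _]]]; apply: hu; exists a.
exists T; split=> //; apply/commutantP => b Ab u.
have [P [Pc Po PS PO Psa]] := projection_op trace_subspace.
have -> : u = P u + (u - P u) by rewrite addrC subrK.
rewrite [T (P u + _)]bopuD (TS _ (Po u)) addr0 bopuD bopuD [T (b (u - _))]TS ?addr0; last first.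
  move=> _ [a Aa <-]; rewrite -adjr -bopM; apply: Po; exists (bop_mul (adj b) a) => //.
  by apply: vnM => //; exact: vn_adj.
have := @bop_closure_eq _ _ S (bop_mul b T) (bop_mul T b) _ _ (Pc u); rewrite !bopM; apply.
move=> _ [a Aa <-]; rewrite !bopM Ta// -(bopM b a psi) Ta ?bopM//; exact: vnM.
Qed.

(** Twisting by [v] conjugates the density: if [y psi] stands for [adj t (t psi)], then [adj v y v]
    at [psi] stands for [adj T (T psi)]. The closeness of [y] is tested only on vectors [a psi],
    since [adj t (t psi)] may have a component orthogonal to them. *)
Lemma twisted_gram (t v T : bop H) y (e : R) : commutant A t -> unitary_in A v -> A y -> 0 <= e ->
  (forall a, A a -> T (a psi) = a (t (adj v psi))) -> (forall u, vorth S u -> T u = 0) ->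
  (forall a, A a -> Num.sqrt (normc2 '[adj t (t psi) - y psi, a psi]) <= e * nr (a psi)) ->
  nr (adj T (T psi) - adj v (y (v psi))) <= e.
Proof.
move=> /commutantP Ct Uv Ay e0 Ta TS hy; have [Av v1 v2] := Uv; have Av' := vn_adj vnA Av.
apply: (@vclosure_bound _ _ S) => //.
  have [P [Pc Po PS PO Psa]] := projection_op trace_subspace.
  have PT u : P (adj T u) = adj T u.
    apply: ip_inj => w; rewrite Psa !adjl.
    by apply/eqP; rewrite eq_sym -subr_eq0 -ipBr -bopuB TS ?ip0r//; exact: Po.
  rewrite addrC -scaleN1r; apply: vclosureP; first exact: trace_subspace.
    apply: sub_vclosure; exists (bop_mul (adj v) (bop_mul y v)) => //.
    by do 2?apply: vnM.
  by rewrite -PT.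
move=> _ [a Aa <-].
(* The pairing with [a psi] becomes the untwisted pairing with [b psi], and [b psi] has the norm of
   [a psi]. *)
pose b := bop_mul v (bop_mul a (adj v)).
have Ab : A b by do 2?apply: vnM.
have -> : '[adj T (T psi) - adj v (y (v psi)), a psi] = '[adj t (t psi) - y psi, b psi].
  rewrite !ipBl !adjl; congr (_ - _).
    have T1 : T psi = t (adj v psi) by have := Ta _ (vn1 vnA); rewrite !bop1E.
    by rewrite T1 Ta// -(Ct _ Av') adjl -!(Ct _ Ab) /b !bopM.
  have Aa' := vn_adj vnA Aa.
  have tr := trA.2 (bop_mul (adj a) (bop_mul (adj v) y)) v (vnM vnA Aa' (vnM vnA Av' Ay)) Av.
  by rewrite !bopM !adjl in tr; rewrite tr -adjr !adjl /b !bopM.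
apply: le_trans (hy b Ab) _; rewrite ler_wpM2l// /b !bopM (unitary_nr _ Uv).
by rewrite nr_unitary_psi.
Qed.

End Protocol.

(** * Error of the conversion protocol *)

Section Conversion.
Context (R : realType) (H : hilbertType R).
Implicit Types (u w xi : H) (x y z h s t v : bop H).
Local Notation re := (@complex.Re R).
Local Notation "'[ u , v ]" := (inner H u v).

Variables (A : set (bop H)) (psi : H).
Hypotheses (vnA : von_neumann_algebra A) (trA : tracial_vector A psi).
Hypothesis facA : A `&` commutant A = [set c *: bop1 H | c in [set: R[i]]].

Let commA := comm_vn vnA.
Let S : set H := [set a psi | a in A].

(** Choose [y] in [A] with [y psi] close to the projection of [adj t (t psi)] and average [y]
    instead. Three errors of [e / 4] occur: passing from the [T p.2] to [y], averaging [y], and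
    replacing [tau(y)] by [sq (t psi) = 1]. *)
Lemma twisted_average t (C e : R) : commutant A t -> sq (t psi) = 1 -> 0 <= C -> 0 < e ->
  (forall u, nr (t u) <= C * nr u) ->
  exists (l : seq (R * bop H)) (T : bop H -> bop H),
  [/\ admissible A l,
      forall p, p \in l -> [/\ commutant A (T p.2), T p.2 psi = t (adj p.2 psi) &
        forall u, nr (T p.2 u) <= C * nr u] &
      nr (\sum_(p <- l) p.1%:C *: adj (T p.2) (T p.2 psi) - psi) <= e].
Proof.
move=> Ct t1 C0 e0 tC.
have [P [Pc Po PS PO Psa]] := projection_op (trace_subspace psi vnA).
have d0 : 0 < e / 4 by rewrite divr_gt0.
have [_ [y Ay <-] yh] := Pc (adj t (t psi)) _ d0.
have hy a : A a -> Num.sqrt (normc2 '[adj t (t psi) - y psi, a psi]) <= e / 4 * nr (a psi).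
  move=> Aa; have -> : '[adj t (t psi) - y psi, a psi] = '[P (adj t (t psi)) - y psi, a psi].
    by rewrite !ipBl Psa (PS (a psi))//; exists a.
  by apply: le_trans (normc2_ip_le _ _) _; rewrite ler_wpM2r ?nr_ge0 ?ltW.
have [l [al hl]] := averaging vnA trA facA Ay d0.
(* The conditional form, with value 0 outside the unitaries, allows a choice over all [v]. *)
have ex v : exists T : bop H, unitary_in A v ->
    [/\ commutant A T, T psi = t (adj v psi), forall u, nr (T u) <= C * nr u &
      nr (adj T (T psi) - adj v (y (v psi))) <= e / 4].
  have [Uv|nU] := pselect (unitary_in A v); last by exists 0.
  have [T [CT Ta TS TC]] := twisted_op vnA trA Ct Uv C0 tC; exists T => _; split=> //.
    by have := Ta _ (vn1 vnA); rewrite !bop1E.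
  exact: (twisted_gram vnA trA Ct Uv Ay (ltW d0) Ta TS hy).
have [T TP] := choice ex; exists l, T; split=> // [p /al.1[_ /TP[]]//|].
have np : nr psi = 1 by rewrite /nr trA.1 sqrtr1.
set a := \sum_(p <- l) _.
have h1 : nr (a - average l y psi) <= e / 4.
  rewrite averageE /a -sumrB; apply: le_trans (nr_sum _ _ _) _.
  apply: (le_trans (y := \sum_(p <- l) p.1 * (e / 4))); last by rewrite -mulr_suml al.2 mul1r.
  rewrite big_seq [X in _ <= X]big_seq; apply: ler_sum => p /al.1[p0 /TP[_ _ _ hp]].
  by rewrite -scalerBr nrZr// ler_wpM2l.
have h2 : nr ('[y psi, psi] *: psi - psi) <= e / 4.
  rewrite -[X in _ - X]scale1r -scalerBl nrZ np mulr1.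
  have -> : '[y psi, psi] - 1 = - '[adj t (t psi) - y psi, psi].
    by rewrite ipBl adjl ip_sq t1 opprB.
  rewrite ncN; have := hy _ (vn1 vnA); rewrite bop1E np mulr1 //.
have := nr_dist a (average l y psi) psi.
have := nr_dist (average l y psi) ('[y psi, psi] *: psi) psi; lra.
Qed.

(** After outcome [p] and its correction the vector is within [D] of [phi]: [f psi] is within [d] of
    [psi], and on [psi] itself the result would be [t psi]. The vector functionals then differ by at
    most [D * (D + 2)]; the residual outcome [r] weighs at most [d ^+ 2]. *)
Lemma conversion_estimate phi t (C d : R) : commutant A t -> sq (t psi) = 1 -> 0 <= C ->
  (forall u, nr (t u) <= C * nr u) -> nr phi = 1 -> 0 < d ->
  exists2 T, LOCC A T & let D := C * d + nr (t psi - phi) in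
  (functional_norm (predual_map T (vector_functional psi) \- vector_functional phi)%R
    <= (D * (D + 2) + d ^+ 2)%:E)%E.
Proof.
move=> Ct t1 C0 tC nphi d0.
have [l [T [al lT sd]]] := twisted_average Ct t1 C0 d0 tC.
pose s := \sum_(p <- l) p.1%:C *: bop_mul (adj (T p.2)) (T p.2).
have sE u : s u = \sum_(p <- l) p.1%:C *: adj (T p.2) (T p.2 u).
  by rewrite /s bop_sum; apply: eq_bigr => p _; rewrite bopZ bopM.
have sp : pos s.
  rewrite /s big_seq; apply: pos_sum => p /al.1[p0 _]; apply: posZ => // u.
  by rewrite bopM adjl ip_sq lecR sq_ge0.
have Cs : commutant A s.
  rewrite /s big_seq; apply: (vn_sum commA) => p /lT[CT _ _].
  by apply: (vnZ commA); apply: (vnM commA) => //; exact: (vn_adj commA).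
have [g [g1 g2 gp gb]] := inverse1p sp.
have gsa := pos_sa gp.
have Cg : commutant A g.
  apply: (vn_inv commA (x := bop1 H + s)) => [|u|u]; rewrite ?bopD ?bop1E//.
  by apply: (vnD commA) => //; exact: (vn1 commA).
pose f := (2 : R[i]) *: g.
pose r := (2 : R[i]) *: g - bop1 H.
have fE u : f u = (2 : R[i]) *: g u by [].
have rE u : r u = (2 : R[i]) *: g u - u by [].
have c2 : Num.conj (2 : R[i]) = 2 by rewrite rmorph_nat.
have fsa : adj f = f by rewrite /f adj_bopZ gsa c2.
have rsa : adj r = r by rewrite /r adjD adjN adj_bopZ gsa c2 adj_bop1.
have Cf : commutant A f by exact: (vnZ commA).
have Cr : commutant A r by apply: (vnB commA) => //; exact: (vn1 commA).
(* In this form [r psi] is visibly small, as [s psi] is close to [psi] and [g] is a contraction. *)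
have rg u : r u = g (u - s u).
  rewrite rE -{2}(g2 u) bopuD bopuB scaler_nat mulr2n.
  by rewrite opprD addrA addrK.
have fr u : f u - u = r u by [].
clearbody f r.
have one u : f (s (f u)) + r (r u) = u.
  rewrite !fE !rE !bopuZ bopuB bopuZ.
  (* The identity expands to [4 g s g + 4 g^2 - 4 g + 1 = 1], so this one relation suffices. *)
  have e : g u = g (s (g u)) + g (g u) by rewrite -bopuD addrC g1.
  apply: ip_inj => w; have := congr1 (fun x : H => '[x, w]) e => /=.
  rewrite ipDl => {}e.
  by rewrite !(ipDl, ipNl, ipZl) e; ring.
pose p_ k := nth (0, bop1 H) l k.
(* Index [size l] is the residual outcome; [nth] returns its default there, so the correction is the
   identity. *)
pose V k := (p_ k).2.
pose K k := if (k < size l)%N then (Num.sqrt (p_ k).1)%:C *: bop_mul (T (V k)) f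
  else if k == size l then r else 0.
pose N := (size l).+1.
have UV k : unitary_in A (V k).
  rewrite /V /p_; have [kl|lk] := ltnP k (size l); last by rewrite nth_default//; exact: unitary_bop1.
  by have [_] := al.1 _ (mem_nth (0, bop1 H) kl).
have CK k : commutant A (K k).
  rewrite /K; case: ifP => kl.
    have [CT _ _] := lT _ (mem_nth (0, bop1 H) kl).
    by apply: (vnZ commA); exact: (vnM commA).
  by case: ifP => // _; exact: (vn0 commA).
have K0 k : (N <= k)%N -> K k = 0.
  by move=> Nk; rewrite /K ltnNge ltnW//= gtn_eqF.
have KE k u : (k < size l)%N -> K k u = (Num.sqrt (p_ k).1)%:C *: T (V k) (f u).
  by move=> kl; rewrite /K kl bopZ bopM.
have Kl : K (size l) = r by rewrite /K ltnn eqxx.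
have sumE (V' : nmodType) (F : R * bop H -> V') : \sum_(p <- l) F p = \sum_(0 <= k < size l) F (p_ k).
  by rewrite (big_nth (0, bop1 H)).
have cr (a : R) : Num.conj (a%:C : R[i]) = a%:C := conjc_real a.
have sqr2 (a : R) : 0 <= a -> (Num.sqrt a)%:C * (Num.sqrt a)%:C = a%:C :> R[i].
  by move=> a0; rewrite -rmorphM -expr2 /= sqr_sqrtr.
have pk0 k : (k < size l)%N -> 0 <= (p_ k).1.
  by move=> kl; have [] := al.1 _ (mem_nth (0, bop1 H) kl).
have K1 u : \sum_(0 <= k < N) adj (K k) (K k u) = u.
  rewrite /N big_nat_recr//= Kl rsa -[RHS](one u); congr (_ + _).
  rewrite sE sumE bopu_sum big_nat_cond [RHS]big_nat_cond; apply: eq_bigr => k /andP[/andP[_ kl] _].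
  rewrite KE// /K kl adj_bopZ adjM fsa bopZ bopM !bopuZ scalerA cr; congr (_ *: _).
  by rewrite sqr2// pk0.
exists (fun x => \sum_(0 <= k < N) cj (K k) (cj (V k) x)).
  exact: local_instrument_LOCC.
move=> D; apply: functional_norm_le => x xc.
rewrite /predual_map /vector_functional /=.
pose zeta k := V k (T (V k) (f psi)).
have wE : '[(\sum_(0 <= k < N) cj (K k) (cj (V k) x)) psi, psi] - '[x phi, phi] =
    \sum_(0 <= k < size l) (p_ k).1%:C * ('[x (zeta k), zeta k] - '[x phi, phi]) +
    '[x (V (size l) (r psi)), V (size l) (r psi)].
  rewrite bop_sum ip_suml /N big_nat_recr//= Kl !adjl addrAC; congr (_ + _).
  under [RHS]eq_bigr do rewrite mulrBr.
  rewrite sumrB -mulr_suml -rmorph_sum -(sumE _ (fun p => p.1)) al.2 mul1r; congr (_ - _).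
  rewrite big_nat_cond [RHS]big_nat_cond; apply: eq_bigr => k /andP[/andP[_ kl] _].
  rewrite !adjl KE// !bopuZ ipZl ipZr cr mulrA sqr2 ?pk0//.
have p1 : nr psi = 1 by rewrite /nr trA.1 sqrtr1.
have rd : nr (r psi) <= d.
  by rewrite rg; apply: le_trans (gb _) _; rewrite nrBC sE.
rewrite -[X in normc2 X]/('[_, _] - _) wE; apply: le_trans (ncD _ _) _; apply: lerD.
  apply: le_trans (nc_sum _ _ _) _.
  apply: (le_trans (y := \sum_(0 <= k < size l) (p_ k).1 * (D * (D + 2)))); last first.
    by rewrite -mulr_suml -(sumE _ (fun p => p.1)) al.2 mul1r.
  rewrite big_nat_cond [X in _ <= X]big_nat_cond; apply: ler_sum => k /andP[/andP[_ kl] _].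
  rewrite normc2M normc2_real sqrtrM ?sqr_ge0// sqrtr_sqr ger0_norm ?pk0// ler_wpM2l ?pk0//.
  have [CT Tp TC] := lT _ (mem_nth (0, bop1 H) kl).
  have zd : nr (zeta k - phi) <= D.
    have h1 : V k (T (V k) psi) = t psi.
      have [AV _ VV] := UV k.
      by rewrite /V Tp ((commutantP _ _).1 Ct _ AV) VV.
    apply: le_trans (nr_dist _ (t psi) _) _; rewrite lerD2r -h1 -!bopuB.
    rewrite (unitary_nr _ (UV k)) fr; apply: le_trans (TC _) _.
    by rewrite ler_wpM2l.
  apply: le_trans (ip_diff_le _ _ xc) _.
  have D0 : 0 <= D := le_trans (nr_ge0 _) zd.
  have : nr (zeta k) <= D + 1.
    by have := nr_dist (zeta k) phi 0; rewrite !subr0 nphi; lra.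
  rewrite nphi; have := nr_ge0 (zeta k - phi); have := nr_ge0 (zeta k); nra.
apply: le_trans (normc2_ip_le _ _) _.
have vr : nr (V (size l) (r psi)) = nr (r psi) := unitary_nr _ (UV _).
have := xc (V (size l) (r psi)); rewrite vr.
have := nr_ge0 (r psi); have := nr_ge0 (x (V (size l) (r psi))); nra.
Qed.

Lemma trace_vector_convertible phi : `|phi| = 1 -> approx_convertible A psi phi.
Proof.
move=> /norm1_sq phi1 eps eps0.
have nphi : nr phi = 1 by rewrite /nr phi1 sqrtr1.
(* The final error is at most [7 * e0]: [D <= 2 * e0 <= 1] gives [D * (D + 2) <= 6 * e0], and
   [d ^+ 2 <= e0]. *)
pose e0 := Num.min (2^-1) (eps / 16).
have e00 : 0 < e0 by rewrite lt_min invr_gt0 ltr0n divr_gt0.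
have e0a : e0 <= 2^-1 by rewrite ge_min lexx.
have e0b : e0 <= eps / 16 by rewrite ge_min lexx orbT.
have e2 : 0 < e0 / 2 by rewrite divr_gt0.
have [b Cb bphi] := commutant_dense vnA trA facA phi e2.
set m := nr (b psi).
have m1 : `|m - 1| <= e0 / 2.
  have := nr_dist (b psi) phi 0; have := nr_dist phi (b psi) 0; rewrite !subr0 nphi -/m (nrBC phi).
  by rewrite ler_norml => *; apply/andP; split; lra.
have m0 : 0 < m by move: m1; rewrite ler_norml => /andP[]; lra.
(* Normalising moves [b psi] by [|m - 1|], at most [e0 / 2], so [t psi] is within [e0] of [phi]. *)
pose t := m^-1%:C *: b.
have Ct : commutant A t by exact: (vnZ commA).
have mi : 0 <= m^-1 by rewrite invr_ge0 ltW.
have nt : nr (t psi) = 1 by rewrite /t bopZ nrZr// mulVf// gt_eqF.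
have t1 : sq (t psi) = 1 by rewrite -nr_sqr nt expr1n.
have tb : nr (t psi - b psi) = `|m - 1|.
  rewrite /t bopZ -[X in _ - X]scale1r -scalerBl nrZ -(rmorph1 (real_complex R)) -rmorphB /=.
  rewrite normc2_real sqrtr_sqr -/m -{2}[m]gtr0_norm// -normrM mulrBl mulVf ?gt_eqF// mul1r.
  exact: distrC.
have tphi : nr (t psi - phi) <= e0.
  by have := nr_dist (t psi) (b psi) phi; rewrite tb; lra.
have [C C0 tC] := bop_bounded t.
pose d := Num.min e0 (e0 / C).
have d0 : 0 < d by rewrite lt_min e00 divr_gt0.
have da : d <= e0 by rewrite ge_min lexx.
have db : C * d <= e0 by rewrite mulrC -ler_pdivlMr// ge_min lexx orbT.
have [T LT hT] := conversion_estimate Ct t1 (ltW C0) tC nphi d0.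
exists T => //; apply: le_lt_trans hT _; rewrite lte_fin.
have n0 := nr_ge0 (t psi - phi); have Cd0 : 0 <= C * d by rewrite mulr_ge0 ?ltW.
set D := C * d + nr (t psi - phi).
have D2 : D <= 2 * e0 by rewrite /D; lra.
have D0 : 0 <= D by rewrite /D; lra.
have h1 : D * (D + 2) <= 2 * e0 * 3 by nra.
have h2 : d ^+ 2 <= e0 by nra.
lra.
Qed.

End Conversion.

Theorem proposition6p3 (R : realType) (H : hilbertType R) (A : set (bop H))
    (sepH : separable H) (A_II1 : II1_factor A) :
  (forall psi : H, trace_vector A psi ->
     forall phi : H, `|phi| = 1 -> approx_convertible A psi phi) /\
  ((exists psi0 : H, trace_vector A psi0) ->
   forall psi : H, `|psi| = 1 ->
     (forall phi : H, `|phi| = 1 -> approx_convertible A psi phi) ->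
     trace_vector A psi).
Proof.
have [[vnA _ facA] _ _] := A_II1; split.
  move=> psi tv; exact: (trace_vector_convertible vnA (trace_tracial vnA tv) facA).
move=> [psi0 tv] psi p1 conv; have [p01 _] := tv.
exact: (convertible_trace_vector sepH vnA tv p1 (conv psi0 p01)).
Qed.
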